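(* Every orthoplicial Apollonian packing contains a tetrahedral, an octahedral and a cubical Apollonian section, i.e. Apollonian sections algebraically equivalent, respectively, to a tetrahedral, an octahedral and a cubical Apollonian disk packing.
   Context: $\widehat{\mathbb{R}^d}=\mathbb{R}^d\cup\{\infty\}$, identified with $\mathbb{S}^d\subset\mathbb{E}^{d+1}$ by stereographic projection. A $d$-ball is a closed ball, the closure of the complement of an open ball, or a closed half-space of $\widehat{\mathbb{R}^d}$. For a $(d+1)$-polytope $\mathcal{P}$ with vertices outside $\mathbb{S}^d$, each vertex $v$ determines the spherical cap of points of $\mathbb{S}^d$ visible from $v$, whose stereographic image is a $d$-ball $b_v$; $\mathsf{B}(\mathcal{P})=\{b_v\}$. $\mathcal{P}$ is edge-scribed if all its edges are tangent to $\mathbb{S}^d$. A polytopal packing with tangency polytope $\mathcal{P}$ is $\mathcal{B}_\mathcal{P}=\mu(\mathsf{B}(\mathcal{P}))$ with $\mathcal{P}$ edge-scribed and $\mu$ Möbius; its dual is $\mathcal{B}_\mathcal{P}^*=\mu(\mathsf{B}(\mathcal{P}^* ))$, $\mathcal{P}^*$ the polar. The Apollonian group $\mathsf{A}(\mathcal{B}_\mathcal{P})$ is generated by the inversions in the boundary spheres of the balls of $\mathcal{B}_\mathcal{P}^*$ and the Apollonian packing is $\Omega(\mathcal{B}_\mathcal{P})=\{g(b):g\in\mathsf{A}(\mathcal{B}_\mathcal{P}),b\in\mathcal{B}_\mathcal{P}\}$. It is tetrahedral/octahedral/cubical ($d=2$) if $\mathcal{P}$ is a tetrahedron/octahedron/cube,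 and orthoplicial ($d=3$) if $\mathcal{P}$ is a $4$-dimensional cross polytope. An Apollonian section of $\Omega(\mathcal{B}_\mathcal{P})$ is a set $\Gamma\cdot X=\{g(b):g\in\Gamma,b\in X\}$ with $\Gamma<\mathsf{A}(\mathcal{B}_\mathcal{P})$ a subgroup and $X\subseteq\mathcal{B}_\mathcal{P}$ (so $\Omega(\mathcal{B}_\mathcal{P})$ itself is one). Two Apollonian sections $\Gamma\cdot X$ and $\Gamma'\cdot X'$ are algebraically equivalent if there are a group isomorphism $\phi:\Gamma\to\Gamma'$ and a bijection $\psi:\Gamma\cdot X\to\Gamma'\cdot X'$ with $\psi(g\cdot b)=\phi(g)\cdot\psi(b)$ for all $g\in\Gamma$, $b\in X$. *)

(* Defs.v *)
From HB Require Import structures.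
From mathcomp Require Import all_boot all_order all_algebra.
From mathcomp Require Import all_classical all_reals all_analysis.

Set Implicit Arguments.
Unset Strict Implicit.
Unset Printing Implicit Defensive.

Import Order.TTheory GRing.Theory Num.Theory.
Import numFieldNormedType.Exports.

Local Open Scope classical_set_scope.
Local Open Scope ring_scope.

(* The library norm on ['rV_n] is the sup norm; the Euclidean structure is set
   up here. *)
Definition dotv (R : realType) (n : nat) (u v : 'rV[R]_n) : R :=
  \sum_(i < n) u 0 i * v 0 i.

Definition sqnorm (R : realType) (n : nat) (u : 'rV[R]_n) : R := dotv u u.

Definition usphere (R : realType) (n : nat) : set 'rV[R]_n :=
  [set x | sqnorm x = 1].
Arguments usphere : clear implicits.

Definition line (R : realType) (n : nat) (u v : 'rV[R]_n) : set 'rV[R]_n :=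
  [set x | exists t : R, x = (1 - t) *: u + t *: v].

Definition segment (R : realType) (n : nat) (u v : 'rV[R]_n) : set 'rV[R]_n :=
  [set x | exists t : R, 0 <= t <= 1 /\ x = (1 - t) *: u + t *: v].

Definition conv_hull (R : realType) (n : nat) (s : seq 'rV[R]_n) :
    set 'rV[R]_n :=
  [set x | exists w : 'I_(size s) -> R,
     [/\ forall i, 0 <= w i, \sum_i w i = 1 & x = \sum_i w i *: s`_i]].

(* Full-dimensional polytopes: the second condition says that the set lies in
   no affine hyperplane. *)
Definition polytope (R : realType) (n : nat) (P : set 'rV[R]_n) : Prop :=
  (exists s : seq 'rV[R]_n, P = conv_hull s) /\
  (forall (a : 'rV[R]_n) (c : R), (forall x, P x -> dotv a x = c) -> a = 0).

(* The improper faces are included: [a = 0] with [c = 0] gives [P], and with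
   [c = 1] the empty face. *)
Definition faces (R : realType) (n : nat) (P : set 'rV[R]_n) :
    set (set 'rV[R]_n) :=
  [set F | exists (a : 'rV[R]_n) (c : R),
     (forall x, P x -> dotv a x <= c) /\ F = P `&` [set x | dotv a x = c]].

Definition vertices (R : realType) (n : nat) (P : set 'rV[R]_n) :
    set 'rV[R]_n :=
  [set v | faces P [set v]].

Definition is_edge (R : realType) (n : nat) (P : set 'rV[R]_n)
    (u v : 'rV[R]_n) : Prop :=
  u <> v /\ faces P (segment u v).

(* Isomorphism of face lattices. *)
Definition comb_equiv (R : realType) (m n : nat)
    (P : set 'rV[R]_m) (Q : set 'rV[R]_n) : Prop :=
  exists f : set 'rV[R]_m -> set 'rV[R]_n,
    set_bij (faces P) (faces Q) f /\
    (forall F G, faces P F -> faces P G -> (F `<=` G <-> f F `<=` f G)).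

Definition polar (R : realType) (n : nat) (P : set 'rV[R]_n) : set 'rV[R]_n :=
  [set y | forall x, P x -> dotv x y <= 1].

(* The tangency point has to lie on the edge itself, not only on the line
   spanned by it. *)
Definition tangent_edge (R : realType) (n : nat) (u v : 'rV[R]_n) : Prop :=
  exists x, segment u v x /\ line u v `&` usphere R n = [set x].

Definition edge_scribed (R : realType) (n : nat) (P : set 'rV[R]_n) : Prop :=
  [/\ polytope P,
      forall v, vertices P v -> 1 < sqnorm v
    & forall u v, is_edge P u v -> tangent_edge u v].

Definition vec3 (R : realType) (a b c : R) : 'rV[R]_3 :=
  \row_(i < 3) [:: a; b; c]`_i.

Definition std_tetrahedron (R : realType) : set 'rV[R]_3 :=
  conv_hull [:: vec3 1 1 1; vec3 1 (-1) (-1); vec3 (-1) 1 (-1);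
                vec3 (-1) (-1) 1].
Arguments std_tetrahedron : clear implicits.

Definition std_cube (R : realType) (n : nat) : set 'rV[R]_n :=
  [set x | forall i, -1 <= x 0 i <= 1].
Arguments std_cube : clear implicits.

Definition std_cross_polytope (R : realType) (n : nat) : set 'rV[R]_n :=
  conv_hull ([seq delta_mx 0 i | i <- enum 'I_n] ++
             [seq - delta_mx 0 i | i <- enum 'I_n]).
Arguments std_cross_polytope : clear implicits.

(* [None] is the point at infinity. *)
Definition hat (R : realType) (d : nat) : Type := option 'rV[R]_d.

(* Projection from the north pole (0, ..., 0, 1), which is sent to infinity. *)
Definition stereo (R : realType) (d : nat) (x : 'rV[R]_d.+1) : hat R d :=
  if x 0 ord_max == 1 then None
  else Some (\row_(i < d) (x 0 (lift ord_max i) / (1 - x 0 ord_max))).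

Definition in_ball (R : realType) (d : nat) (c : 'rV[R]_d) (r : R) :
    set (hat R d) :=
  [set p | if p is Some x then sqnorm (x - c) <= r ^+ 2 else False].

Definition out_ball (R : realType) (d : nat) (c : 'rV[R]_d) (r : R) :
    set (hat R d) :=
  [set p | if p is Some x then r ^+ 2 <= sqnorm (x - c) else True].

Definition half_space (R : realType) (d : nat) (a : 'rV[R]_d) (t : R) :
    set (hat R d) :=
  [set p | if p is Some x then dotv a x <= t else True].

Definition sphere_inv (R : realType) (d : nat) (c : 'rV[R]_d) (r : R)
    (p : hat R d) : hat R d :=
  if p is Some x then
    if x == c then None
    else Some (c + (r ^+ 2 / sqnorm (x - c)) *: (x - c))
  else Some c.

Definition hyperplane_inv (R : realType) (d : nat) (a : 'rV[R]_d) (t : R)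
    (p : hat R d) : hat R d :=
  if p is Some x then Some (x - (2 * (dotv a x - t) / sqnorm a) *: a)
  else None.

(* [ball_inversion b f]: the set [b] is a d-ball and [f] is the inversion in
   its boundary sphere. *)
Variant ball_inversion (R : realType) (d : nat) :
    set (hat R d) -> (hat R d -> hat R d) -> Prop :=
  | InBallInversion (c : 'rV[R]_d) (r : R) of 0 < r :
      ball_inversion (in_ball c r) (sphere_inv c r)
  | OutBallInversion (c : 'rV[R]_d) (r : R) of 0 < r :
      ball_inversion (out_ball c r) (sphere_inv c r)
  | HalfSpaceInversion (a : 'rV[R]_d) (t : R) of a != 0 :
      ball_inversion (half_space a t) (hyperplane_inv a t).

Definition subgroup (T : Type) (G : set (T -> T)) : Prop :=
  [/\ G id,
      forall g h, G g -> G h -> G (g \o h)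
    & forall g, G g -> exists h, [/\ G h, cancel g h & cancel h g]].

Inductive generated (T : Type) (S : set (T -> T)) : (T -> T) -> Prop :=
  | gen_in g : S g -> generated S g
  | gen_id : generated S id
  | gen_comp g h : generated S g -> generated S h -> generated S (g \o h)
  | gen_inv g h :
      generated S g -> cancel g h -> cancel h g -> generated S h.

Definition ball_orbit (T : Type) (G : set (T -> T)) (X : set (set T)) :
    set (set T) :=
  [set B | exists g b, [/\ G g, X b & B = g @` b]].

Definition mobius (R : realType) (d : nat) : set (hat R d -> hat R d) :=
  generated [set f | exists b, ball_inversion b f].
Arguments mobius : clear implicits.

(* [x] is visible from [v] when the segment from [v] to [x] meets the closed
   unit ball only at [x]. *)
Definition visible_cap (R : realType) (n : nat) (v : 'rV[R]_n) :
    set 'rV[R]_n :=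
  [set x | usphere R n x /\
     forall t : R, 0 < t <= 1 -> 1 < sqnorm ((1 - t) *: x + t *: v)].

Definition ball_arrangement (R : realType) (d : nat) (P : set 'rV[R]_d.+1) :
    set (set (hat R d)) :=
  [set (@stereo R d) @` visible_cap v | v in vertices P].

(* [interior P 0] makes the polar of [P] a polytope again. *)
Definition polytopal (R : realType) (d : nat) (P : set 'rV[R]_d.+1)
    (mu : hat R d -> hat R d) : Prop :=
  [/\ edge_scribed P, interior P 0 & mobius R d mu].

Definition packing (R : realType) (d : nat) (P : set 'rV[R]_d.+1)
    (mu : hat R d -> hat R d) : set (set (hat R d)) :=
  [set mu @` b | b in ball_arrangement P].

Definition dual_packing (R : realType) (d : nat) (P : set 'rV[R]_d.+1)
    (mu : hat R d -> hat R d) : set (set (hat R d)) :=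
  [set mu @` b | b in ball_arrangement (polar P)].

Definition apollonian_group (R : realType) (d : nat) (P : set 'rV[R]_d.+1)
    (mu : hat R d -> hat R d) : set (hat R d -> hat R d) :=
  generated [set f | exists b, dual_packing P mu b /\ ball_inversion b f].

Definition apollonian_packing (R : realType) (d : nat) (P : set 'rV[R]_d.+1)
    (mu : hat R d -> hat R d) : set (set (hat R d)) :=
  ball_orbit (apollonian_group P mu) (packing P mu).

Definition tetrahedral (R : realType) (P : set 'rV[R]_3)
    (mu : hat R 2 -> hat R 2) : Prop :=
  polytopal P mu /\ comb_equiv P (std_tetrahedron R).

Definition octahedral (R : realType) (P : set 'rV[R]_3)
    (mu : hat R 2 -> hat R 2) : Prop :=
  polytopal P mu /\ comb_equiv P (std_cross_polytope R 3).

Definition cubical (R : realType) (P : set 'rV[R]_3)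
    (mu : hat R 2 -> hat R 2) : Prop :=
  polytopal P mu /\ comb_equiv P (std_cube R 3).

Definition orthoplicial (R : realType) (P : set 'rV[R]_4)
    (mu : hat R 3 -> hat R 3) : Prop :=
  polytopal P mu /\ comb_equiv P (std_cross_polytope R 4).

(* The pair [(G, X)] presents the section [ball_orbit G X]. *)
Definition apollonian_section (R : realType) (d : nat) (P : set 'rV[R]_d.+1)
    (mu : hat R d -> hat R d) (G : set (hat R d -> hat R d))
    (X : set (set (hat R d))) : Prop :=
  [/\ subgroup G, G `<=` apollonian_group P mu & X `<=` packing P mu].

Definition alg_equiv (T T' : Type) (G : set (T -> T)) (X : set (set T))
    (G' : set (T' -> T')) (X' : set (set T')) : Prop :=
  exists (phi : (T -> T) -> (T' -> T')) (psi : set T -> set T'),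
    [/\ set_bij G G' phi,
        forall g h, G g -> G h -> phi (g \o h) = phi g \o phi h,
        set_bij (ball_orbit G X) (ball_orbit G' X') psi
      & forall g b, G g -> X b -> psi (g @` b) = phi g @` psi b].

(* Main.v *)
(* A ball of [hat R d] is a unit space-like vector of Lorentz space [lor R d], and
   the inversion in its boundary is the Lorentz reflection in that vector.  For an
   edge-scribed [P] of the type of the 4-dimensional cross-polytope, tangency fixes
   the Gram matrix of the eight vertex vectors: they are [C + U_i] and [C - U_i]
   for a time-like [C] with [C^2 = -1] and orthogonal [U_i] with [U_i^2 = 2], and
   the facet vectors are [C + (+- U_1 +- U_2 +- U_3 +- U_4) / 2].  Each section is
   obtained by cutting with a 2-sphere, that is, with the orthogonal complement of
   a unit vector [n]; [Gamma] preserves the sphere, and both the isomorphism of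
   groups and the bijection of balls are restriction to it.
   - tetrahedral: [n] is a facet vector, [Gamma] is generated by the reflections in
     the four facets adjacent to that facet, and [X] is the set of its vertices;
   - octahedral: [n = U_4 / sqrt 2], [Gamma] is generated by the products of the two
     commuting reflections in the facets that differ in the sign of [U_4] only, and
     [X] omits the two vertices [C + U_4] and [C - U_4];
   - cubical: [n = (U_1 - U_2 - U_3 + U_4) / sqrt 8], [Gamma] is generated by the
     reflections in three pairs of opposite facets, and [X] consists of all eight
     balls, which meet the sphere at 45 degrees.
   Restriction is injective because of integrality: in the octahedral case the
   parity of a word, in the cubical case the orbit of a disk, is visible modulo 4. *)

Require Import Defs.
From mathcomp Require Import all_boot all_order all_algebra.
From mathcomp Require Import all_classical all_reals all_analysis.
From mathcomp Require Import ring lra zify.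

Set Implicit Arguments.
Unset Strict Implicit.
Unset Printing Implicit Defensive.

Import Order.TTheory GRing.Theory Num.Theory.
Import numFieldNormedType.Exports.

Local Open Scope classical_set_scope.
Local Open Scope ring_scope.

(** * Lorentz model of the conformal sphere *)

(** Algebraic equivalence speaks of maps and point sets of [hat R d], while everything is computed
    in [lor R d]. Two faithfulness facts carry the translation: a map determines its isometry
    ([acts_id_linear]), and a ball determines its unit vector ([cap_inj]). Edge tangency gives the
    product -1 for vertices joined by an edge and says nothing about the four antipodal pairs. Their
    product -3 is forced by dimension: the four vertex vectors of a facet and its polar vector span
    the five-dimensional space, so the opposite vertices can be solved for. Restriction to the
    sphere orthogonal to [n] can lose only the sign of the component along [n]. A word acts on [n]
    by a power of [chi], and a ball has [n]-component [eta]; what has to be shown is that the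
    restricted word or disk determines these. In the tetrahedral case [chi = 1] and [eta = 0], so
    nothing can be lost. In the octahedral case [chi = -1], which calls for the parity of a word; in
    the cubical case the sign of [eta] depends on the vertex, which calls for separating the orbits
    of the disks. *)

Section EuclideanForm.
Variables (R : realType) (n : nat).
Implicit Types u v w : 'rV[R]_n.

Lemma dotvC u v : dotv u v = dotv v u.
Proof. by apply: eq_bigr => i _; rewrite mulrC. Qed.

Lemma dotvDl u v w : dotv (u + v) w = dotv u w + dotv v w.
Proof. by rewrite -big_split; apply: eq_bigr => i _; rewrite mxE mulrDl. Qed.

Lemma dotvZl (a : R) u v : dotv (a *: u) v = a * dotv u v.
Proof. by rewrite /dotv mulr_sumr; apply: eq_bigr => i _; rewrite mxE mulrA. Qed.

Lemma dotvDr u v w : dotv u (v + w) = dotv u v + dotv u w.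
Proof. by rewrite dotvC dotvDl !(dotvC u). Qed.

Lemma dotvZr (a : R) u v : dotv u (a *: v) = a * dotv u v.
Proof. by rewrite dotvC dotvZl dotvC. Qed.

Lemma dotvNl u v : dotv (- u) v = - dotv u v.
Proof. by rewrite -scaleN1r dotvZl mulN1r. Qed.

Lemma dotvNr u v : dotv u (- v) = - dotv u v.
Proof. by rewrite dotvC dotvNl dotvC. Qed.

Lemma dotv0l u : dotv 0 u = 0.
Proof. by rewrite -(scale0r u) dotvZl mul0r. Qed.

Lemma dotv0r u : dotv u 0 = 0.
Proof. by rewrite dotvC dotv0l. Qed.

Lemma dotv_sumr (I : Type) (r : seq I) (F : I -> 'rV[R]_n) u :
  dotv u (\sum_(i <- r) F i) = \sum_(i <- r) dotv u (F i).
Proof.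
by elim: r => [|i r IH]; rewrite ?big_nil ?dotv0r // !big_cons dotvDr IH.
Qed.

Lemma sqnorm_ge0 u : 0 <= sqnorm u.
Proof. by apply: sumr_ge0 => i _; rewrite -expr2 sqr_ge0. Qed.

Lemma sqnorm_eq0 u : sqnorm u = 0 -> u = 0.
Proof.
move=> /eqP; rewrite /sqnorm /dotv psumr_eq0; last first.
  by move=> i _; rewrite -expr2 sqr_ge0.
move=> /allP h; apply/rowP => i; rewrite mxE.
by have := h i (mem_index_enum i); rewrite mulf_eq0 orbb => /eqP.
Qed.

Lemma sqnorm_gt0 u : u != 0 -> 0 < sqnorm u.
Proof.
by move=> u0; rewrite lt_def sqnorm_ge0 andbT; apply: contra u0 => /eqP /sqnorm_eq0 ->.
Qed.

End EuclideanForm.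

Definition dotvE := (dotvDl, dotvDr, dotvZl, dotvZr, dotvNl, dotvNr, dotv0l, dotv0r).

(** Triples [(b, s, t)] with quadratic form [b . b - s t], of signature [(d + 1, 1)]. The scalars
    are stored as ['rV_1] so that the product carries the vector space structure. A ball of centre
    [c] and radius [r] is [(c / r, (|c|^2 - r^2) / r, 1 / r)]: the last coordinate is its
    curvature. *)
Notation lor R d := ('rV[R]_d * 'rV[R]_1 * 'rV[R]_1)%type.

Definition mklor (R : realType) (d : nat) (b : 'rV[R]_d) (s t : R) : lor R d :=
  (b, const_mx s, const_mx t).

Lemma linear_zero (R : realType) (V W : lmodType R) (M : V -> W) :
  linear M -> M 0 = 0.
Proof.
move=> lM; have := lM 1 0 0; rewrite !scale1r addr0.
by rewrite -{1}(addr0 (M 0)) => /addrI <-.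
Qed.

Lemma linear_scale (R : realType) (V W : lmodType R) (M : V -> W) (a : R) x :
  linear M -> M (a *: x) = a *: M x.
Proof. by move=> lM; have := lM a x 0; rewrite (linear_zero lM) !addr0. Qed.

Lemma lor_ext (R : realType) (d : nat) (x y : lor R d) :
  (forall i, x.1.1 0 i = y.1.1 0 i) -> x.1.2 0 0 = y.1.2 0 0 ->
  x.2 0 0 = y.2 0 0 -> x = y.
Proof.
case: x y => [[b s] t] [[b' s'] t'] /= /rowP -> hs ht.
by congr (_, _, _); apply/rowP => i; rewrite ord1.
Qed.

Lemma mklorE (R : realType) (d : nat) (x : lor R d) :
  x = mklor x.1.1 (x.1.2 0 0) (x.2 0 0).
Proof. by apply: lor_ext => [i||]; rewrite ?mxE. Qed.

Ltac lor_expand := apply: lor_ext => [?||]; rewrite /= ?mxE.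
Ltac lor_ring := lor_expand; ring.
Ltac lor_field := lor_expand; field.

Section Lorentz.
Variables (R : realType) (d : nat).
Implicit Types (x y z A B : lor R d) (p q : hat R d).

Definition lf x y : R :=
  dotv x.1.1 y.1.1 - (x.1.2 0 0 * y.2 0 0 + y.1.2 0 0 * x.2 0 0) / 2.

Lemma lfC x y : lf x y = lf y x.
Proof. by rewrite /lf dotvC; congr (_ - _ / _); rewrite addrC. Qed.

Lemma lfDl x y z : lf (x + y) z = lf x z + lf y z.
Proof. by rewrite /lf /= !dotvE !mxE; field. Qed.

Lemma lfZl (a : R) x y : lf (a *: x) y = a * lf x y.
Proof. by rewrite /lf /= !dotvE !mxE; field. Qed.

Lemma lfDr x y z : lf x (y + z) = lf x y + lf x z.
Proof. by rewrite lfC lfDl !(lfC x). Qed.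

Lemma lfZr (a : R) x y : lf x (a *: y) = a * lf x y.
Proof. by rewrite lfC lfZl lfC. Qed.

Lemma lfNl x y : lf (- x) y = - lf x y.
Proof. by rewrite -scaleN1r lfZl mulN1r. Qed.

Lemma lfNr x y : lf x (- y) = - lf x y.
Proof. by rewrite lfC lfNl lfC. Qed.

Lemma lf0l x : lf 0 x = 0.
Proof. by rewrite -(scale0r x) lfZl mul0r. Qed.

Definition null_vec p : lor R d :=
  if p is Some x then mklor x (sqnorm x) 1 else mklor 0 1 0.

Definition cap A : set (hat R d) := [set p | 0 <= lf (null_vec p) A].

Definition refl A x : lor R d := x - (2 * lf x A) *: A.

Definition isometry (M : lor R d -> lor R d) :=
  linear M /\ forall x y, lf (M x) (M y) = lf x y.

(** The factor is required to be positive: this rules out [- M], and it makes the image of a cap the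
    cap of the image vector. *)
Definition acts (M : lor R d -> lor R d) (g : hat R d -> hat R d) :=
  forall p, exists2 l : R, 0 < l & M (null_vec p) = l *: null_vec (g p).

Lemma null_vec_null p : lf (null_vec p) (null_vec p) = 0.
Proof. by case: p => [x|]; rewrite /lf /= !mxE ?dotv0l /sqnorm; field. Qed.

(** Between finite points the product is [- |x - y|^2 / 2]; with infinity it is [- 1 / 2]. *)
Lemma null_vec_lf_neq0 p q : p <> q -> lf (null_vec p) (null_vec q) != 0.
Proof.
case: p q => [x|] [y|] //= pq; rewrite /lf /= !mxE ?dotv0l ?dotv0r.
- have xy : x - y != 0 by rewrite subr_eq0; apply/eqP => xy; apply: pq; rewrite xy.
  have := sqnorm_gt0 xy; rewrite /sqnorm !dotvE (dotvC y x) => h.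
  clear pq; apply/eqP => h0; lra.
- by clear pq; apply/eqP; lra.
- by clear pq; apply/eqP; lra.
Qed.

Lemma null_vec_ray p q (l : R) : null_vec p = l *: null_vec q -> p = q.
Proof.
move=> e; apply: contrapT => /null_vec_lf_neq0 /eqP; apply.
by rewrite e lfZl null_vec_null mulr0.
Qed.

Lemma lf_mklor (b b' : 'rV[R]_d) (s t s' t' : R) :
  lf (mklor b s t) (mklor b' s' t') = dotv b b' - (s * t' + s' * t) / 2.
Proof. by rewrite /lf /= !mxE. Qed.

Lemma scale_mklor (a : R) (b : 'rV[R]_d) (s t : R) :
  a *: mklor b s t = mklor (a *: b) (a * s) (a * t).
Proof. by lor_expand. Qed.

Lemma null_vec_surj z : lf z z = 0 -> exists (l : R) p, z = l *: null_vec p.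
Proof.
rewrite (mklorE z); move: z.1.1 (z.1.2 0 0) (z.2 0 0) => b s t.
rewrite lf_mklor => h; have [t0|t0] := eqVneq t 0.
  exists s, None; rewrite t0 in h *.
  have b0 : b = 0 by apply: sqnorm_eq0; rewrite /sqnorm; lra.
  by rewrite b0 scale_mklor scaler0 mulr1 mulr0.
exists t, (Some (t^-1 *: b)); rewrite scale_mklor mulr1 scalerA mulfV // scale1r.
congr mklor; rewrite /sqnorm !dotvE.
have -> : dotv b b = s * t by lra.
by field.
Qed.

(* The null vectors of [oo], [0] and [x] give explicit coordinates: this is
   what makes a map of [hat R d] determine its Lorentz transformation. *)
Lemma lor_null_decomp (b : 'rV[R]_d) (s t : R) :
  mklor b s t = 1 *: null_vec (Some b) +
    ((t - 1) *: null_vec (Some 0) + ((s - sqnorm b) *: null_vec None + 0)).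
Proof. by rewrite /= /sqnorm dotv0l; lor_ring. Qed.

Lemma refl_isometry A : lf A A = 1 -> isometry (refl A).
Proof.
move=> hA; split=> [a x y|x y]; rewrite /refl.
  by rewrite lfDl lfZl; lor_ring.
by rewrite !(lfDl, lfDr, lfNl, lfNr, lfZl, lfZr) hA (lfC A y); ring.
Qed.

Lemma reflK A : lf A A = 1 -> cancel (refl A) (refl A).
Proof.
move=> hA x; rewrite /refl !(lfDl, lfNl, lfZl) hA -addrA -opprD -scalerDl.
have -> : 2 * lf x A + 2 * (lf x A - 2 * lf x A * 1) = 0 by ring.
by rewrite scale0r subr0.
Qed.

Lemma acts_unique M g h : acts M g -> acts M h -> g = h.
Proof.
move=> ag ah; apply/funext => p.
have [l l0 e] := ag p; have [k k0] := ah p; rewrite e => /esym e'.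
apply/esym/(@null_vec_ray _ _ (k^-1 * l)).
by rewrite -scalerA -e' scalerA mulVf ?lt0r_neq0 // scale1r.
Qed.

Lemma acts_id : acts id id.
Proof. by move=> p; exists 1 => //; rewrite scale1r. Qed.

Lemma isometry_comp M M' : isometry M -> isometry M' -> isometry (M \o M').
Proof.
move=> [lM iM] [lM' iM']; split => [a x y|x y] /=; first by rewrite lM' lM.
by rewrite iM iM'.
Qed.

Lemma acts_comp M M' g g' : linear M ->
  acts M g -> acts M' g' -> acts (M \o M') (g \o g').
Proof.
move=> lM ag ag' p; have [k k0 e] := ag' p; have [l l0 e'] := ag (g' p).
exists (k * l); first exact: mulr_gt0.
by rewrite /= e linear_scale // e' scalerA.
Qed.

Lemma acts_inv M M' g h : linear M' -> cancel M M' -> cancel h g ->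
  acts M g -> acts M' h.
Proof.
move=> lM' MM' hg ag p; have [l l0] := ag (h p); rewrite hg => e.
exists l^-1; first by rewrite invr_gt0.
have := congr1 M' e; rewrite MM' linear_scale // => ->.
by rewrite scalerA mulVf ?lt0r_neq0 // scale1r.
Qed.

Lemma acts_cap M g h A : isometry M -> acts M g -> cancel g h -> cancel h g ->
  g @` cap A = cap (M A).
Proof.
move=> [_ iM] ag gh hg; apply/seteqP; split => [_ [p /= pA <-]|p /= pA].
  have [l l0 e] := ag p; move: pA; rewrite /cap /= -iM e lfZl pmulr_rge0 //.
exists (h p) => //; rewrite /cap /=; have [l l0] := ag (h p); rewrite hg => e.
by rewrite -iM e lfZl pmulr_rge0 //.
Qed.

End Lorentz.

(** If [M] multiplies the null vectors of two distinct points by [k] and [l], invariance of their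
    nonzero product gives [k l = 1]. Three distinct points therefore force positive factors equal to
    1, and null vectors span. Dimension at least one supplies a third point besides 0 and
    infinity. *)
Lemma acts_id_linear (R : realType) (d : nat) (M : lor R d.+1 -> lor R d.+1) :
  isometry M -> acts M id -> M =1 id.
Proof.
move=> [lM iM] aM.
have prod1 p q k l : p <> q -> M (null_vec p) = k *: null_vec p ->
    M (null_vec q) = l *: null_vec q -> k * l = 1.
  move=> pq ep eq; have := iM (null_vec p) (null_vec q).
  rewrite ep eq lfZl lfZr => e; apply: (mulIf (null_vec_lf_neq0 pq)).
  by rewrite -mulrA e mul1r.
have scale1 p q r : p <> q -> q <> r -> p <> r -> M (null_vec p) = null_vec p.
  move=> pq qr pr; have [k k0 ep] := aM p; have [l l0 eq] := aM q.
  have [m m0 er] := aM r; have kl := prod1 _ _ _ _ pq ep eq.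
  have lm := prod1 _ _ _ _ qr eq er; have km := prod1 _ _ _ _ pr ep er.
  have k1 : k = 1.
    have kk : k ^+ 2 = 1.
      by rewrite expr2 -[LHS]mulr1 -lm mulrACA kl km mulr1.
    by apply/eqP; move/eqP: kk; rewrite sqrf_eq1 => /orP[//|/eqP kN];
       rewrite kN oppr_gt0 ltr10 in k0.
  by rewrite ep k1 scale1r.
have fixed p : M (null_vec p) = null_vec p.
  have one0 : (const_mx 1 : 'rV[R]_d.+1) != 0.
    by apply/eqP => /rowP /(_ ord0); rewrite !mxE => /eqP; rewrite oner_eq0.
  have h1 : Some (0 : 'rV[R]_d.+1) <> Some (const_mx 1).
    by case=> e; rewrite -e eqxx in one0.
  case: p => [x|]; last by apply: (@scale1 _ (Some 0) (Some (const_mx 1))).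
  have [->|x0] := eqVneq x 0; first by apply: (@scale1 _ None (Some (const_mx 1))).
  by apply: (@scale1 _ (Some 0) None) => //; case=> e; rewrite e eqxx in x0.
have M0 := linear_zero lM.
by move=> x; rewrite (mklorE x) lor_null_decomp !lM !fixed M0.
Qed.

(** * Balls as unit vectors, inversions as reflections *)

Section BallInversion.
Variables (R : realType) (d : nat).
Implicit Types (A B : lor R d) (c x : 'rV[R]_d) (r : R) (b : set (hat R d)).

Definition in_ball_vec c r : lor R d :=
  mklor (r^-1 *: c) ((sqnorm c - r ^+ 2) / r) r^-1.

Definition half_space_vec (a : 'rV[R]_d) (t : R) : lor R d :=
  (- (Num.sqrt (sqnorm a))^-1) *: mklor a (2 * t) 0.

Lemma in_ball_vec1 c r : 0 < r -> lf (in_ball_vec c r) (in_ball_vec c r) = 1.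
Proof.
move=> r0; have r1 := lt0r_neq0 r0.
by rewrite lf_mklor !dotvE /sqnorm; field.
Qed.

Lemma lf_in_ball_vec c r x : 0 < r ->
  lf (null_vec (Some x)) (in_ball_vec c r) = (r ^+ 2 - sqnorm (x - c)) / (2 * r).
Proof.
move=> r0; have r1 := lt0r_neq0 r0.
by rewrite lf_mklor /sqnorm !dotvE (dotvC c x); field.
Qed.

Lemma in_ballE c r : 0 < r -> in_ball c r = cap (in_ball_vec c r).
Proof.
move=> r0; apply/seteqP; rewrite /in_ball /cap; split => -[x|] //=; last first.
- have ri : 0 < r^-1 by rewrite invr_gt0.
  by rewrite lf_mklor !dotvE; lra.
- by rewrite lf_in_ball_vec // pmulr_lge0 ?subr_ge0 // invr_gt0 mulr_gt0.
- by rewrite lf_in_ball_vec // pmulr_lge0 ?subr_ge0 // invr_gt0 mulr_gt0.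
Qed.

Lemma out_ballE c r : 0 < r -> out_ball c r = cap (- in_ball_vec c r).
Proof.
move=> r0; apply/seteqP; rewrite /out_ball /cap; split => -[x|] //=.
- rewrite lfNr lf_in_ball_vec // -mulNr opprB pmulr_lge0 ?subr_ge0 //.
  by rewrite invr_gt0 mulr_gt0.
- have ri : 0 < r^-1 by rewrite invr_gt0.
  by move=> _; rewrite lfNr lf_mklor !dotvE; lra.
- rewrite lfNr lf_in_ball_vec // -mulNr opprB pmulr_lge0 ?subr_ge0 //.
  by rewrite invr_gt0 mulr_gt0.
Qed.

Lemma acts_sphere_inv c r : 0 < r ->
  acts (refl (in_ball_vec c r)) (sphere_inv c r).
Proof.
move=> r0; have r1 := lt0r_neq0 r0; case=> [x|]; last first.
  exists (r^-2); first by rewrite invr_gt0 exprn_gt0.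
  by rewrite /refl lf_mklor !dotvE; lor_field.
rewrite /refl lf_in_ball_vec //=; have [->|xc] := eqVneq x c.
  exists (r ^+ 2); first by rewrite exprn_gt0.
  by rewrite subrr; lor_expand; rewrite /sqnorm ?dotv0l; field.
have D0 : sqnorm (x - c) != 0 by rewrite lt0r_neq0 // sqnorm_gt0 // subr_eq0.
exists (sqnorm (x - c) / r ^+ 2).
  by rewrite divr_gt0 ?exprn_gt0 // sqnorm_gt0 // subr_eq0.
set D := sqnorm (x - c) in D0 *.
have eD : D = dotv x x - dotv x c *+ 2 + dotv c c.
  by rewrite /D /sqnorm !dotvE (dotvC c x); ring.
lor_expand.
- by field; rewrite ?D0 ?r1.
- rewrite /sqnorm !dotvE (dotvC c x).
  have -> : dotv x x = D + dotv x c *+ 2 - dotv c c by rewrite eD; ring.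
  by field; rewrite ?D0 ?r1.
- by field; rewrite ?D0 ?r1.
Qed.

Lemma half_space_vec1 (a : 'rV[R]_d) t : a != 0 ->
  lf (half_space_vec a t) (half_space_vec a t) = 1.
Proof.
move=> /sqnorm_gt0 a0; rewrite /half_space_vec lfZl lfZr lf_mklor !mulr0 addr0 mul0r subr0.
rewrite -/(sqnorm a) mulrA mulrNN -expr2 exprVn sqr_sqrtr ?mulVf ?lt0r_neq0 //.
exact: ltW.
Qed.

Lemma lf_half_space_vec (a : 'rV[R]_d) t x :
  lf (null_vec (Some x)) (half_space_vec a t) =
  (t - dotv a x) / Num.sqrt (sqnorm a).
Proof.
by rewrite lfZr lf_mklor (dotvC a x); move: (Num.sqrt _)^-1 => u; field.
Qed.

Lemma half_spaceE (a : 'rV[R]_d) t : a != 0 ->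
  half_space a t = cap (half_space_vec a t).
Proof.
move=> /sqnorm_gt0 a0.
have s0 : 0 < (Num.sqrt (sqnorm a))^-1 by rewrite invr_gt0 sqrtr_gt0.
apply/seteqP; rewrite /half_space /cap; split => -[x|] //=.
- by rewrite lf_half_space_vec pmulr_lge0 ?subr_ge0.
- by move=> _; rewrite lfZr lf_mklor dotv0l; lra.
- by rewrite lf_half_space_vec pmulr_lge0 ?subr_ge0.
Qed.

Lemma acts_hyperplane_inv (a : 'rV[R]_d) t : a != 0 ->
  acts (refl (half_space_vec a t)) (hyperplane_inv a t).
Proof.
move=> /sqnorm_gt0 a0.
have s2 : Num.sqrt (sqnorm a) ^+ 2 = dotv a a by rewrite sqr_sqrtr // ltW.
have s0 : Num.sqrt (sqnorm a) != 0 by rewrite lt0r_neq0 // sqrtr_gt0.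
have d0 : dotv a a != 0 by rewrite lt0r_neq0.
case=> [x|]; exists 1; rewrite // scale1r /refl.
- rewrite lf_half_space_vec /half_space_vec /= scalerA.
  have -> : 2 * ((t - dotv a x) / Num.sqrt (sqnorm a)) * - (Num.sqrt (sqnorm a))^-1
      = 2 * (dotv a x - t) / dotv a a by rewrite -s2; field.
  by lor_expand; rewrite /sqnorm ?dotvE ?(dotvC x a); field.
- have -> : lf (null_vec None) (half_space_vec a t) = 0.
    by rewrite lfZr lf_mklor dotv0l; ring.
  by rewrite mulr0 scale0r subr0.
Qed.

Lemma ball_inversionP b f : ball_inversion b f ->
  exists A, [/\ lf A A = 1, b = cap A & acts (refl A) f].
Proof.
case=> [c r r0|c r r0|a t a0].
- exists (in_ball_vec c r); split; [exact: in_ball_vec1|exact: in_ballE|].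
  exact: acts_sphere_inv.
- exists (- in_ball_vec c r); split; [|exact: out_ballE|].
    by rewrite lfNl lfNr opprK in_ball_vec1.
  move=> p; have [l l0 e] := acts_sphere_inv c r0 p; exists l => //.
  by rewrite -e /refl lfNr mulrN scalerN scaleNr opprK.
- exists (half_space_vec a t).
  by split; [exact: half_space_vec1|exact: half_spaceE|exact: acts_hyperplane_inv].
Qed.

(** The sign of the last coordinate, the curvature, decides the shape: negative for the complement
    of a ball, zero for a half-space, positive for a ball. *)
Lemma ball_inversion_cap A : lf A A = 1 -> exists f, ball_inversion (cap A) f /\ acts (refl A) f.
Proof.
rewrite (mklorE A); move: A.1.1 (A.1.2 0 0) (A.2 0 0) => b s t h.
have [t0|t0|t0] := ltgtP t 0.
- have r0 : 0 < (- t)^-1 by rewrite invr_gt0 oppr_gt0.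
  have e : mklor b s t = - in_ball_vec (t^-1 *: b) (- t)^-1.
    lor_expand; first by field; rewrite lt_eqF.
      rewrite /sqnorm !dotvE; have -> : dotv b b = 1 + s * t by rewrite -h lf_mklor; field.
      by field; rewrite lt_eqF.
    by rewrite invrK opprK.
  exists (sphere_inv (t^-1 *: b) (- t)^-1); split.
    by rewrite e -out_ballE //; constructor.
  move=> p; have [l l0 e'] := acts_sphere_inv (t^-1 *: b) r0 p; exists l => //.
  by rewrite -e' e /refl lfNr mulrN scalerN scaleNr opprK.
- have r0 : 0 < t^-1 by rewrite invr_gt0.
  have e : mklor b s t = in_ball_vec (t^-1 *: b) t^-1.
    lor_expand; first by field; rewrite gt_eqF.
      rewrite /sqnorm !dotvE; have -> : dotv b b = 1 + s * t by rewrite -h lf_mklor; field.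
      by field; rewrite gt_eqF.
    by rewrite invrK.
  exists (sphere_inv (t^-1 *: b) t^-1); split.
    by rewrite e -in_ballE //; constructor.
  by rewrite e; apply: acts_sphere_inv.
- have b1 : sqnorm (- b) = 1 by rewrite -h t0 lf_mklor /sqnorm !dotvE; field.
  have b0 : - b != 0.
    by apply/eqP => b0; move: b1; rewrite b0 /sqnorm dotv0l => /esym /eqP; rewrite oner_eq0.
  have e : mklor b s t = half_space_vec (- b) (- s / 2).
    by rewrite /half_space_vec b1 sqrtr1; lor_expand; rewrite ?t0; field.
  exists (hyperplane_inv (- b) (- s / 2)); split.
    by rewrite e -half_spaceE //; constructor.
  by rewrite e; apply: acts_hyperplane_inv.
Qed.

End BallInversion.

(** * A ball determines its unit vector *)

Section CapUnique.
Variables (R : realType) (d : nat).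
Implicit Types (A B : lor R d.+1) (x : 'rV[R]_d.+1).

Let q A x := lf (null_vec (Some x)) A.

Let qE (b x : 'rV[R]_d.+1) (s t : R) :
  q (mklor b s t) x = dotv x b - (dotv x x * t + s) / 2.
Proof. by rewrite /q lf_mklor /sqnorm; field. Qed.

(* The gradient of [q A] has length [1] on the zero set of [q A], so that [q A]
   takes negative values near each zero. *)
Lemma cap_zero A B x : lf A A = 1 -> cap A = cap B -> q A x = 0 -> q B x = 0.
Proof.
move=> hA hAB qA; have qB : 0 <= q B x.
  by have : cap B (Some x); [rewrite -hAB /cap /= -/(q A x) qA|].
have out y : q A y < 0 -> q B y < 0.
  rewrite !ltNge; apply: contra => yB.
  by have : cap A (Some y); [rewrite hAB|].
move: hA qA qB out {hAB}; rewrite (mklorE A) (mklorE B).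
move: A.1.1 (A.1.2 0 0) (A.2 0 0) => b s t.
move: B.1.1 (B.1.2 0 0) (B.2 0 0) => b' s' t'.
rewrite lf_mklor !qE => hA qA qB out.
apply/eqP; rewrite eq_le qB andbT leNgt; apply/negP => c0.
set c := dotv x b' - _ in c0; have [g gE] : exists g, g = b - t *: x by eexists.
have g1 : dotv g g = 1.
  rewrite gE !dotvE (dotvC b x); have -> : dotv b b = 1 + s * t by rewrite -hA; field.
  have -> : dotv x b = (dotv x x * t + s) / 2 by lra.
  by field.
pose k := dotv g (b' - t' *: x); pose m := `|k| + `|t'|.
have t0 := normr_ge0 t; have m0 : 0 <= m / c by apply: divr_ge0; [exact: addr_ge0|exact: ltW].
have D0 : 0 < 1 + `|t| + m / c by lra.
(* The step from [x] against the unit gradient [g] is short enough for two estimates: [u |t| <= 1]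
   makes [q A] negative there, and [u m <= c] keeps [q B] nonnegative, contradicting [out]. *)
pose u := (1 + `|t| + m / c)^-1.
have u0 : 0 < u by rewrite invr_gt0.
have uD : u * (1 + `|t| + m / c) = 1 by rewrite mulVf // lt0r_neq0.
have k0 := normr_ge0 k; have t'0 := normr_ge0 t'.
have u1 : u <= 1 by nra.
have ut : u * `|t| <= 1 by nra.
have um : u * m <= c.
  by rewrite -[m](divfK (lt0r_neq0 c0)) mulrA -[leRHS]mul1r ler_wpM2r ?(ltW c0) //; nra.
have := out (x - u *: g); rewrite !qE.
have e1 : dotv (x - u *: g) b - (dotv (x - u *: g) (x - u *: g) * t + s) / 2 =
    - u * (1 + u * t / 2).
  have xg : dotv g b - t * dotv x g = 1.
    have <- : dotv g (b - t *: x) = 1 by rewrite -gE.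
    by rewrite dotvDr dotvNr dotvZr (dotvC g x).
  rewrite !dotvE (dotvC g x) g1; have -> : dotv g b = 1 + t * dotv x g by lra.
  have -> : dotv x b = (dotv x x * t + s) / 2 by lra.
  by field.
have e2 : dotv (x - u *: g) b' - (dotv (x - u *: g) (x - u *: g) * t' + s') / 2 =
    c - u * k - u * u * t' / 2.
  by rewrite /c /k !dotvE (dotvC g x) g1; field.
have tle := ler_norm (- t); rewrite normrN in tle.
have kle := ler_norm k; have t'le := ler_norm t'.
rewrite e1 e2 => h.
have : c - u * k - u * u * t' / 2 < 0.
  apply: h; rewrite mulNr oppr_lt0 mulr_gt0 //.
  have : u * (- t) <= 1 by apply: le_trans ut; rewrite ler_wpM2l // ltW.
  by lra.
apply/negP; rewrite -leNgt.
have h1 : u * k <= u * `|k| by rewrite ler_wpM2l // ltW.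
have h2 : u * u * t' <= u * `|t'|.
  rewrite -mulrA ler_wpM2l ?(ltW u0) //; apply: (@le_trans _ _ (u * `|t'|)).
    by rewrite ler_wpM2l // ltW.
  by rewrite ler_piMl.
have h3 : 0 <= u * `|t'| by rewrite mulr_ge0 // ltW.
by move: um; rewrite /m mulrDr; lra.
Qed.

Lemma sqnorm_delta : sqnorm (delta_mx 0 0 : 'rV[R]_d.+1) = 1.
Proof.
rewrite /sqnorm /dotv (bigD1 ord0) //= big1 ?addr0; first by rewrite !mxE /= mulr1.
by move=> i i0; rewrite !mxE /= (negPf i0) mul0r.
Qed.

(** The boundary sphere consists of the points [t^-1 (b + e)] with [e] a unit vector. Comparing [e]
    with [- e] isolates the part linear in [e], so [B] is a multiple [k] of [A] with [k = 1] or
    [k = -1]; membership of infinity excludes [-1]. *)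
Lemma cap_inj_curved A B : lf A A = 1 -> lf B B = 1 -> cap A = cap B ->
  A.2 0 0 != 0 -> A = B.
Proof.
move=> hA hB hAB; have := (fun x => @cap_zero A B x hA hAB).
have : (cap A None : Prop) = cap B None by rewrite hAB.
move: hA hB {hAB}; rewrite (mklorE A) (mklorE B) /cap /=.
move: A.1.1 (A.1.2 0 0) (A.2 0 0) => b s t.
move: B.1.1 (B.1.2 0 0) (B.2 0 0) => b' s' t'.
rewrite !lf_mklor !mxE !dotv0l => hA hB hN zero t0.
have bb : dotv b b = 1 + s * t by rewrite -hA; field.
have zq e : dotv e e = 1 -> 2 * t * (dotv b b' + dotv e b') -
    (t' * (2 + s * t + 2 * dotv e b) + s' * t ^+ 2) = 0.
  move=> e1; have := zero (t^-1 *: (b + e)); rewrite !qE !dotvE (dotvC b e) bb e1.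
  move=> /(_ _)/(congr1 (fun z => 2 * t ^+ 2 * z)) h.
  rewrite mulr0 in h; rewrite -h; first by field.
  by field.
have zw e : dotv e e = 1 -> dotv e (t *: b' - t' *: b) = 0.
  move=> e1; have := zq _ e1; have := zq (- e).
  by rewrite !dotvE opprK => /(_ e1); lra.
have w0 : t *: b' - t' *: b = 0.
  apply/eqP/negPn/negP => w0; have w1 := sqnorm_gt0 w0; move: zw w1.
  move: (t *: b' - t' *: b) => w; rewrite /sqnorm => zw w1.
  have [r r0 rr] : exists2 r, r != 0 & dotv w w = r ^+ 2.
    by exists (Num.sqrt (dotv w w)); rewrite ?lt0r_neq0 ?sqrtr_gt0 ?sqr_sqrtr // ltW.
  have /zw : dotv (r^-1 *: w) (r^-1 *: w) = 1 by rewrite !dotvE rr; field.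
  by move/eqP; rewrite dotvZl mulf_eq0 invr_eq0 (negPf r0) gt_eqF.
pose k := t' / t; have t'E : t' = k * t by rewrite divfK.
have b'E : b' = k *: b.
  by move/eqP: w0; rewrite subr_eq0 /k mulrC -scalerA => /eqP <-;
     rewrite scalerA mulVf // scale1r.
have s'E : s' = k * s.
  have := zq _ sqnorm_delta; rewrite t'E b'E !dotvE bb => h.
  have : t ^+ 2 * (s' - k * s) = 0 by rewrite -[RHS]oppr0 -h; ring.
  by move/eqP; rewrite mulf_eq0 expf_eq0 /= (negPf t0) subr_eq0 => /eqP.
have k2 : (k == 1) || (k == -1).
  by rewrite -sqrf_eq1; apply/eqP; rewrite -hB t'E b'E s'E !dotvE bb; field.
suff k1 : k = 1 by rewrite t'E b'E s'E k1 !mul1r scale1r.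
case/orP: k2 => /eqP // kN; move: hN; rewrite t'E kN => hN.
have h : (0 <= - t) = (0 <= t) :> Prop.
  have -> : (0 <= - t) = (0 <= 0 - (1 * t + s * 0) / 2) by apply/idP/idP; lra.
  rewrite hN; have -> : (0 <= 0 - (1 * (-1 * t) + s' * 0) / 2) = (0 <= t) by apply/idP/idP; lra.
  by [].
have [tp|tp] := leP 0 t; have : 0 <= t /\ 0 <= - t.
- by split=> //; rewrite h.
- by move=> [_ ?]; case/eqP: t0; lra.
- by rewrite -h; split; lra.
- by move=> [? _]; lra.
Qed.

Lemma cap_inj A B : lf A A = 1 -> lf B B = 1 -> cap A = cap B -> A = B.
Proof.
move=> hA hB hAB; have [tA|tA] := eqVneq (A.2 0 0) 0; last exact: cap_inj_curved.
have [tB|tB] := eqVneq (B.2 0 0) 0; last by apply/esym/cap_inj_curved.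
have zero := (fun x => @cap_zero A B x hA hAB).
have pos x : 0 <= q A x -> 0 <= q B x.
  by move=> h; have : cap B (Some x); [rewrite -hAB|].
move: hA hB zero pos {hAB}; rewrite (mklorE A) (mklorE B) tA tB.
move: A.1.1 (A.1.2 0 0) => b s; move: B.1.1 (B.1.2 0 0) => b' s'.
rewrite !lf_mklor !mulr0 !addr0 mul0r !subr0 => hA hB zero pos.
pose k := dotv b b'.
(* Both curvatures being zero, the boundary hyperplane is parametrised by [(s / 2) b + y] with [y]
   orthogonal to [b]. The point one step further along [b] later decides the sign. *)
have zq y : dotv y b = 0 -> s * k + 2 * dotv y b' = s'.
  move=> yb; have := zero ((s / 2) *: b + y); rewrite !qE !dotvE hA yb -/k => h.
  by have := h ltac:(field); lra.
have y0 : b' - k *: b = 0.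
  have := zq (b' - k *: b); have := zq 0; rewrite !dotvE hA hB -/k (dotvC b' b) -/k.
  move=> h1 h2; apply: sqnorm_eq0; rewrite /sqnorm !dotvE hA hB (dotvC b' b) -/k.
  by lra.
have b'E : b' = k *: b by apply/eqP; rewrite -subr_eq0 y0.
have s'E : s' = k * s by have := zq 0; rewrite !dotv0l => <- //; ring.
have k2 : (k == 1) || (k == -1).
  by rewrite -sqrf_eq1 -hB b'E !dotvE hA expr2 mulr1.
suff k1 : k = 1 by rewrite b'E s'E k1 mul1r scale1r.
case/orP: k2 => /eqP // kN; have := pos ((s / 2 + 1) *: b).
rewrite !qE !dotvE hA -/k s'E kN => h; suff : 0 <= -1 :> R by lra.
by apply: le_trans (h _) _; lra.
Qed.

End CapUnique.

(** * Stereographic projection and Moebius maps *)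

Section Stereographic.
Variables (R : realType) (d : nat).
Implicit Types (u v : 'rV[R]_d.+1) (A : lor R d).

(* [lift_sphere v h] is the Lorentz vector of the point [v / h] of projective
   space; [(x, 1)] with [x] on the sphere goes to the null ray of [stereo x]. *)
Definition lift_sphere v (h : R) : lor R d :=
  mklor (\row_(i < d) v 0 (lift ord_max i)) (h + v 0 ord_max) (h - v 0 ord_max).

Lemma lf_lift_sphere u v (h k : R) :
  lf (lift_sphere u h) (lift_sphere v k) = dotv u v - h * k.
Proof.
rewrite lf_mklor /dotv [in RHS](bigD1_ord ord_max) //=.
under eq_bigr do rewrite !mxE.
by field.
Qed.

Lemma lift_sphere_surj A : exists v h, A = lift_sphere v h.
Proof.
pose v : 'rV[R]_d.+1 := \row_i
  if unlift ord_max i is Some j then A.1.1 0 j else (A.1.2 0 0 - A.2 0 0) / 2.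
exists v, ((A.1.2 0 0 + A.2 0 0) / 2); lor_expand; rewrite ?liftK ?unlift_none //.
- by field.
- by field.
Qed.

Lemma lift_sphere_comb (a b h k : R) u v :
  a *: lift_sphere u h + b *: lift_sphere v k =
  lift_sphere (a *: u + b *: v) (a * h + b * k).
Proof. by lor_ring. Qed.

Lemma stereo_null_vec u : sqnorm u = 1 ->
  exists2 l : R, 0 < l & lift_sphere u 1 = l *: null_vec (stereo u).
Proof.
move=> u1; have e := lf_lift_sphere u u 1 1.
rewrite -/(sqnorm u) u1 mulr1 subrr lf_mklor in e.
have h : sqnorm (\row_(i < d) u 0 (lift ord_max i)) = 1 - u 0 ord_max ^+ 2.
  by rewrite /sqnorm; lra.
rewrite /stereo; have [u0|u0] := eqVneq (u 0 ord_max) 1.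
  exists 2 => //; rewrite u0 expr1n subrr in h.
  by rewrite /lift_sphere (sqnorm_eq0 h) u0; lor_ring.
have ul : u 0 ord_max < 1.
  by rewrite lt_neqAle u0; have := sqnorm_ge0 (\row_(i < d) u 0 (lift ord_max i)); rewrite h; nra.
have u2 : 1 - u 0 ord_max != 0 by rewrite subr_eq0 eq_sym.
exists (1 - u 0 ord_max); first by rewrite subr_gt0.
have -> : \row_(i < d) (u 0 (lift ord_max i) / (1 - u 0 ord_max)) =
    (1 - u 0 ord_max)^-1 *: \row_(i < d) u 0 (lift ord_max i).
  by apply/rowP => i; rewrite !mxE mulrC.
rewrite scale_mklor scalerA mulfV // scale1r mulr1; congr mklor.
rewrite /sqnorm !dotvE -/(sqnorm _) h; field.
exact: u2.
Qed.

Lemma stereo_surj (p : hat R d) : exists2 u, sqnorm u = 1 & stereo u = p.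
Proof.
have [v [h e]] := lift_sphere_surj (null_vec p).
have h0 : 0 < h.
  have := congr1 (fun A => A.1.2 0 0 + A.2 0 0) e; rewrite /= !mxE.
  by case: p e => [x|] _; rewrite /= !mxE; have := @sqnorm_ge0; [move=> /(_ _ _ x)|]; lra.
have h1 := lt0r_neq0 h0.
have e1 : lift_sphere (h^-1 *: v) 1 = h^-1 *: null_vec p.
  by rewrite e; lor_field.
have u1 : sqnorm (h^-1 *: v) = 1.
  have := lf_lift_sphere (h^-1 *: v) (h^-1 *: v) 1 1.
  by rewrite e1 lfZl lfZr null_vec_null !mulr0 /sqnorm; lra.
exists (h^-1 *: v) => //; have [l l0 e2] := stereo_null_vec u1.
apply/esym/(@null_vec_ray _ _ _ _ (h * l)).
by rewrite -scalerA -e2 e1 scalerA mulfV // scale1r.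
Qed.

Lemma visible_capE v : 1 < sqnorm v ->
  visible_cap v = usphere R d.+1 `&` [set x | 1 <= dotv x v].
Proof.
move=> v1; have q (x : 'rV[R]_d.+1) (t : R) : sqnorm x = 1 ->
    sqnorm ((1 - t) *: x + t *: v) =
    1 + t * (2 * (1 - t) * (dotv x v - 1) + t * (sqnorm v - 1)).
  by rewrite /sqnorm !dotvE (dotvC v x) => ->; ring.
apply/seteqP; split => x [x1 /= h]; split=> //.
  rewrite leNgt; apply/negP => h1; pose e := 1 - dotv x v.
  have e0 : 0 < e by rewrite subr_gt0.
  (* The parameter at which the line through [x] and [v] meets the sphere a second time. *)
  pose t := 2 * e / (2 * e + (sqnorm v - 1)).
  have D0 : 0 < 2 * e + (sqnorm v - 1) by lra.
  have t0 : 0 < t by apply: divr_gt0 => //; lra.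
  have tD : t * (2 * e + (sqnorm v - 1)) = 2 * e by rewrite divfK // lt0r_neq0.
  have t1 : t <= 1 by rewrite ler_pdivrMr //; lra.
  have := h t; rewrite t0 t1 => /(_ isT); rewrite q //.
  have -> : 2 * (1 - t) * (dotv x v - 1) + t * (sqnorm v - 1) = 0.
    by move: tD; rewrite /e; lra.
  by rewrite mulr0 addr0 ltxx.
move=> t /andP[t0 t1]; rewrite q // ltrDl mulr_gt0 //.
by rewrite ltr_wpDl ?mulr_gt0 ?subr_gt0 // !mulr_ge0 // subr_ge0.
Qed.

Lemma stereo_visible_cap v : 1 < sqnorm v ->
  (@stereo R d) @` visible_cap v = cap (lift_sphere v 1).
Proof.
move=> v1; rewrite visible_capE //; apply/seteqP; split => [_ [x [x1 /= h] <-]|p h].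
  have [l l0 e] := stereo_null_vec x1.
  by rewrite /cap /= -(pmulr_rge0 _ l0) -lfZl -e lf_lift_sphere mulr1 subr_ge0.
have [x x1 e] := stereo_surj p; exists x => //; split=> //=.
have [l l0 e1] := stereo_null_vec x1; move: h; rewrite /cap /= -e.
by rewrite -(pmulr_rge0 _ l0) -lfZl -e1 lf_lift_sphere mulr1 subr_ge0.
Qed.

Lemma cap_scale (a : R) A : 0 < a -> cap (a *: A) = cap A.
Proof.
by move=> a0; apply/seteqP; split=> p; rewrite /cap /= lfZr pmulr_rge0.
Qed.

(** [lift_sphere v 1] has norm [sqnorm v - 1]; for a point outside the sphere this rescales it to
    the unit vector of the visible cap. *)
Definition point_vec v : lor R d := (Num.sqrt (sqnorm v - 1))^-1 *: lift_sphere v 1.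

Lemma point_vec1 v : 1 < sqnorm v -> lf (point_vec v) (point_vec v) = 1.
Proof.
move=> v1; rewrite lfZl lfZr lf_lift_sphere mulr1 mulrA -invfM -expr2.
by rewrite sqr_sqrtr ?mulVf ?lt0r_neq0 ?subr_ge0 ?subr_gt0 // ltW.
Qed.

Lemma cap_point_vec v : 1 < sqnorm v ->
  cap (point_vec v) = (@stereo R d) @` visible_cap v.
Proof.
by move=> v1; rewrite cap_scale ?stereo_visible_cap // invr_gt0 sqrtr_gt0 subr_gt0.
Qed.

Lemma acts_involutive M (g : hat R d -> hat R d) :
  linear M -> involutive M -> acts M g -> involutive g.
Proof.
move=> lM K ag; have := acts_comp lM ag ag.
rewrite (_ : M \o M = id); last by apply/funext => x /=.
by move=> /acts_unique /(_ (@acts_id _ _)) e p; have := congr1 (@^~ p) e.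
Qed.

(** Both inverses are part of the conclusion so that the induction passes through [gen_inv]. *)
Lemma mobius_isometry (g : hat R d -> hat R d) : mobius R d g ->
  exists M M' h, [/\ isometry M /\ isometry M', cancel M M' /\ cancel M' M,
    acts M g & cancel g h /\ cancel h g].
Proof.
elim=> {g} [g [b /ball_inversionP [A [hA _ ag]]]||g h _ IHg _ IHh|g h _ IH gh hg].
- have K := reflK hA; have iM := refl_isometry hA.
  have gK := acts_involutive iM.1 K ag.
  by exists (refl A), (refl A), g.
- by exists id, id, id; split=> //; exact: (@acts_id R d).
- have [M [M' [g' [[iM iM'] [K K'] ag [gg' g'g]]]]] := IHg.
  have [L [L' [h' [[iL iL'] [C C'] ah [hh' h'h]]]]] := IHh.
  exists (M \o L), (L' \o M'), (h' \o g'); split.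
  + by split; apply: isometry_comp.
  + by split; apply: can_comp.
  + exact: acts_comp iM.1 ag ah.
  + by split; apply: can_comp.
- have [M [M' [h' [[iM iM'] [K K'] ag _]]]] := IH.
  exists M', M, g; split=> //; exact: acts_inv iM'.1 K hg ag.
Qed.

End Stereographic.

(** * Restriction of generated groups *)

Definition word (T I : Type) (f : I -> T -> T) (s : seq I) : T -> T :=
  foldr (fun i g => f i \o g) id s.

Section Words.
Variables (T I : Type) (f : I -> T -> T).
Hypothesis fK : forall i, involutive (f i).

Lemma word_cat s1 s2 : word f (s1 ++ s2) = word f s1 \o word f s2.
Proof. by elim: s1 => //= i s1 ->. Qed.

Lemma wordK s : cancel (word f s) (word f (rev s)).
Proof.
by elim: s => //= i s IH x; rewrite rev_cons -cats1 word_cat /= fK IH.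
Qed.

Lemma wordVK s : cancel (word f (rev s)) (word f s).
Proof. by move=> x; rewrite -{1}(revK s) wordK. Qed.

Lemma generated_word s : generated (range f) (word f s).
Proof.
elim: s => [|i s IH]; first exact: gen_id.
by apply: gen_comp => //; apply: gen_in; exists i.
Qed.

Lemma generated_wordP g : generated (range f) g <-> exists s, g = word f s.
Proof.
split=> [|[s ->]]; last exact: generated_word.
elim=> {g} [g [i _ <-]||g h _ [s ->] _ [s' ->]|g h _ [s ->] gh hg].
- by exists [:: i].
- by exists [::].
- by exists (s ++ s'); rewrite word_cat.
- exists (rev s); apply/funext => x.
  by rewrite -{2}(hg x) wordK.
Qed.

Lemma subgroup_generated : subgroup (generated (range f)).
Proof.
split=> [|g h hg hh|g /generated_wordP [s ->]]; first exact: gen_id.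
  exact: gen_comp.
by exists (word f (rev s)); split; [exact: generated_word|exact: wordK|exact: wordVK].
Qed.

End Words.

Lemma generated_sub (T : Type) (S : set (T -> T)) (S' : set (T -> T)) :
  (forall g, S g -> generated S' g) -> generated S `<=` generated S'.
Proof.
move=> SS' g; elim=> {g} [g /SS' //||g h _ gS _ hS|g h _ gS gh hg].
- exact: gen_id.
- exact: gen_comp.
- exact: gen_inv gS gh hg.
Qed.

(* Both the isomorphism and the bijection are restrictions along [j]. *)
Lemma alg_equiv_restrict (T T' I K : Type) (f : I -> T -> T) (f' : I -> T' -> T')
    (b : K -> set T) (j : T' -> T) :
  (forall i, involutive (f i)) -> (forall i, involutive (f' i)) ->
  injective j -> (forall i x, f i (j x) = j (f' i x)) ->
  (forall s, word f' s = id -> word f s = id) ->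
  (forall s k l, word f' s @` (j @^-1` b k) = j @^-1` b l -> word f s @` b k = b l) ->
  alg_equiv (generated (range f)) (range b)
            (generated (range f')) (range (fun k => j @^-1` b k)).
Proof.
move=> fK f'K jI fj inj1 inj2.
have wj s x : word f s (j x) = j (word f' s x).
  by elim: s x => //= i s IH x; rewrite IH fj.
(* Any word representing [g] may be chosen: by [wj] and the injectivity of [j], words that agree on
   [T] agree on [T']. *)
pose phi g := word f' (if pselect (exists s, g = word f s) is left H
                       then projT1 (cid H) else [::]).
have phiE s : phi (word f s) = word f' s.
  rewrite /phi; case: pselect => [H|]; last by case; exists s.
  case: (cid H) => s' /= e; apply/funext => x; apply: jI.
  by rewrite -!wj e.
have psiE s B : j @^-1` (word f s @` B) = word f' s @` (j @^-1` B).
  apply/seteqP; split => [x [y By e]|_ [x Bx <-]]; last first.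
    by exists (j x) => //; rewrite wj.
  exists (word f' (rev s) x); last by rewrite wordVK.
  by rewrite /preimage /= -wj -e wordK.
have imVK s (B : set T) : word f (rev s) @` (word f s @` B) = B.
  rewrite image_comp (_ : _ \o _ = id) ?image_id //.
  by apply/funext => x /=; rewrite wordK.
have imV'K s (B : set T') : word f' (rev s) @` (word f' s @` B) = B.
  rewrite image_comp (_ : _ \o _ = id) ?image_id //.
  by apply/funext => x /=; rewrite wordK.
exists phi, (fun B => j @^-1` B); split.
- split=> [g|g h|g] .
  + by move=> /generated_wordP [] // s ->; rewrite phiE; exact: generated_word.
  + rewrite !inE => /generated_wordP [] // s -> /generated_wordP [] // s' ->.
    rewrite !phiE => e.
    have /inj1 : word f' (rev s' ++ s) = id.
      by rewrite word_cat e; apply/funext => x /=; rewrite wordK.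
    rewrite word_cat => e'; apply/funext => x.
    by rewrite -(wordVK fK s' (word f s x)); have /= -> := congr1 (@^~ x) e'.
  + move=> /generated_wordP [] // s ->; exists (word f s); last exact: phiE.
    exact: generated_word.
- move=> g h /generated_wordP [] // s -> /generated_wordP [] // s' ->.
  by rewrite -word_cat !phiE word_cat.
- split.
  + move=> _ [g [_ [/generated_wordP [] // s -> [k _ <-] ->]]].
    exists (word f' s), (j @^-1` b k); split; [exact: generated_word|by exists k|].
    exact: psiE.
  + move=> B B'; rewrite !inE => -[g [_ [/generated_wordP [] // s -> [k _ <-] ->]]].
    move=> [h [_ [/generated_wordP [] // s' -> [l _ <-] ->]]] /=.
    rewrite !psiE => e.
    have /inj2 : word f' (rev s' ++ s) @` (j @^-1` b k) = j @^-1` b l.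
      by rewrite word_cat -image_comp e imV'K.
    rewrite word_cat -image_comp => <-.
    by rewrite -{2}(revK s') imVK.
  + move=> _ [g [_ [/generated_wordP [] // s -> [k _ <-] ->]]].
    exists (word f s @` b k); last by rewrite psiE.
    by exists (word f s), (b k); split; [exact: generated_word|exists k|].
- by move=> g _ /generated_wordP [] // s -> [k _ <-]; rewrite psiE phiE.
Qed.

Section WordActs.
Variables (R : realType) (d : nat) (I : Type).
Variables (T : I -> lor R d -> lor R d) (f : I -> hat R d -> hat R d).
Hypotheses (iT : forall i, isometry (T i)) (af : forall i, acts (T i) (f i)).

Lemma word_isometry s : isometry (word T s).
Proof. by elim: s => [|i s IH] /=; [|apply: isometry_comp]. Qed.

Lemma word_acts s : acts (word T s) (word f s).
Proof.
elim: s => [|i s IH] /=; first exact: (@acts_id R d).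
exact: acts_comp (iT i).1 _ _.
Qed.

End WordActs.

(* [J] is the inclusion of the span of a 2-sphere with unit normal [n]; the
   generators act on that span as the reflections [refl (a i)], and the ball
   [E k] meets the sphere in the disk [w k]. *)
Lemma section_alg_equiv (R : realType) (I K : Type)
    (J : lor R 2 -> lor R 3) (n C : lor R 3) (c : lor R 2)
    (T : I -> lor R 3 -> lor R 3) (f : I -> hat R 3 -> hat R 3)
    (a : I -> lor R 2) (g : I -> hat R 2 -> hat R 2)
    (E : K -> lor R 3) (w : K -> lor R 2) (rho chi : R) (eta : K -> R) :
  linear J -> (forall x y, lf (J x) (J y) = lf x y) ->
  (forall y, lf (J y) n = 0) -> (forall z, exists y a, z = J y + a *: n) ->
  (forall y, lf (J y) C = lf y c) ->
  (forall p, lf (null_vec p) C < 0) -> (forall p, lf (null_vec p) c < 0) ->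
  (forall i, isometry (T i)) -> (forall i, involutive (T i)) ->
  (forall i, acts (T i) (f i)) ->
  (forall i, lf (a i) (a i) = 1) -> (forall i, acts (refl (a i)) (g i)) ->
  (forall i y, T i (J y) = J (refl (a i) y)) -> (forall i, T i n = chi *: n) ->
  0 < rho -> (forall k, lf (w k) (w k) = 1) ->
  (forall k, E k = rho *: J (w k) + eta k *: n) ->
  (forall s, word (fun i => refl (a i)) s =1 id -> chi ^+ size s = 1) ->
  (forall s k l, word (fun i => refl (a i)) s (w k) = w l ->
     chi ^+ size s * eta k = eta l) ->
  alg_equiv (generated (range f)) (range (fun k => cap (E k)))
            (generated (range g)) (range (fun k => cap (w k))).
Proof.
move=> lJ iJ Jn Jspan JC Cneg cneg iT TK aT a1 ag TJ Tn rho0 w1 EE par col.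
have JZ (k : R) y : J (k *: y) = k *: J y by exact: linear_scale.
(* [j p] is the point of the 2-sphere on the null ray of [J (null_vec p)]. The factor is positive
   because products of [null_vec] with [C] and with [c] are all negative. *)
have /choice [j jP] (p : hat R 2) :
    exists q : hat R 3, exists2 l : R, 0 < l & J (null_vec p) = l *: null_vec q.
  have [l [q e]] := null_vec_surj (etrans (iJ _ _) (null_vec_null p)).
  exists q, l => //; have := JC (null_vec p); rewrite e lfZl => h.
  by have := cneg p; rewrite -h nmulr_llt0.
have jI : injective j.
  move=> p p' e; apply: contrapT => /null_vec_lf_neq0 /eqP; apply.
  have [l _ e1] := jP p; have [l' _ e2] := jP p'.
  by rewrite -iJ e1 e2 e lfZl lfZr null_vec_null !mulr0.
have fj i x : f i (j x) = j (g i x).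
  have [l l0 e1] := jP x; have [l1 l10 e2] := jP (g i x).
  have [l2 l20 e3] := aT i (j x); have [l3 l30 e4] := ag i x.
  have := TJ i (null_vec x); rewrite e1 (linear_scale _ _ (iT i).1) e3 e4 JZ e2 !scalerA => h.
  apply: (@null_vec_ray _ _ _ _ ((l * l2)^-1 * (l3 * l1))).
  by rewrite -scalerA -h scalerA mulVf ?scale1r // lt0r_neq0 // mulr_gt0.
(* The component along [n] is orthogonal to the span, hence invisible on the sphere: [E k] cuts out
   the disk of [w k] whatever [eta k] is. *)
have wE : (fun k => cap (w k)) = (fun k => j @^-1` cap (E k)).
  apply/funext => k; apply/seteqP; have key x : (0 <= lf (null_vec (j x)) (E k)) =
      (0 <= lf (null_vec x) (w k)).
    have [l l0 e] := jP x; rewrite -(pmulr_rge0 _ l0) -lfZl -e EE lfDr !lfZr Jn.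
    by rewrite mulr0 addr0 iJ pmulr_rge0.
  by split=> x; rewrite /cap /preimage /= key.
have fK i : involutive (f i) by exact: acts_involutive (iT i).1 (TK i) (aT i).
have gK i : involutive (g i).
  exact: acts_involutive (refl_isometry (a1 i)).1 (reflK (a1 i)) (ag i).
have ia i : isometry (refl (a i)) by exact: refl_isometry.
set m := fun i => refl (a i) in par col.
have WJ s y : word T s (J y) = J (word m s y).
  by elim: s y => //= i s IH y; rewrite IH TJ.
have Wn s : word T s n = chi ^+ size s *: n.
  elim: s => [|i s IH] /=; first by rewrite expr0 scale1r.
  by rewrite IH (linear_scale _ _ (iT i).1) Tn scalerA exprSr.
have WT s y (t : R) : word T s (J y + t *: n) =
    J (word m s y) + (t * chi ^+ size s) *: n.
  have [lW _] := word_isometry iT s.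
  by have := lW 1 (J y) (t *: n); rewrite !scale1r (linear_scale _ _ lW) WJ Wn scalerA.
(* An equality of maps or disks of [hat R 2] becomes one of isometries or unit vectors, which
   settles the part in the span; [par] and [col] control the component along [n]. *)
rewrite wE; apply: alg_equiv_restrict => // [s e|s k l].
  have e1 : word m s =1 id.
    apply: acts_id_linear; first exact: word_isometry.
    by rewrite -e; apply: word_acts.
  apply: (@acts_unique _ _ (word T s)); first exact: word_acts.
  rewrite (_ : word T s = id); first exact: (@acts_id R 3).
  apply/funext => z; have [y [t ->]] := Jspan z.
  by rewrite WT (par _ e1) mulr1 e1.
have wEk i : j @^-1` cap (E i) = cap (w i) by rewrite (congr1 (@^~ i) wE).
rewrite !wEk => e.
have ew : word m s (w k) = w l.
  apply: cap_inj => //; first by rewrite (word_isometry ia s).2.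
  rewrite -e; apply/esym.
  exact: acts_cap (word_isometry ia s) (word_acts ia ag s) (wordK gK s) (wordVK gK s).
have -> : word f s @` cap (E k) = cap (word T s (E k)).
  exact: acts_cap (word_isometry iT s) (word_acts iT aT s) (wordK fK s) (wordVK fK s).
by rewrite !EE -JZ WT (linear_scale _ _ (word_isometry ia s).1) ew mulrC (col _ _ _ ew) JZ.
Qed.

(** * Faces of polytopes *)

Section ConvexHull.
Variables (R : realType) (n : nat).
Implicit Types (a b u v x y : 'rV[R]_n) (s : seq 'rV[R]_n) (P F : set 'rV[R]_n).

Lemma dotv_conv a s (w : 'I_(size s) -> R) :
  dotv a (\sum_i w i *: s`_i) = \sum_i w i * dotv a s`_i.
Proof. by rewrite dotv_sumr; apply: eq_bigr => i _; rewrite dotvZr. Qed.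

Lemma conv_hull_mem s v : v \in s -> conv_hull s v.
Proof.
move=> vs; have iv : (index v s < size s)%N by rewrite index_mem.
exists (fun i => (i == Ordinal iv)%:R); split=> [i||]; first exact: ler0n.
  by rewrite (bigD1 (Ordinal iv)) //= eqxx big1 ?addr0 // => i /negPf ->.
rewrite (bigD1 (Ordinal iv)) //= eqxx scale1r nth_index // big1 ?addr0 //.
by move=> i /negPf ->; rewrite scale0r.
Qed.

Lemma conv_hull_convex s x y (t : R) : 0 <= t <= 1 ->
  conv_hull s x -> conv_hull s y -> conv_hull s ((1 - t) *: x + t *: y).
Proof.
move=> /andP[t0 t1] [w [w0 w1 ->]] [w' [w'0 w'1 ->]].
exists (fun i => (1 - t) * w i + t * w' i); split.
- by move=> i; rewrite addr_ge0 // mulr_ge0 // subr_ge0.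
- by rewrite big_split /= -!mulr_sumr w1 w'1 !mulr1 subrK.
- rewrite !scaler_sumr -big_split; apply: eq_bigr => i _ /=.
  by rewrite !scalerA -scalerDl.
Qed.

Lemma conv_hull_le a (c : R) s : (forall v, v \in s -> dotv a v <= c) ->
  forall x, conv_hull s x -> dotv a x <= c.
Proof.
move=> h x [w [w0 w1 ->]]; rewrite dotv_conv -[c]mul1r -w1 mulr_suml.
by apply: ler_sum => i _; rewrite ler_wpM2l // h // mem_nth.
Qed.

Lemma conv_hull_eq a (c : R) s (w : 'I_(size s) -> R) :
  (forall v, v \in s -> dotv a v <= c) -> (forall i, 0 <= w i) -> \sum_i w i = 1 ->
  dotv a (\sum_i w i *: s`_i) = c -> forall i, w i != 0 -> dotv a s`_i = c.
Proof.
move=> h w0 w1 e i wi.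
have : \sum_i w i * (c - dotv a s`_i) = 0.
  under eq_bigr do rewrite mulrBr.
  by rewrite sumrB -mulr_suml w1 mul1r -dotv_conv e subrr.
move=> /eqP; rewrite psumr_eq0 => [/allP /(_ i (mem_index_enum i))|k _].
  by rewrite mulf_eq0 (negPf wi) subr_eq0 => /eqP.
by rewrite mulr_ge0 // subr_ge0 h // mem_nth.
Qed.

Lemma segment_idl u v : segment u v u.
Proof. by exists 0; rewrite lexx ler01 subr0 scale1r scale0r addr0. Qed.

Lemma segment_idr u v : segment u v v.
Proof. by exists 1; rewrite lexx ler01 subrr scale1r scale0r add0r. Qed.

Lemma segment_id u : segment u u = [set u].
Proof.
apply/seteqP; split=> [x [t [_ ->]]|_ ->]; last exact: segment_idl.
by rewrite -scalerDl subrK scale1r.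
Qed.

Lemma conv_hull_face_segment a (c : R) s u v :
  (forall x, x \in s -> dotv a x <= c) ->
  (forall x, x \in s -> dotv a x = c -> x = u \/ x = v) ->
  u \in s -> v \in s -> dotv a u = c -> dotv a v = c ->
  faces (conv_hull s) (segment u v).
Proof.
move=> h huv us vs au av; exists a, c; split; first exact: conv_hull_le.
apply/seteqP; split=> [x [t [t01 ->]]|x [[w [w0 w1 ->]] /= e]].
  split; first by apply: conv_hull_convex => //; apply: conv_hull_mem.
  by rewrite /= !dotvE au av; ring.
pose t := \sum_i w i * (s`_i == v)%:R.
have t0 : 0 <= t by apply: sumr_ge0 => i _; rewrite mulr_ge0.
exists t; rewrite t0 -w1 ler_sum => [|i _]; last first.
  by case: eqP => _; rewrite ?mulr1 ?mulr0.
split=> //; rewrite /t -sumrB !scaler_suml -big_split; apply: eq_bigr => i _ /=.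
have [->|wi] := eqVneq (w i) 0; first by rewrite mul0r subrr !scale0r addr0.
have := huv _ (mem_nth 0 (ltn_ord i)) (conv_hull_eq h w0 w1 e wi).
case: eqP => [->|_ [->|//]]; first by rewrite mulr1 subrr scale0r add0r.
by rewrite mulr0 subr0 scale0r addr0.
Qed.

(* A large multiple of the functional exposing [F], perturbed by [b], exposes
   the [b]-maximal part of [F]. *)
Lemma face_argmax P F b : polytope P -> faces P F -> F !=set0 ->
  exists be : R, [/\ faces P (F `&` [set x | dotv b x = be]),
    F `&` [set x | dotv b x = be] !=set0 & forall x, F x -> dotv b x <= be].
Proof.
move=> [[s ->] _] [a [c [aP ->]]] [x0 [[w [w0 w1 x0E]] /= ax0]].
have as_ v : v \in s -> dotv a v <= c by move=> vs; apply/aP/conv_hull_mem.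
have [i0 i0P] : exists i : 'I_(size s), dotv a s`_i == c.
  have : exists i, w i != 0.
    apply: contrapT => h; have : (\sum_i w i) = 0.
      rewrite big1 // => i _; apply/eqP/negPn/negP => wi; apply: h; by exists i.
    by rewrite w1 => /eqP; rewrite oner_eq0.
  case=> i wi; exists i; apply/eqP.
  by apply: conv_hull_eq wi => //; rewrite -x0E.
case: (@Order.TotalTheory.arg_maxP _ _ _ i0 (fun i : 'I_(size s) => dotv a s`_i == c)
  (fun i => dotv b s`_i) i0P) => im /eqP imP immax.
set be := dotv b s`_im; exists be.
(* [D] exceeds every ratio of a gain in [b] to a loss in [a]. Points on the face have denominator 0
   and contribute 0 by the convention for division. *)
pose D := 1 + \sum_(i < size s) `|dotv b s`_i - be| / (c - dotv a s`_i).
have Dpos (i : 'I_(size s)) : dotv a s`_i < c ->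
    dotv b s`_i - be < D * (c - dotv a s`_i).
  move=> lt; apply: le_lt_trans (ler_norm _) _; rewrite -ltr_pdivrMr ?subr_gt0 //.
  rewrite /D (bigD1 i) //= addrCA ltrDl ltr_wpDr // sumr_ge0 // => k _.
  by rewrite divr_ge0 // subr_ge0 as_ // mem_nth.
have D0 : 0 < D.
  rewrite /D ltr_wpDr // sumr_ge0 // => k _.
  by rewrite divr_ge0 // subr_ge0 as_ // mem_nth.
pose a' := D *: a + b; pose c' := D * c + be.
have a's (i : 'I_(size s)) : dotv a' s`_i <= c' /\
    (dotv a' s`_i = c' -> dotv a s`_i = c /\ dotv b s`_i = be).
  rewrite /a' /c' dotvDl dotvZl.
  have := as_ _ (mem_nth 0 (ltn_ord i)); rewrite le_eqVlt => /orP[/eqP ai|lt].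
    have := immax i; rewrite ai eqxx => /(_ isT); rewrite -/be => bi.
    by split=> [|/addrI]; rewrite ?lerD2l.
  by have := Dpos i lt; split; nra.
have a'le v : v \in s -> dotv a' v <= c'.
  by move=> vs; have := (a's (Ordinal (etrans (index_mem v s) vs))).1; rewrite nth_index.
have a'P := conv_hull_le a'le.
split.
- exists a', c'; split=> //; apply/seteqP; split=> [x [[xP /= ax] /= bx]|x [xP /= a'x]].
    by split=> //=; rewrite /a' /c' dotvDl dotvZl ax bx.
  have [w' [w'0 w'1 xE]] := xP; rewrite xE in a'x.
  have key := conv_hull_eq a'le w'0 w'1 a'x.
  have ax : dotv a x = c.
    rewrite xE dotv_conv -[RHS]mul1r -w'1 mulr_suml; apply: eq_bigr => i _.
    have [->|wi] := eqVneq (w' i) 0; first by rewrite !mul0r.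
    by rewrite ((a's i).2 (key i wi)).1.
  split=> //=; move: a'x; rewrite -xE /a' /c' dotvDl dotvZl ax.
  by move/addrI.
- by exists s`_im; split=> //; split=> //; apply/conv_hull_mem/mem_nth.
- move=> x [xP /= ax]; have := a'P x xP; rewrite /a' /c' dotvDl dotvZl ax.
  by rewrite lerD2l.
Qed.

Lemma face_convex P F x y (t : R) : polytope P -> faces P F -> 0 <= t <= 1 ->
  F x -> F y -> F ((1 - t) *: x + t *: y).
Proof.
move=> [[s ->] _] [a [c [_ ->]]] t01 [xP /= ax] [yP /= ay].
by split; [exact: conv_hull_convex|rewrite /= !dotvE ax ay; ring].
Qed.

Lemma face_sub P F : faces P F -> F `<=` P.
Proof. by move=> [a [c [_ ->]]] x []. Qed.

(** A linear functional that attains its maximum over [P] inside a segment of [P] also attains it at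
    an end. *)
Lemma face_in_segment P F u v : faces P F -> F !=set0 -> P u -> P v ->
  F `<=` segment u v -> F u \/ F v.
Proof.
move=> [a [c [aP ->]]] [x Fx] Pu Pv /(_ x Fx) [t [/andP[t0 t1] xE]].
move: Fx => [_ /=]; rewrite xE !dotvE => e.
have := aP u Pu; rewrite le_eqVlt => /orP[/eqP au|au]; first by left.
have := aP v Pv; rewrite le_eqVlt => /orP[/eqP av|av]; first by right.
have h1 : 0 <= (1 - t) * (c - dotv a u) by rewrite mulr_ge0 // subr_ge0 // ltW.
move: t0; rewrite le_eqVlt => /orP[/eqP t0|t0].
  by move: e; rewrite -t0; lra.
have h2 : 0 < t * (c - dotv a v) by rewrite mulr_gt0 // subr_gt0.
by lra.
Qed.

End ConvexHull.

(** * Vertices and edges recovered from the face lattice *)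

Section CombEquiv.
Variables (R : realType) (m n : nat) (P : set 'rV[R]_m) (Q : set 'rV[R]_n).
Variable f : set 'rV[R]_m -> set 'rV[R]_n.
Hypotheses (polP : polytope P) (bijf : set_bij (faces P) (faces Q) f).
Hypothesis lef : forall F G, faces P F -> faces P G -> (F `<=` G <-> f F `<=` f G).

Lemma face_set0 (k : nat) (S : set 'rV[R]_k) : faces S set0.
Proof.
exists 0, 1; split=> [x _|]; first by rewrite dotv0l.
by apply/seteqP; split=> // x [_ /=]; rewrite dotv0l => /esym/eqP; rewrite oner_eq0.
Qed.

Lemma comb_surj G : faces Q G -> exists2 F, faces P F & f F = G.
Proof. by case: bijf => _ _ h /h [F ? ?]; exists F. Qed.

Lemma comb_faces F : faces P F -> faces Q (f F).
Proof. by case: bijf => h _ _ /h. Qed.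

Lemma comb_inj F G : faces P F -> faces P G -> f F = f G -> F = G.
Proof. by case: bijf => _ h _ ? ?; apply: h; rewrite inE. Qed.

Lemma comb_set0 : f set0 = set0.
Proof.
have [G G1 G2] := comb_surj (face_set0 Q).
by have := (lef (face_set0 P) G1).1 (@sub0set _ _); rewrite G2 subset0.
Qed.

Lemma comb_nonempty F : faces P F -> f F !=set0 <-> F !=set0.
Proof.
move=> hF; rewrite -!set0P; split; apply: contra => /eqP e; apply/eqP.
  by rewrite e comb_set0.
by apply: comb_inj => //; [exact: face_set0|rewrite comb_set0].
Qed.

(** A face with two points [x] and [y] would have a proper nonempty subface, the part where
    [dotv (x - y)] is maximal, whereas strictly below [[set w]] there is only the empty face. *)
Lemma comb_vertex w : faces Q [set w] -> exists2 v, faces P [set v] & f [set v] = [set w].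
Proof.
move=> hw; have [G G1 G2] := comb_surj hw.
have G0 : G !=set0 by apply/comb_nonempty => //; rewrite G2; exists w.
have [x Gx] := G0; suff GE : G = [set x] by exists x; rewrite -GE.
apply/seteqP; split=> [y Gy|_ -> //]; apply/esym/eqP; rewrite -subr_eq0; apply/eqP.
have [be [h1 h2 _]] := face_argmax (x - y) polP G1 G0.
have e : G `&` [set z | dotv (x - y) z = be] = G.
  apply: comb_inj => //; apply/seteqP; split; first by apply/lef => // z [].
  rewrite G2 => _ ->; have /comb_nonempty [//|z fz] := h2.
  have /lef : G `&` [set z | dotv (x - y) z = be] `<=` G by move=> ? [].
  by move=> /(_ h1 G1) /(_ _ fz); rewrite G2 => <-.
have [_ /= ex] : (G `&` [set z | dotv (x - y) z = be]) x by rewrite e.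
have [_ /= ey] : (G `&` [set z | dotv (x - y) z = be]) y by rewrite e.
by apply: sqnorm_eq0; rewrite /sqnorm [in LHS]dotvDr dotvNr ex ey subrr.
Qed.

Lemma comb_mem F v w : faces P F -> faces P [set v] -> f [set v] = [set w] ->
  F v <-> f F w.
Proof.
move=> hF hv e; have := lef hv hF; rewrite e => h.
by split=> [Fv|Fw]; [apply: h.1|apply: h.2] => // _ ->.
Qed.

(** The image of a nonempty subface of the preimage [G] lies in the segment and so contains [w] or
    [w']; hence every linear functional is maximal on [G] at [v] or at [v']. Applied to the
    component of [x - v] orthogonal to [v' - v], this puts [G] on the line; applied to [v' - v] and
    its opposite, it puts [G] between the two points. *)
Lemma comb_edge w w' v v' : w <> w' -> faces Q (segment w w') ->
  faces P [set v] -> f [set v] = [set w] -> faces P [set v'] -> f [set v'] = [set w'] ->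
  is_edge P v v'.
Proof.
move=> ww' hs hv ev hv' ev'; split.
  by move=> vv'; apply: ww'; have : [set w] w' by rewrite -ev vv' ev'.
have [G G1 G2] := comb_surj hs.
have Gv : G v by apply/(comb_mem G1 hv ev); rewrite G2; exact: segment_idl.
have Gv' : G v' by apply/(comb_mem G1 hv' ev'); rewrite G2; exact: segment_idr.
have Qw : Q w by apply: (face_sub hs); exact: segment_idl.
have Qw' : Q w' by apply: (face_sub hs); exact: segment_idr.
have bnd b x : G x -> dotv b x <= dotv b v \/ dotv b x <= dotv b v'.
  move=> Gx; have [be [h1 h2 h3]] := face_argmax b polP G1 (ex_intro _ v Gv).
  have fs : f (G `&` [set z | dotv b z = be]) `<=` segment w w'.
    by rewrite -G2; apply/lef => // z [].
  have [] := face_in_segment (comb_faces h1) ((comb_nonempty h1).2 h2) Qw Qw' fs.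
    by move=> /(comb_mem h1 hv ev) [_ /= ->]; left; apply: h3.
  by move=> /(comb_mem h1 hv' ev') [_ /= ->]; right; apply: h3.
suff -> : segment v v' = G by [].
apply/seteqP; split=> [x [t [t01 ->]]|x Gx]; first exact: face_convex G1 t01 Gv Gv'.
have [u uE] : exists u, u = v' - v by eexists.
have uu : 0 < dotv u u.
  apply: sqnorm_gt0; rewrite uE subr_eq0; apply/eqP => vv'; apply: ww'.
  by have : [set w] w' by rewrite -ev -vv' ev'.
pose t := dotv u (x - v) / dotv u u.
have tE : t * dotv u u = dotv u (x - v) by rewrite divfK // lt0r_neq0.
have y0 : x - v - t *: u = 0.
  apply: sqnorm_eq0; set y := x - v - t *: u.
  have yu : dotv y u = 0 by rewrite dotvC /y dotvDr dotvNr dotvZr tE subrr.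
  have yv : dotv y v' = dotv y v.
    by move: yu; rewrite uE dotvDr dotvNr => /eqP; rewrite subr_eq0 => /eqP.
  have yx : dotv y x <= dotv y v by have [] := bnd y x Gx; rewrite ?yv.
  have yy : sqnorm y = dotv y x - dotv y v.
    by rewrite /sqnorm {2}/y dotvDr dotvNr dotvZr yu mulr0 subr0 dotvDr dotvNr.
  by apply/eqP; rewrite eq_le sqnorm_ge0 andbT yy subr_le0.
exists t; split; last first.
  move/eqP: y0; rewrite subr_eq0 => /eqP e; rewrite -[x](subrK v) e uE.
  by apply/rowP => i; rewrite !mxE; ring.
have uv : dotv u v' = dotv u v + dotv u u.
  have -> : dotv u u = dotv u (v' - v) by rewrite -uE.
  by rewrite dotvDr dotvNr; ring.
have e : dotv u x = dotv u v + t * dotv u u by rewrite tE dotvDr dotvNr; ring.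
apply/andP; split.
  have := bnd (- u) x Gx; rewrite !dotvNl => h.
  have : 0 <= t * dotv u u by case: h; lra.
  by rewrite pmulr_lge0.
have : t * dotv u u <= 1 * dotv u u by case: (bnd u x Gx); lra.
by rewrite ler_pM2r.
Qed.

End CombEquiv.

Definition sgn (R : realType) (b : bool) : R := (-1) ^+ b.

Lemma sgnM (R : realType) (b c : bool) : sgn R b * sgn R c = sgn R (b (+) c).
Proof. by rewrite /sgn signr_addb. Qed.

Lemma sgnN (R : realType) (b : bool) : sgn R (~~ b) = - sgn R b.
Proof. by rewrite /sgn signrN. Qed.

Lemma sgn_sqr (R : realType) (b : bool) : sgn R b * sgn R b = 1.
Proof. by rewrite sgnM addbb. Qed.

Lemma sgn_le1 (R : realType) (b : bool) : sgn R b <= 1.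
Proof. by rewrite /sgn; case: b; rewrite ?expr0 ?expr1 //; lra. Qed.

Lemma sgn_eq1 (R : realType) (b : bool) : sgn R b = 1 -> b = false.
Proof. by case: b; rewrite // /sgn expr1; lra. Qed.

(** * Faces of the standard cross-polytope *)

Section CrossPolytope.
Variables (R : realType) (n : nat).

Definition cross_vertex (i : 'I_n) (b : bool) : 'rV[R]_n := sgn R b *: delta_mx 0 i.

Lemma dotv_delta (a : 'rV[R]_n) (i : 'I_n) : dotv a (delta_mx 0 i) = a 0 i.
Proof.
rewrite /dotv (bigD1 i) //= big1 ?addr0; first by rewrite mxE !eqxx mulr1.
by move=> k /negPf ki; rewrite mxE ki andbF mulr0.
Qed.

Lemma dotv_cross_vertex (a : 'rV[R]_n) i b :
  dotv a (cross_vertex i b) = sgn R b * a 0 i.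
Proof. by rewrite dotvZr dotv_delta. Qed.

Definition cross_seq : seq 'rV[R]_n :=
  [seq delta_mx 0 i | i <- enum 'I_n] ++ [seq - delta_mx 0 i | i <- enum 'I_n].

Lemma cross_seqP x : x \in cross_seq <-> exists i b, x = cross_vertex i b.
Proof.
rewrite /cross_seq mem_cat; split.
  case/orP => /mapP [i _ ->]; first by exists i, false; rewrite /cross_vertex scale1r.
  by exists i, true; rewrite /cross_vertex /sgn expr1 scaleN1r.
case=> i [[] ->]; apply/orP; [right|left]; apply/mapP; exists i; rewrite ?mem_enum //.
  by rewrite /cross_vertex /sgn expr1 scaleN1r.
by rewrite /cross_vertex scale1r.
Qed.

(** Only antipodal pairs are left out: [j = i] with [c = b] gives the vertex itself as a degenerate
    segment. The exposing functional has the signs of the two vertices on their axes and 0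
    elsewhere. *)
Lemma cross_face_segment i b j c :
  faces (std_cross_polytope R n) (segment (cross_vertex i b) (cross_vertex j c)) \/
  i = j /\ c = ~~ b.
Proof.
have [[ij cb]|h] := pselect (i = j /\ c = ~~ b); [by right|left].
pose a : 'rV[R]_n := \row_k (if (k == i) then sgn R b else if k == j then sgn R c else 0).
have ac k e : dotv a (cross_vertex k e) =
    sgn R e * (if k == i then sgn R b else if k == j then sgn R c else 0).
  by rewrite dotv_cross_vertex mxE.
have ai : dotv a (cross_vertex i b) = 1 by rewrite ac eqxx sgn_sqr.
have aj : dotv a (cross_vertex j c) = 1.
  rewrite ac; case: eqP => [ji|_]; last by rewrite eqxx sgn_sqr.
  rewrite (_ : c = b) ?sgn_sqr //; apply: contrapT => cb; apply: h; split=> //.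
  by case: (b) (c) cb => -[].
apply: (@conv_hull_face_segment _ _ a 1).
- move=> x /cross_seqP [k [e ->]]; rewrite ac.
  case: ifP => _; [|case: ifP => _]; rewrite ?mulr0 ?ler01 // sgnM; exact: sgn_le1.
- move=> x /cross_seqP [k [e ->]]; rewrite ac.
  case: eqP => [->|_]; [|case: eqP => [->|_]].
  + by rewrite sgnM => /sgn_eq1; case: (e) (b) => -[] // _; left.
  + by rewrite sgnM => /sgn_eq1; case: (e) (c) => -[] // _; right.
  + by rewrite mulr0 => /esym/eqP; rewrite oner_eq0.
- by apply/cross_seqP; exists i, b.
- by apply/cross_seqP; exists j, c.
- exact: ai.
- exact: aj.
Qed.

Lemma cross_facet (e : 'I_n -> bool) : exists F, faces (std_cross_polytope R n) F /\
  forall i, F (cross_vertex i (e i)) /\ ~ F (cross_vertex i (~~ e i)).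
Proof.
pose a : 'rV[R]_n := \row_k sgn R (e k).
have ac k c : dotv a (cross_vertex k c) = sgn R (c (+) e k).
  by rewrite dotv_cross_vertex mxE sgnM.
exists (std_cross_polytope R n `&` [set x | dotv a x = 1]); split.
  exists a, 1; split=> //; apply: conv_hull_le => x /cross_seqP [k [c ->]].
  by rewrite ac sgn_le1.
move=> i; split.
  by split; [apply/conv_hull_mem/cross_seqP; exists i, (e i)|rewrite /= ac addbb].
by case=> _ /=; rewrite ac addNb addbb => /sgn_eq1.
Qed.

Lemma cross_vertex_inj i b j c : cross_vertex i b = cross_vertex j c -> i = j.
Proof.
move=> /rowP /(_ i); rewrite !mxE !eqxx /= mulr1.
case: eqP => // _; rewrite mulr0 => /eqP; rewrite /sgn signr_eq0 //.
Qed.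

End CrossPolytope.

(** Along the line, [sqnorm - 1] is a quadratic polynomial built from [U], [W] and [V]. Meeting the
    sphere once makes its discriminant vanish, so [W^2 = U V]; the contact lying between [u] and [v]
    makes [W] negative. The normalised product is then [W / sqrt (U V) = -1]. *)
Lemma tangent_edge_lf (R : realType) (d : nat) (u v : 'rV[R]_d.+1) :
  u <> v -> 1 < sqnorm u -> 1 < sqnorm v -> tangent_edge u v ->
  lf (point_vec u) (point_vec v) = -1.
Proof.
move=> uv u1 v1 [_ [[t [/andP[t0 t1] ->]] h]].
pose U := sqnorm u - 1; pose V := sqnorm v - 1; pose W := dotv u v - 1.
have qE s : sqnorm ((1 - s) *: u + s *: v) =
    1 + ((1 - s) ^+ 2 * U + 2 * s * (1 - s) * W + s ^+ 2 * V).
  by rewrite /U /V /W /sqnorm !dotvE (dotvC v u); ring.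
have U0 : 0 < U by rewrite subr_gt0.
have V0 : 0 < V by rewrite subr_gt0.
have N0 : 0 < U - 2 * W + V.
  have : u - v != 0 by rewrite subr_eq0; apply/eqP.
  by move=> /sqnorm_gt0; rewrite /U /V /W /sqnorm !dotvE (dotvC v u); lra.
have qt : (1 - t) ^+ 2 * U + 2 * t * (1 - t) * W + t ^+ 2 * V = 0.
  have : (line u v `&` usphere R d.+1) ((1 - t) *: u + t *: v) by rewrite h.
  by case=> _ /=; rewrite /usphere /= qE; lra.
(* The other root, from the sum of the two roots; uniqueness of the contact point gives [s = t]. *)
pose s := 2 * (U - W) / (U - 2 * W + V) - t.
have sN : s * (U - 2 * W + V) = 2 * (U - W) - t * (U - 2 * W + V).
  by rewrite mulrBl divfK // lt0r_neq0.
have qs : (1 - s) ^+ 2 * U + 2 * s * (1 - s) * W + s ^+ 2 * V = 0.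
  rewrite -qt; apply/eqP; rewrite -subr_eq0; apply/eqP.
  have -> : (1 - s) ^+ 2 * U + 2 * s * (1 - s) * W + s ^+ 2 * V -
     ((1 - t) ^+ 2 * U + 2 * t * (1 - t) * W + t ^+ 2 * V) =
     (s - t) * (s * (U - 2 * W + V) - (2 * (U - W) - t * (U - 2 * W + V))) by ring.
  by rewrite sN subrr mulr0.
have st : s = t.
  have : (line u v `&` usphere R d.+1) ((1 - s) *: u + s *: v).
    by split; [exists s|rewrite /usphere /= qE qs addr0].
  rewrite h => /= e; have : (s - t) *: (v - u) = 0.
    transitivity (((1 - s) *: u + s *: v) - ((1 - t) *: u + t *: v)).
      by apply/rowP => i; rewrite !mxE; ring.
    by rewrite e subrr.
  move/eqP; rewrite scaler_eq0 !subr_eq0 => /orP[/eqP //|/eqP vu].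
  by case: uv; rewrite vu.
have W2 : W ^+ 2 = U * V.
  have tN : t * (U - 2 * W + V) = U - W by move: sN; rewrite st; lra.
  have : (U - 2 * W + V) * ((1 - t) ^+ 2 * U + 2 * t * (1 - t) * W + t ^+ 2 * V) = 0.
    by rewrite qt mulr0.
  have -> : (U - 2 * W + V) * ((1 - t) ^+ 2 * U + 2 * t * (1 - t) * W + t ^+ 2 * V)
    = U * V - W ^+ 2 + (t * (U - 2 * W + V) - (U - W)) ^+ 2 by ring.
  by rewrite tN subrr expr0n addr0 => /eqP; rewrite subr_eq0 => /eqP.
have W0 : W < 0.
  rewrite ltNge; apply/negP => W0.
  have h1 : 0 <= (1 - t) ^+ 2 * U by rewrite mulr_ge0 ?sqr_ge0 // ltW.
  have h2 : 0 <= 2 * t * (1 - t) * W by rewrite !mulr_ge0 // subr_ge0.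
  have h3 : 0 <= t ^+ 2 * V by rewrite mulr_ge0 ?sqr_ge0 // ltW.
  have [tz|tz] := eqVneq t 0; first by move: qt; rewrite tz; lra.
  have : 0 < t ^+ 2 * V by rewrite mulr_gt0 // exprn_gt0 // lt_def tz.
  by lra.
rewrite lfZl lfZr lf_lift_sphere mulr1 -/U -/V -/W mulrA -invfM mulrC.
rewrite -sqrtrM ?(ltW U0) // -W2 sqrtr_sqr ltr0_norm // invrN mulrN mulfV //.
by rewrite lt_eqF.
Qed.

Section LorentzBasis.
Variables (R : realType) (d : nat).

Let row x : 'rV[R]_(d + 1 + 1) := row_mx (row_mx x.1.1 x.1.2) x.2.
Let row' (x : lor R d) : 'rV[R]_(d + 1 + 1) :=
  row_mx (row_mx x.1.1 (- 2^-1 *: x.2)) (- 2^-1 *: x.1.2).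

Let lf_row x y : lf x y = (row x *m (row' y)^T) 0 0.
Proof.
rewrite !tr_row_mx !mul_row_col !mxE !big_ord1 !mxE /lf.
have -> : \sum_j x.1.1 0 j * (y.1.1)^T j 0 = dotv x.1.1 y.1.1.
  by apply: eq_bigr => i _; rewrite mxE.
by field.
Qed.

(** [row'] holds dual coordinates, which turn the form into a matrix product; a diagonal Gram matrix
    with nonzero entries then makes the matrix of the [b i] invertible. *)
Lemma lor_orthogonal_basis (b : 'I_(d + 1 + 1) -> lor R d) (z : lor R d) :
  (forall i j, i != j -> lf (b i) (b j) = 0) -> (forall i, lf (b i) (b i) != 0) ->
  (forall i, lf (b i) z = 0) -> z = 0.
Proof.
move=> ob nb bz; pose B := \matrix_i row (b i); pose B' := \matrix_i row' (b i).
have G : B *m B'^T = diag_mx (\row_i lf (b i) (b i)).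
  apply/matrixP => i j; rewrite [RHS]mxE [in RHS]mxE.
  transitivity (lf (b i) (b j)).
    by rewrite lf_row !mxE; apply: eq_bigr => k _; rewrite !mxE.
  by case: eqP => [->|/eqP /ob]; rewrite ?mulr1n ?mulr0n.
have uB : B \in unitmx.
  have : B *m B'^T \in unitmx.
    rewrite G unitmxE det_diag unitfE; apply/prodf_neq0 => i _; rewrite mxE; exact: nb.
  by rewrite unitmx_mul => /andP[].
have z0 : row' z = 0.
  apply: trmx_inj; rewrite trmx0; apply: (can_inj (mulKmx uB)).
  rewrite mulmx0; apply/colP => i; rewrite [RHS]mxE -(bz i) lf_row !mxE.
  by apply: eq_bigr => k _; rewrite !mxE.
move: z0; rewrite -[0]row_mx0 => /eq_row_mx [].
rewrite -[0 : 'rV_(d + 1)]row_mx0 => /eq_row_mx [z1 z2] z3.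
have e (x : 'rV[R]_1) : - 2^-1 *: x = 0 -> x = 0.
  move/eqP; rewrite scaler_eq0 oppr_eq0 invr_eq0 => /orP[|/eqP //].
  by rewrite pnatr_eq0.
by case: z z1 z2 z3 {bz} => [[zb zs] zt] /= -> /e -> /e ->.
Qed.

End LorentzBasis.

Lemma lor3_orthogonal_basis (R : realType) (b0 b1 b2 b3 b4 z : lor R 3) :
  lf b0 b1 = 0 -> lf b0 b2 = 0 -> lf b0 b3 = 0 -> lf b0 b4 = 0 -> lf b1 b2 = 0 ->
  lf b1 b3 = 0 -> lf b1 b4 = 0 -> lf b2 b3 = 0 -> lf b2 b4 = 0 -> lf b3 b4 = 0 ->
  lf b0 b0 != 0 -> lf b1 b1 != 0 -> lf b2 b2 != 0 -> lf b3 b3 != 0 -> lf b4 b4 != 0 ->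
  lf b0 z = 0 -> lf b1 z = 0 -> lf b2 z = 0 -> lf b3 z = 0 -> lf b4 z = 0 -> z = 0.
Proof.
move=> *; apply: (@lor_orthogonal_basis R 3 (fun i => nth b0 [:: b0; b1; b2; b3; b4] i)).
- by case=> [[|[|[|[|[|?]]]]] ?] [[|[|[|[|[|?]]]]] ?] //= _; rewrite // lfC.
- by case=> [[|[|[|[|[|?]]]]] ?].
- by case=> [[|[|[|[|[|?]]]]] ?].
Qed.

(** * Rigidity of the cross-polytope *)

Section Rigidity.
Variable R : realType.

(** The total sum, two differences and a difference of sums of [e1], [e2], [e3], [e4] are
    orthogonal, so with [A] they form an orthogonal basis of the five-dimensional space. *)
Lemma tetra_basis (e1 e2 e3 e4 A z : lor R 3) :
  lf e1 e1 = 1 -> lf e2 e2 = 1 -> lf e3 e3 = 1 -> lf e4 e4 = 1 ->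
  lf e1 e2 = -1 -> lf e1 e3 = -1 -> lf e1 e4 = -1 -> lf e2 e3 = -1 -> lf e2 e4 = -1 ->
  lf e3 e4 = -1 -> lf e1 A = 0 -> lf e2 A = 0 -> lf e3 A = 0 -> lf e4 A = 0 ->
  lf A A != 0 ->
  lf e1 z = 0 -> lf e2 z = 0 -> lf e3 z = 0 -> lf e4 z = 0 -> lf A z = 0 -> z = 0.
Proof.
move=> h11 h22 h33 h44 h12 h13 h14 h23 h24 h34 a1 a2 a3 a4 aa z1 z2 z3 z4 za.
apply: (@lor3_orthogonal_basis _ (e1 + e2 + e3 + e4) (e1 - e2) (e3 - e4)
  (e1 + e2 - e3 - e4) A) => //; rewrite !(lfDl, lfDr, lfNl, lfNr)
  ?(lfC e2 e1) ?(lfC e3 e1) ?(lfC e4 e1) ?(lfC e3 e2) ?(lfC e4 e2) ?(lfC e4 e3)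
  ?h11 ?h22 ?h33 ?h44 ?h12 ?h13 ?h14 ?h23 ?h24 ?h34 ?a1 ?a2 ?a3 ?a4 ?z1 ?z2 ?z3 ?z4;
  try (by ring); by apply/eqP; lra.
Qed.

Lemma sum_indic (i : 'I_4) (x y : R) (g : 'I_4 -> R) :
  (forall j, g j = if i == j then x else y) -> \sum_j g j = x + 3 * y.
Proof.
move=> gE; rewrite (bigD1 i) //= gE eqxx; congr (_ + _).
rewrite (eq_bigr (fun _ => y)) => [|j /negPf]; last by rewrite gE eq_sym => ->.
by rewrite sumr_const cardC1 card_ord mulr_natl.
Qed.

Lemma lf_sumr d (I : finType) (F : I -> lor R d) u :
  lf u (\sum_i F i) = \sum_i lf u (F i).
Proof.
elim/big_rec2: _ => [|i y z _ <-]; last by rewrite lfDr.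
by rewrite lfC lf0l.
Qed.

(** [E] and [F] are the vertex vectors of two opposite facets, [E i] antipodal to [F i], and [A] is
    the polar vector of the facet of [E]. Among the vertices, only the antipodal products are
    unknown. *)
Variables (E F : 'I_4 -> lor R 3) (A : lor R 3).
Hypotheses (EE : forall i j, lf (E i) (E j) = if i == j then 1 else -1)
  (FF : forall i j, lf (F i) (F j) = if i == j then 1 else -1)
  (EF : forall i j, i != j -> lf (E i) (F j) = -1)
  (EA : forall i, lf (E i) A = 0) (FA : forall i, lf (F i) A < 0) (A0 : 0 < lf A A).

Let Sg := \sum_i E i.
Let al i := (lf (E i) (F i) + 3) / 4.
Let ga i := lf (F i) A / lf A A.

Let ord4 (G : 'I_4 -> Prop) : G (inord 0) -> G (inord 1) -> G (inord 2) -> G (inord 3) ->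
  forall i, G i.
Proof.
move=> h0 h1 h2 h3 i; rewrite -(inord_val i); case: i => [[|[|[|[|?]]]] ?] //.
Qed.

Let inordE (i j : nat) : (i < 4)%N -> (j < 4)%N -> (inord i == inord j :> 'I_4) = (i == j).
Proof. by move=> hi hj; rewrite -val_eqE /= !inordK. Qed.

Let ESg i : lf (E i) Sg = -2.
Proof. by rewrite lf_sumr (@sum_indic i 1 (-1)) //; ring. Qed.

Let FSg i : lf (F i) Sg = 4 * al i - 6.
Proof.
rewrite lf_sumr (@sum_indic i (lf (E i) (F i)) (-1)); first by rewrite /al; field.
by move=> j; rewrite lfC; case: eqP => [->//|/eqP ij]; rewrite EF // eq_sym.
Qed.

(** [F i] solved for in the basis of the [E j] and [A]: since it has the same product with all
    [E j], [j != i], only [Sg], [E i] and [A] occur. *)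
Let F_expand i : F i = (1 - al i) *: Sg + (2 * al i - 1) *: E i + ga i *: A.
Proof.
have SgA : lf Sg A = 0 by rewrite lfC lf_sumr big1 // => j _; rewrite lfC EA.
apply/eqP; rewrite -subr_eq0; apply/eqP; set z := _ - _.
have zE j : lf (E j) z = 0.
  rewrite /z !(lfDr, lfNr, lfZr) ESg EE EA; case: eqP => [->|/eqP ji].
    by rewrite /al; field.
  by rewrite EF //; ring.
have zA : lf A z = 0.
  rewrite /z !(lfDr, lfNr, lfZr) (lfC A Sg) SgA (lfC A (E i)) EA (lfC A (F i)) /ga.
  by field; rewrite lt0r_neq0.
by apply: (@tetra_basis (E (inord 0)) (E (inord 1)) (E (inord 2)) (E (inord 3)) A) => //;
  rewrite ?EE ?inordE // lt0r_neq0.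
Qed.

Let gaA i : lf (F i) A = ga i * lf A A.
Proof. by rewrite /ga divfK // lt0r_neq0. Qed.

Let EFal i : lf (E i) (F i) = 4 * al i - 3.
Proof. by rewrite /al; field. Qed.

Let norm_al i : ga i ^+ 2 * lf A A = 4 * (1 - al i ^+ 2).
Proof.
have := FF i i; rewrite eqxx {2}F_expand !(lfDr, lfZr) FSg gaA (lfC (F i)) EFal.
by lra.
Qed.

Let pair_al i j : i != j -> ga i * ga j * lf A A = 4 * (1 - al i) * (1 - al j).
Proof.
move=> ij; have := FF i j; rewrite (negPf ij) {1}F_expand !(lfDl, lfZl).
rewrite (lfC Sg) FSg (lfC A) gaA EF //.
by lra.
Qed.

Let ga_lt0 i : ga i < 0.
Proof. by rewrite /ga pmulr_llt0 ?invr_gt0. Qed.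

Let al_lt i : 0 < 1 - al i.
Proof.
have : 0 < 4 * (1 - al i ^+ 2).
  by rewrite -norm_al mulr_gt0 // lt_def sqr_ge0 sqrf_eq0 lt_eqF.
by nra.
Qed.

(** Eliminating [ga] between two norm relations and the pair relation leaves [(1 + al i) (1 + al j)
    = (1 - al i) (1 - al j)], once the nonzero factors [1 - al i] and [1 - al j] are cancelled. *)
Let al_opp i j : i != j -> al i + al j = 0.
Proof.
move=> ij; have h := pair_al ij; have hi := norm_al i; have hj := norm_al j.
have : (ga i ^+ 2 * lf A A) * (ga j ^+ 2 * lf A A) = (ga i * ga j * lf A A) ^+ 2 by ring.
rewrite h hi hj => e.
have : 32 * (1 - al i) * (1 - al j) * (al i + al j) = 0.
  have -> : 32 * (1 - al i) * (1 - al j) * (al i + al j) =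
    4 * (1 - al i ^+ 2) * (4 * (1 - al j ^+ 2)) - (4 * (1 - al i) * (1 - al j)) ^+ 2 by ring.
  by rewrite e subrr.
by move/eqP; rewrite !mulf_eq0 (gt_eqF (al_lt i)) (gt_eqF (al_lt j)) pnatr_eq0 /= => /eqP.
Qed.

(** Three numbers that cancel in pairs all vanish. *)
Let al0 i : al i = 0.
Proof.
suff [j [k [ij ik jk]]] : exists j k : 'I_4, [/\ i != j, i != k & j != k].
  by have := al_opp ij; have := al_opp ik; have := al_opp jk; lra.
elim/ord4: i.
- by exists (inord 1), (inord 2); rewrite !inordE.
- by exists (inord 0), (inord 2); rewrite !inordE.
- by exists (inord 1), (inord 0); rewrite !inordE.
- by exists (inord 1), (inord 2); rewrite !inordE.
Qed.

Lemma rigid_antipodal i : lf (E i) (F i) = -3.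
Proof. by rewrite EFal al0; ring. Qed.

(** With [al = 0] the sum [E i + F i] is [Sg] plus [ga i] times [A], and comparing the norm and pair
    relations shows that all [ga i] agree. *)
Lemma rigid_center i j : E i + F i = E j + F j.
Proof.
have [->//|ij] := eqVneq i j.
have gaE : ga i = ga j.
  have h := pair_al ij; have h' := norm_al i; rewrite !al0 in h h'.
  have n0 : ga i * lf A A != 0 by rewrite mulf_neq0 ?(gt_eqF A0) // (lt_eqF (ga_lt0 i)).
  by apply: (mulfI n0); lra.
by rewrite !F_expand !al0 gaE; lor_ring.
Qed.

End Rigidity.

Lemma interior_scale (R : realType) (n : nat) (P : set 'rV[R]_n) (a : 'rV[R]_n) :
  interior P 0 -> exists2 t : R, 0 < t & P (t *: a).
Proof.
move=> /nbhs_ballP [e /= e0 eP]; pose S := \sum_i `|a 0 i|.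
have S0 : 0 <= S by rewrite sumr_ge0.
have D0 : 0 < 1 + S by lra.
exists (e / (1 + S)); first exact: divr_gt0.
apply: eP; split=> // i j; rewrite !mxE /ball /= sub0r normrN normrM.
rewrite gtr0_norm ?divr_gt0 // mulrAC ltr_pdivrMr // ltr_pM2l // !ord1.
by rewrite /S (bigD1 j) //= addrCA ltrDl ltr_wpDr // sumr_ge0.
Qed.

(** All that is kept of the combinatorial type: vertices indexed by axis and sign, edges between
    different axes, a supporting hyperplane for each choice of signs. As 0 is interior the bound can
    be normalised to 1, which makes [a] a point of the polar. *)
Lemma orthoplicial_vertices (R : realType) (P : set 'rV[R]_4) :
  polytope P -> interior P 0 -> comb_equiv P (std_cross_polytope R 4) ->
  exists v : 'I_4 -> bool -> 'rV[R]_4,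
    [/\ forall i b, vertices P (v i b),
        forall i j b c, i != j -> is_edge P (v i b) (v j c)
      & forall e : 'I_4 -> bool, exists a : 'rV[R]_4,
          [/\ forall x, P x -> dotv a x <= 1, forall i, dotv a (v i (e i)) = 1
            & forall i, dotv a (v i (~~ e i)) < 1]].
Proof.
move=> polP intP [f [bijf lef]].
have vx (i : 'I_4) b : faces (std_cross_polytope R 4) [set cross_vertex R i b].
  by have [|[_]] := cross_face_segment R i b i b; [rewrite segment_id|case: b].
have vE (ib : 'I_4 * bool) : exists v, faces P [set v] /\
    f [set v] = [set cross_vertex R ib.1 ib.2].
  by have [v ? ?] := comb_vertex polP bijf lef (vx ib.1 ib.2); exists v.
have {vE} /choice [v vP] := vE.
exists (fun i b => v (i, b)); split.
- by move=> i b; have [] := vP (i, b).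
- move=> i j b c ij; have [v1 v2] := vP (i, b); have [v3 v4] := vP (j, c).
  apply: (comb_edge polP bijf lef _ _ v1 v2 v3 v4).
    by move=> /cross_vertex_inj; apply/eqP.
  by have [//|[/eqP]] := cross_face_segment R i b j c; rewrite (negPf ij).
move=> e; have [F [hF Fe]] := cross_facet R e.
have [G hG GF] := comb_surj bijf hF.
have Gv i : G (v (i, e i)).
  by have [v1 v2] := vP (i, e i); apply/(comb_mem lef hG v1 v2); rewrite GF; apply: (Fe i).1.
have Gv' i : ~ G (v (i, ~~ e i)).
  have [v1 v2] := vP (i, ~~ e i); move/(comb_mem lef hG v1 v2); rewrite GF; apply: (Fe i).2.
have Pv i b : P (v (i, b)).
  by have [v1 _] := vP (i, b); apply: (face_sub v1).
have [a [c [aP GE]]] := hG; rewrite GE in Gv Gv'.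
have av i : dotv a (v (i, e i)) = c by have [] := Gv i.
have av' i : dotv a (v (i, ~~ e i)) < c.
  have := aP _ (Pv i (~~ e i)); rewrite le_eqVlt => /orP[/eqP h|//].
  by case: (Gv' i); split; [exact: Pv|exact: h].
have c0 : 0 < c.
  have a0 : a != 0.
    by apply/eqP => a0; have := av' 0; rewrite -(av 0) a0 !dotv0l ltxx.
  have [t t0 Pt] := interior_scale a intP; have := aP _ Pt; rewrite dotvZr.
  by apply: lt_le_trans; rewrite mulr_gt0 // sqnorm_gt0.
exists (c^-1 *: a); split=> [x Px|i|i]; rewrite dotvZl mulrC.
- by rewrite ler_pdivrMr // mul1r aP.
- by rewrite av mulfV // gt_eqF.
- by rewrite ltr_pdivrMr // mul1r.
Qed.

(** * The orthogonal frame of an orthoplicial packing *)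

Section Frame.
Variable R : realType.

Definition frame (C : lor R 3) (U : 'I_4 -> lor R 3) :=
  [/\ lf C C = -1, forall i, lf C (U i) = 0,
      forall i j, lf (U i) (U j) = if i == j then 2 else 0
    & forall p, lf (null_vec p) C < 0].

Definition facet_vec (C : lor R 3) (U : 'I_4 -> lor R 3) (e : 'I_4 -> bool) :=
  C + 2^-1 *: \sum_i sgn R (e i) *: U i.

(** Reversed Cauchy-Schwarz: for [x] on the sphere, [|h x - c|^2 >= 0] and [|c|^2 < h^2] give
    [dotv x c < h]. *)
Lemma future_timelike d (C : lor R d) (c : 'rV[R]_d.+1) (h : R) :
  C = lift_sphere c h -> 0 < h -> lf C C < 0 -> forall p, lf (null_vec p) C < 0.
Proof.
move=> CE h0 CC p; have [x x1 <-] := stereo_surj p.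
have [l l0 e] := stereo_null_vec x1; rewrite -(pmulr_rlt0 _ l0) -lfZl -e.
move: CC; rewrite CE !lf_lift_sphere mul1r => CC.
have := sqnorm_ge0 (h *: x - c); rewrite /sqnorm !dotvE -/(sqnorm x) x1 (dotvC c x) => h1.
have : h * (2 * (dotv x c - h)) < 0 by lra.
by rewrite pmulr_rlt0 // pmulr_rlt0.
Qed.

Lemma spacelike_orthogonal d (C : lor R d) (a : 'rV[R]_d.+1) :
  lf C C < 0 -> lf C (lift_sphere a 1) = 0 -> 1 < sqnorm a.
Proof.
have [c [h ->]] := lift_sphere_surj C; rewrite !lf_lift_sphere mulr1 => CC Ca.
rewrite ltNge; apply/negP => a1.
have := sqnorm_ge0 (c - h *: a); rewrite /sqnorm !dotvE (dotvC a c) -/(sqnorm a) => h1.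
have : 0 <= h * h * (1 - sqnorm a) by rewrite mulr_ge0 ?subr_ge0 // -expr2 sqr_ge0.
have ca : dotv c a = h by lra.
by move: h1; rewrite ca; lra.
Qed.

Variables (C : lor R 3) (U : 'I_4 -> lor R 3).
Hypothesis fCU : frame C U.

Lemma frame_basis z : lf z C = 0 -> (forall i, lf z (U i) = 0) -> z = 0.
Proof.
move: fCU => [CC CU UU _] zC zU.
apply: (@lor_orthogonal_basis R 3 (fun i => if unlift ord0 i is Some j then U j else C)).
- move=> i j; case: unliftP => [i'|] ->; case: unliftP => [j'|] -> //.
  + by rewrite (inj_eq lift_inj) => /negPf ij; rewrite UU ij.
  + by rewrite lfC CU.
- move=> i; case: unliftP => [i'|] _; rewrite ?UU ?eqxx ?CC; apply/eqP; lra.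
- by move=> i; rewrite lfC; case: unliftP.
Qed.

Lemma lf_facet_vecr e z :
  lf z (facet_vec C U e) = lf z C + 2^-1 * \sum_i sgn R (e i) * lf z (U i).
Proof.
rewrite /facet_vec lfDr lfZr lf_sumr; congr (_ + _ * _).
by apply: eq_bigr => i _; rewrite lfZr.
Qed.

Lemma lf_facet_vecU e i : lf (U i) (facet_vec C U e) = sgn R (e i).
Proof.
move: fCU => [CC CU UU _]; rewrite lf_facet_vecr lfC CU add0r.
rewrite (@sum_indic R i (2 * sgn R (e i)) 0); first by field.
move=> j; rewrite UU; case: eqP => [->|_]; ring.
Qed.

Lemma lf_facet_vecC e : lf C (facet_vec C U e) = -1.
Proof.
move: fCU => [CC CU UU _]; rewrite lf_facet_vecr CC big1 ?mulr0 ?addr0 // => i _.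
by rewrite CU mulr0.
Qed.

Lemma facet_vec1 e : lf (facet_vec C U e) (facet_vec C U e) = 1.
Proof.
rewrite lf_facet_vecr lfC lf_facet_vecC (eq_bigr (fun=> 1)) => [|i _].
  by rewrite sumr_const card_ord; field.
by rewrite lfC lf_facet_vecU sgn_sqr.
Qed.

(** The four vertex vectors of a facet have a one-dimensional orthogonal complement; this identifies
    every vector polar to the facet. *)
Lemma facet_vec_orthogonal e z :
  (forall i, lf z (C + sgn R (e i) *: U i) = 0) -> z = (- lf z C) *: facet_vec C U e.
Proof.
move=> h; apply/eqP; rewrite -subr_eq0; apply/eqP; move: (fCU) => [CC CU UU _].
apply: frame_basis => [|i]; rewrite lfDl lfNl lfZl lfC.
  by rewrite (lfC _ C) lf_facet_vecC lfC; ring.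
have := h i; rewrite lfDr lfZr (lfC _ (U i)) (lfC (facet_vec _ _ _)) lf_facet_vecU => e1.
have := congr1 ( *%R (sgn R (e i))) e1; rewrite mulrDr mulrA sgn_sqr mul1r mulr0.
by move=> e2; lra.
Qed.

End Frame.

Lemma lift_sphere_inj (R : realType) (d : nat) (u v : 'rV[R]_d.+1) (h k : R) :
  lift_sphere u h = lift_sphere v k -> u = v.
Proof.
move=> e; have hk : h = k.
  by have := congr1 (fun A : lor R d => A.1.2 0 0 + A.2 0 0) e; rewrite /= !mxE; lra.
apply/eqP; rewrite -subr_eq0; apply/eqP/sqnorm_eq0.
have := lift_sphere_comb 1 (-1) h k u v; rewrite !scale1r !scaleN1r e subrr => e0.
have := lf_lift_sphere (u - v) (u - v) (1 * h + -1 * k) (1 * h + -1 * k).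
by rewrite -e0 lf0l hk /sqnorm; lra.
Qed.

Lemma standard_frame (R : realType) (P : set 'rV[R]_4) :
  edge_scribed P -> interior P 0 -> comb_equiv P (std_cross_polytope R 4) ->
  exists C U, [/\ frame C U,
    forall i b, exists2 v, vertices P v /\ 1 < sqnorm v & point_vec v = C + sgn R b *: U i
    & forall e, exists2 a, vertices (polar P) a /\ 1 < sqnorm a &
        cap (lift_sphere a 1) = cap (facet_vec C U e)].
Proof.
move=> [polP vP eP] intP cP.
have [v [vV vE vF]] := orthoplicial_vertices polP intP cP.
have v1 i b : 1 < sqnorm (v i b) by apply: vP.
have [E EdE] : exists E : 'I_4 -> bool -> lor R 3, forall i b, E i b = point_vec (v i b).
  by eexists.
have EE i b : lf (E i b) (E i b) = 1 by rewrite EdE; apply: point_vec1.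
have EF i j b c : i != j -> lf (E i b) (E j c) = -1.
  move=> ij; have ed := vE i j b c ij; rewrite !EdE; apply: tangent_edge_lf => //; last exact: eP.
  by case: ed.
have rho0 i b : 0 < (Num.sqrt (sqnorm (v i b) - 1))^-1.
  by rewrite invr_gt0 sqrtr_gt0 subr_gt0.
have Ea a i b : lf (E i b) (lift_sphere a 1) =
    (Num.sqrt (sqnorm (v i b) - 1))^-1 * (dotv a (v i b) - 1).
  by rewrite EdE lfZl lf_lift_sphere mulr1 dotvC.
have [a [_ a1 a2]] := vF (fun=> false).
have aE i : lf (E i false) (lift_sphere a 1) = 0 by rewrite Ea a1 subrr mulr0.
have aF i : lf (E i true) (lift_sphere a 1) < 0.
  by rewrite Ea pmulr_rlt0 ?subr_lt0 // (a2 i).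
have GE b i j : lf (E i b) (E j b) = if i == j then 1 else -1.
  by case: eqP => [->|/eqP]; [exact: EE|exact: EF].
have A0 : 0 < lf (lift_sphere a 1) (lift_sphere a 1).
  rewrite lf_lift_sphere mulr1 subr_gt0.
  (* The sum of the four vertex vectors of the facet has norm -8 and is orthogonal to the polar
     vector. *)
  apply: (@spacelike_orthogonal _ _ (\sum_i E i false)).
    rewrite lf_sumr (eq_bigr (fun=> -2)) => [|i _]; last first.
      rewrite lfC lf_sumr (@sum_indic R i 1 (-1)) ?GE //; ring.
    by rewrite sumr_const card_ord; lra.
  by rewrite lfC lf_sumr big1 // => i _; rewrite lfC.
have EF' i j : i != j -> lf (E i false) (E j true) = -1 by exact: EF.
have anti := rigid_antipodal (GE false) (GE true) EF' aE aF A0.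
have cen := rigid_center (GE false) (GE true) EF' aE aF A0.
pose C := 2^-1 *: (E 0 false + E 0 true).
pose U i := 2^-1 *: (E i false - E i true).
have EU i b : E i b = C + sgn R b *: U i.
  by rewrite /C (cen 0 i) /U /sgn; case: b; rewrite ?expr0 ?expr1; lor_field.
have CE i : C = 2^-1 *: (E i false + E i true) by rewrite /C (cen 0 i).
have CC : lf C C = -1.
  by rewrite /C !(lfDl, lfDr, lfZl, lfZr) !EE (lfC (E 0 true)) anti; field.
have fr : frame C U.
  split=> //.
  - move=> i; rewrite (CE i) !(lfDl, lfDr, lfNr, lfZl, lfZr) !EE (lfC (E i true)) anti.
    by field.
  - move=> i j; rewrite !(lfDl, lfDr, lfNl, lfNr, lfZl, lfZr).
    case: eqP => [->|/eqP ij]; first by rewrite !EE (lfC (E j true)) anti; field.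
    by rewrite !EF //; field.
  - have CL : C = lift_sphere
        ((2^-1 * (Num.sqrt (sqnorm (v 0 false) - 1))^-1) *: v 0 false +
         (2^-1 * (Num.sqrt (sqnorm (v 0 true) - 1))^-1) *: v 0 true)
        (2^-1 * (Num.sqrt (sqnorm (v 0 false) - 1))^-1 * 1 +
         2^-1 * (Num.sqrt (sqnorm (v 0 true) - 1))^-1 * 1).
      by rewrite -lift_sphere_comb /C !EdE scalerDr !scalerA.
    apply: (future_timelike CL); last by rewrite CC; lra.
    by have := rho0 0 false; have := rho0 0 true; lra.
exists C, U; split=> // [i b|e]; first by exists (v i b); rewrite // -EU EdE.
have [ae [aP ae1 ae2]] := vF e.
have orth y : (forall i, dotv y (v i (e i)) = 1) ->
    lift_sphere y 1 = (- lf (lift_sphere y 1) C) *: facet_vec C U e.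
  move=> h; apply: facet_vec_orthogonal => // i.
  by rewrite lfC -EU Ea h subrr mulr0.
have oa := orth ae ae1; set ka := - lf (lift_sphere ae 1) C in oa.
(* The sign is read off from a vertex outside the facet; a negative factor would give the cap of the
   opposite vector. *)
have ka0 : 0 < ka.
  have h1 : lf (E 0 (e 0)) (lift_sphere ae 1) = 0 by rewrite Ea ae1 subrr mulr0.
  have h2 : lf (E 0 (~~ e 0)) (lift_sphere ae 1) < 0 by rewrite Ea pmulr_rlt0 ?subr_lt0 ?ae2.
  move: h1 h2; rewrite !EU sgnN scaleNr !lfDl lfNl (lfC C) => h1 h2.
  by rewrite /ka; lra.
have a1e : 1 < sqnorm ae.
  rewrite -subr_gt0; have := lf_lift_sphere ae ae 1 1; rewrite mulr1 /sqnorm => <-.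
  by rewrite oa lfZl lfZr (facet_vec1 fr) mulr1 mulr_gt0.
exists ae; last by rewrite oa cap_scale.
(* On the polar each of the four summands is at most 1, so the value 4 is attained only where all
   are 1, and [orth] leaves a single such point. *)
split=> //; exists (\sum_i v i (e i)), 4.
have le1 y : polar P y -> forall i, dotv y (v i (e i)) <= 1.
  by move=> py i; rewrite dotvC; apply/py/(face_sub (vV i (e i))).
have dE y : dotv (\sum_i v i (e i)) y = \sum_i dotv y (v i (e i)) by rewrite dotvC dotv_sumr.
split=> [y py|].
  have -> : 4 = \sum_(i < 4) 1 :> R by rewrite sumr_const card_ord.
  by rewrite dE; apply: ler_sum => i _; apply: le1.
apply/seteqP; split=> [_ ->|y [py /= ey]].
  split; first by move=> x Px; rewrite dotvC; exact: aP.
  by rewrite /= dE (eq_bigr (fun=> 1)) ?sumr_const ?card_ord // => i _; rewrite ae1.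
have y1 i : dotv y (v i (e i)) = 1.
  have : \sum_i (1 - dotv y (v i (e i))) = 0.
    by rewrite sumrB -dE ey sumr_const card_ord subrr.
  move/eqP; rewrite psumr_eq0 => [/allP /(_ i (mem_index_enum i))|k _].
    by rewrite subr_eq0 => /eqP.
  by rewrite subr_ge0 le1.
have oy := orth y y1; apply: (@lift_sphere_inj _ _ _ _ 1 1); rewrite oa oy; congr (_ *: _).
set ky := - lf _ C in oy *; set A := facet_vec C U e in oa oy.
(* The last two coordinates of a [lift_sphere y 1] add up to 2, which fixes the multiple of [A]. *)
have h1 : ka * (A.1.2 0 0 + A.2 0 0) = 2.
  have := congr1 (fun z : lor R 3 => z.1.2 0 0 + z.2 0 0) oa; rewrite /= !mxE; lra.
have h2 : ky * (A.1.2 0 0 + A.2 0 0) = 2.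
  have := congr1 (fun z : lor R 3 => z.1.2 0 0 + z.2 0 0) oy; rewrite /= !mxE; lra.
have n0 : A.1.2 0 0 + A.2 0 0 != 0.
  by apply/eqP => n0; move: h1; rewrite n0 mulr0; lra.
by apply: (mulIf n0); rewrite h1 h2.
Qed.

(** The isometry of [mu] carries the frame along. From here on the polytope enters only through
    these balls and inversions. *)
Lemma orthoplicial_frame (R : realType) (P : set 'rV[R]_4) (mu : hat R 3 -> hat R 3) :
  orthoplicial P mu -> exists C U, [/\ frame C U,
    forall i b, packing P mu (cap (C + sgn R b *: U i))
    & forall e, exists2 f, apollonian_group P mu f & acts (refl (facet_vec C U e)) f].
Proof.
move=> [[esP intP /mobius_isometry [M [M' [h [[iM iM'] [K K'] ag [gh hg]]]]]] cP].
have [C [U [[CC CU UU Cneg] vE aE]]] := standard_frame esP intP cP.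
have MD x y : M (x + y) = M x + M y by have := iM.1 1 x y; rewrite !scale1r.
have MZ (t : R) x : M (t *: x) = t *: M x by apply: linear_scale; exact: iM.1.
have mucap A : mu @` cap A = cap (M A) := acts_cap A iM ag gh hg.
exists (M C), (fun i => M (U i)); split.
- split=> [|i|i j|p]; rewrite ?iM.2 //.
  have [l l0 e] := acts_inv iM'.1 K hg ag p.
  by rewrite -iM'.2 K e lfZl pmulr_rlt0.
- move=> i b; have [v [vv v1] e] := vE i b; exists (cap (point_vec v)).
    by exists v => //; rewrite cap_point_vec.
  by rewrite e mucap MD MZ.
- move=> e; have [a [av a1] ae] := aE e.
  have MA : M (facet_vec C U e) = facet_vec (M C) (fun i => M (U i)) e.
    rewrite /facet_vec MD MZ; congr (_ + _ *: _).
    apply: (big_ind2 (fun x y => M x = y)); first exact: linear_zero iM.1.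
      by move=> x1 y1 x2 y2 <- <-.
    by move=> i _; rewrite MZ.
  have h1 : lf (M (facet_vec C U e)) (M (facet_vec C U e)) = 1.
    by rewrite iM.2; apply: facet_vec1.
  have [f [bf af]] := ball_inversion_cap h1; exists f; last by rewrite -MA.
  apply: gen_in; exists (cap (M (facet_vec C U e))); split=> //.
  rewrite -mucap -ae -stereo_visible_cap //.
  by exists ((@stereo R 3) @` visible_cap a) => //; exists a.
Qed.

(** * Planar packings *)

Section ConvexHullMore.
Variables (R : realType) (n : nat).
Implicit Types (u v x y : 'rV[R]_n) (s : seq 'rV[R]_n) (P : set 'rV[R]_n).

Lemma conv_hull_fin (K : finType) (v : K -> 'rV[R]_n) s (w : K -> R) :
  (forall k, v k \in s) -> (forall k, 0 <= w k) -> \sum_k w k = 1 ->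
  conv_hull s (\sum_k w k *: v k).
Proof.
move=> vs w0 w1.
have iv k : (index (v k) s < size s)%N by rewrite index_mem.
pose h k := Ordinal (iv k).
exists (fun i => \sum_(k | h k == i) w k); split=> [i||]; first exact: sumr_ge0.
  by rewrite -w1 (partition_big h predT).
rewrite (partition_big h predT) //=; apply: eq_bigr => i _.
rewrite scaler_suml; apply: eq_bigr => k /eqP <-.
by rewrite /= nth_index.
Qed.

Lemma conv_hull_sub s s' : {subset s <= s'} -> conv_hull s `<=` conv_hull s'.
Proof.
move=> ss' _ [w [w0 w1 ->]]; apply: conv_hull_fin => // i.
by apply/ss'/mem_nth.
Qed.

Lemma eq_conv_hull s s' : s =i s' -> conv_hull s = conv_hull s'.
Proof. by move=> e; apply/seteqP; split; apply: conv_hull_sub => x; rewrite e. Qed.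

Lemma conv_hull_scale s (r : R) :
  conv_hull [seq r *: x | x <- s] = [set r *: x | x in conv_hull s].
Proof.
apply/seteqP; split=> [_ [w [w0 w1 ->]]|_ [_ [w [w0 w1 ->]] <-]].
  have lt (i : 'I_(size [seq r *: x | x <- s])) : (i < size s)%N.
    by case: i => i /=; rewrite size_map.
  exists (\sum_i w i *: s`_i).
    by apply: conv_hull_fin => // i; exact: mem_nth.
  rewrite scaler_sumr; apply: eq_bigr => i _.
  by rewrite (nth_map 0) // !scalerA mulrC.
rewrite scaler_sumr; under eq_bigr do rewrite scalerA mulrC -scalerA.
apply: conv_hull_fin => // i.
by apply: map_f; exact: mem_nth.
Qed.

Lemma polar_conv_hull s :
  polar (conv_hull s) = [set y | forall x, x \in s -> dotv x y <= 1].
Proof.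
apply/seteqP; split=> [y h x xs|y h x]; first by apply/h/conv_hull_mem.
by rewrite dotvC; apply: conv_hull_le => z zs; rewrite dotvC h.
Qed.

Lemma polytope_interior s : interior (conv_hull s) 0 -> polytope (conv_hull s).
Proof.
move=> h; split; first by exists s.
move=> a c ac; have c0 : c = 0 by rewrite -(ac 0) ?dotv0r //; exact: interior_subset.
have [t t0 /ac] := interior_scale a h; rewrite dotvZr c0 => /eqP.
by rewrite mulf_eq0 (gt_eqF t0) => /eqP /sqnorm_eq0.
Qed.

Lemma interior_cube P (e : R) : 0 < e -> (forall x, (forall i, `|x 0 i| < e) -> P x) ->
  interior P 0.
Proof.
move=> e0 h; apply/nbhs_ballP; exists e => //= y [_ hy]; apply: h => i.
by have := hy 0 i; rewrite mxE /ball /= sub0r normrN.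
Qed.

Lemma vertices_sub s v : vertices (conv_hull s) v -> v \in s.
Proof.
move=> [a [c [ac vE]]].
have [[w [w0 w1 vw]] /= av] : (conv_hull s `&` [set x | dotv a x = c]) v by rewrite -vE.
have as_ x : x \in s -> dotv a x <= c by move=> xs; apply/ac/conv_hull_mem.
have [i wi] : exists i, w i != 0.
  apply: contrapT => h; have : (\sum_i w i) = 0.
    by rewrite big1 // => i _; apply/eqP/negPn/negP => wi; apply: h; exists i.
  by rewrite w1 => /eqP; rewrite oner_eq0.
have ai : dotv a s`_i = c by apply: conv_hull_eq wi => //; rewrite -vw.
have <- : s`_i = v.
  have : (conv_hull s `&` [set x | dotv a x = c]) s`_i.
    by split=> //; apply/conv_hull_mem/mem_nth.
  by rewrite -vE.
exact: mem_nth.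
Qed.

Variables (s : seq 'rV[R]_n) (q : R).
Hypothesis sq : forall v, v \in s -> sqnorm v = q.

Lemma sphere_dotv u v : u \in s -> v \in s -> dotv u v <= q /\ (dotv u v = q -> v = u).
Proof.
move=> us vs; have h := sqnorm_ge0 (v - u).
have e : sqnorm (v - u) = 2 * (q - dotv u v).
  by rewrite /sqnorm !dotvE -!/(sqnorm _) !sq // (dotvC v u); ring.
split=> [|duv]; first by rewrite -subr_ge0 -(pmulr_rge0 _ (ltr0Sn _ 1)) -e.
by apply/eqP; rewrite -subr_eq0; apply/eqP/sqnorm_eq0; rewrite e duv subrr mulr0.
Qed.

Lemma sphere_vertices v : vertices (conv_hull s) v <-> v \in s.
Proof.
split=> [|vs]; first exact: vertices_sub.
rewrite /vertices /= -segment_id; apply: (@conv_hull_face_segment _ _ v q) => //.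
- by move=> x xs; apply: (sphere_dotv vs xs).1.
- by move=> x xs h; left; apply: (sphere_dotv vs xs).2.
- exact: sq.
- exact: sq.
Qed.

Lemma edge_vertexr u v : polytope (conv_hull s) -> is_edge (conv_hull s) u v -> v \in s.
Proof.
move=> polP [uv fuv]; apply: vertices_sub.
have [be [h1 [x [Fx /= bx]] h3]] :=
  face_argmax (v - u) polP fuv (ex_intro _ u (segment_idl u v)).
rewrite /vertices /=.
suff <- : segment u v `&` [set x | dotv (v - u) x = be] = [set v] by [].
have w0 : 0 < sqnorm (v - u) by apply: sqnorm_gt0; rewrite subr_eq0; apply/eqP => /esym.
have key y : segment u v y -> dotv (v - u) v <= dotv (v - u) y -> y = v.
  move=> [t [/andP[t0 t1] ->]]; rewrite !(dotvDr, dotvZr) => h.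
  have e : sqnorm (v - u) = dotv (v - u) v - dotv (v - u) u.
    by rewrite /sqnorm [in LHS]dotvDr dotvNr.
  have : (1 - t) * sqnorm (v - u) <= 0 by rewrite e; lra.
  rewrite pmulr_lle0 // subr_le0 => t1'.
  have -> : t = 1 by apply/eqP; rewrite eq_le t1 t1'.
  by rewrite subrr scale0r scale1r add0r.
have bv : dotv (v - u) v = be.
  have xv : x = v by apply: key => //; rewrite bx; apply/h3/segment_idr.
  by rewrite -bx xv.
apply/seteqP; split=> [y [Fy /= by_]|_ ->].
  by apply: key => //; rewrite bv by_.
by split=> //; exact: segment_idr.
Qed.

Lemma edge_sym u v : is_edge (conv_hull s) u v -> is_edge (conv_hull s) v u.
Proof.
have seg (a b : 'rV[R]_n) : segment a b `<=` segment b a.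
  move=> x [t [/andP[t0 t1] ->]]; exists (1 - t); rewrite subr_ge0 t1 gerBl t0.
  by split=> //; rewrite subKr addrC.
move=> [uv h]; split=> [/esym //|].
by rewrite (_ : segment v u = segment u v) //; apply/seteqP; split; apply: seg.
Qed.

(** A test that discards diagonals without listing faces: if [x] and [y] share the midpoint of the
    edge, the supporting functional is maximal at both, so [x] lies on the edge, and a chord meets
    the sphere only at its ends. *)
Lemma edge_midpoint u v x y : polytope (conv_hull s) -> is_edge (conv_hull s) u v ->
  x \in s -> y \in s -> x + y = u + v -> x = u \/ x = v.
Proof.
move=> polP ed xs ys xy; have vs := edge_vertexr polP ed.
have us := edge_vertexr polP (edge_sym ed).
move: ed => [uv [a [c [ac sE]]]].
have mem z : segment u v z -> dotv a z = c by rewrite sE => -[].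
have au := mem _ (segment_idl u v); have av := mem _ (segment_idr u v).
have ax : dotv a x = c.
  have h1 := ac _ (conv_hull_mem xs); have h2 := ac _ (conv_hull_mem ys).
  have := congr1 (dotv a) xy; rewrite !dotvDr au av => h3.
  by apply/eqP; rewrite eq_le h1 /=; clear -h2 h3; lra.
have [t [_ xE]] : segment u v x.
  by rewrite sE; split=> //; exact: conv_hull_mem.
have := sq xs; rewrite /sqnorm xE !dotvE -!/(sqnorm _) (dotvC v u) !sq // => e.
have : t * ((1 - t) * (q - dotv u v)) = 0 by clear -e; lra.
move/eqP; rewrite !mulf_eq0 => /or3P[/eqP t0|t1|duv].
- by left; rewrite t0 subr0 scale0r scale1r addr0.
- by right; move: t1; rewrite subr_eq0 => /eqP <-; rewrite subrr scale0r scale1r add0r.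
- case: uv; apply/esym/(sphere_dotv us vs).2/eqP.
  by rewrite eq_sym -subr_eq0.
Qed.

(** The value of [dotv u v] says that the midpoint has norm 1. *)
Lemma sphere_tangent u v : u <> v -> sqnorm u = q -> sqnorm v = q ->
  dotv u v = 2 - q -> tangent_edge u v.
Proof.
move=> uv u1 v1 duv; pose m := (1 - 2^-1) *: u + 2^-1 *: v.
have qE (t : R) : sqnorm ((1 - t) *: u + t *: v) = 1 + (2 * t - 1) ^+ 2 * (q - 1).
  by rewrite /sqnorm !dotvE -!/(sqnorm _) (dotvC v u) u1 v1 duv; ring.
have q1 : q - 1 != 0.
  apply/eqP => q1; apply: uv; apply/eqP; rewrite -subr_eq0; apply/eqP/sqnorm_eq0.
  rewrite /sqnorm !dotvE -!/(sqnorm _) (dotvC v u) u1 v1 duv.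
  have -> : q = 1 by apply/eqP; rewrite -subr_eq0 q1.
  by ring.
exists m; split; first by exists 2^-1; split=> //; clear uv; apply/andP; split; lra.
apply/seteqP; split=> [x [[t xE]]|_ ->].
  rewrite xE /usphere /= qE -[in RHS](addr0 1) => /addrI /eqP.
  rewrite mulf_eq0 (negPf q1) orbF sqrf_eq0 => /eqP t0.
  by have -> : t = 2^-1 by clear uv; lra.
split; first by exists 2^-1.
by rewrite /usphere /= qE mulfV ?pnatr_eq0 // subrr expr0n mul0r addr0.
Qed.

End ConvexHullMore.

Lemma comb_equiv_refl (R : realType) (n : nat) (P : set 'rV[R]_n) : comb_equiv P P.
Proof.
exists id; split=> //; split=> // F hF.
by exists F.
Qed.

Lemma comb_equiv_scale (R : realType) (n : nat) (P : set 'rV[R]_n) (r : R) :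
  0 < r -> comb_equiv [set r *: x | x in P] P.
Proof.
move=> r0; have r1 := lt0r_neq0 r0.
have rK : cancel ( *:%R r) ( *:%R r^-1 : 'rV[R]_n -> 'rV[R]_n).
  by move=> x; rewrite scalerA mulVf // scale1r.
have rVK : cancel ( *:%R r^-1) ( *:%R r : 'rV[R]_n -> 'rV[R]_n).
  by move=> x; rewrite scalerA mulfV // scale1r.
pose sc (t : R) (F : set 'rV[R]_n) := [set t *: x | x in F].
have scK : cancel (sc r) (sc r^-1).
  move=> F; rewrite /sc image_comp (_ : _ \o _ = id) ?image_id //.
  by apply/funext => x /=; rewrite rK.
have scVK : cancel (sc r^-1) (sc r).
  move=> F; rewrite /sc image_comp (_ : _ \o _ = id) ?image_id //.
  by apply/funext => x /=; rewrite rVK.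
have facesS (t : R) (Q : set 'rV[R]_n) F : t != 0 -> faces Q F -> faces (sc t Q) (sc t F).
  move=> t0 [a [c [ac ->]]]; exists (t^-1 *: a), c; split.
    by move=> _ [x Qx <-]; rewrite dotvZl dotvZr mulKf // ac.
  apply/seteqP; split=> [_ [x [Qx /= ax] <-]|_ [[x Qx <-] /=]].
    by split; [exists x|rewrite /= dotvZl dotvZr mulKf].
  by rewrite dotvZl dotvZr mulKf // => ax; exists x.
have scS (t : R) F G : F `<=` G -> sc t F `<=` sc t G.
  by move=> FG _ [x Fx <-]; exists x => //; exact: FG.
exists (sc r^-1); split; [split|].
- move=> F hF; have := @facesS r^-1 _ _ _ hF; rewrite -/(sc r P) scK; apply.
  by rewrite invr_eq0.
- by move=> F G _ _; apply: (can_inj scVK).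
- move=> F hF; exists (sc r F); last exact: scK.
  exact: facesS.
- move=> F G _ _; split; first exact: scS.
  by move=> /(scS r); rewrite !scVK.
Qed.

(** The last hypothesis lets each pair of vertices either have the product of a tangent edge or
    share its midpoint with another pair, in which case it is no edge. *)
Lemma planar_packing (R : realType) (I K : finType) (va : I -> 'rV[R]_3)
    (vx : K -> 'rV[R]_3) (q q' : R) :
  polar (conv_hull (codom vx)) = conv_hull (codom va) ->
  (forall k, sqnorm (vx k) = q) -> (forall i, sqnorm (va i) = q') -> 1 < q -> 1 < q' ->
  interior (conv_hull (codom vx)) 0 ->
  (forall k l, vx k <> vx l -> dotv (vx k) (vx l) = 2 - q \/
     exists k' l', [/\ vx k' + vx l' = vx k + vx l, vx k' <> vx k & vx k' <> vx l]) ->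
  [/\ polytopal (conv_hull (codom vx)) id,
      packing (conv_hull (codom vx)) id = range (fun k => cap (point_vec (vx k)))
    & exists2 g : I -> hat R 2 -> hat R 2,
        apollonian_group (conv_hull (codom vx)) id = generated (range g)
      & forall i, acts (refl (point_vec (va i))) (g i)].
Proof.
move=> polQ vq aq q1 q'1 intQ edg.
have sq v : v \in codom vx -> sqnorm v = q by move=> /codomP [k ->].
have sq' v : v \in codom va -> sqnorm v = q' by move=> /codomP [k ->].
have vert v : vertices (conv_hull (codom vx)) v <-> v \in codom vx.
  exact: sphere_vertices sq v.
have vert' v : vertices (polar (conv_hull (codom vx))) v <-> v \in codom va.
  by rewrite polQ; exact: sphere_vertices sq' v.
have polP := polytope_interior intQ.
have capx k : (@stereo R 2) @` visible_cap (vx k) = cap (point_vec (vx k)).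
  by rewrite cap_point_vec // vq.
have capa i : (@stereo R 2) @` visible_cap (va i) = cap (point_vec (va i)).
  by rewrite cap_point_vec // aq.
split.
- split=> //; last exact: gen_id.
  split=> // [v /vert /sq -> //|u v ed].
  have vs := edge_vertexr polP ed; have us := edge_vertexr polP (edge_sym ed).
  have [uv _] := ed; apply: (@sphere_tangent _ _ q) => //; [exact: sq|exact: sq|].
  case/codomP: us vs uv ed => k -> /codomP [l ->] kl ed.
  have [//|[k' [l' [e n1 n2]]]] := edg k l kl.
  by have [] := edge_midpoint sq polP ed (codom_f vx k') (codom_f vx l') e.
- apply/seteqP; split=> [_ [_ [v /vert /codomP [k ->] <-] <-]|_ [k _ <-]].
    by exists k => //; rewrite image_id capx.
  exists (cap (point_vec (vx k))); last by rewrite image_id.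
  by exists (vx k); [apply/vert/codom_f|exact: capx].
have a1 i : lf (point_vec (va i)) (point_vec (va i)) = 1 by rewrite point_vec1 // aq.
have /choice [g gP] i : exists f, ball_inversion (cap (point_vec (va i))) f /\
    acts (refl (point_vec (va i))) f by exact: ball_inversion_cap.
exists g; last by move=> i; have [] := gP i.
congr generated; apply/seteqP; split.
  move=> f [_ [[_ [v /vert' /codomP [i ->] <-] <-] bf]]; exists i => //.
  (* The relation [ball_inversion] is not a function by definition; [cap_inj] shows that the ball
     fixes the unit vector and so the inversion. *)
  move: bf; rewrite image_id capa => /ball_inversionP [A [A1 /cap_inj e af]].
  apply: acts_unique (gP i).2 _; rewrite e //.
move=> _ [i _ <-]; exists (cap (point_vec (va i))); split; last exact: (gP i).1.
exists (cap (point_vec (va i))); last by rewrite image_id.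
by exists (va i); [apply/vert'/codom_f|exact: capa].
Qed.

Notation o4 k := (@Ordinal 4 k isT).
Notation o3 k := (@Ordinal 3 k isT).

Lemma ord4_ind (G : 'I_4 -> Prop) : G (o4 0) -> G (o4 1) -> G (o4 2) -> G (o4 3) ->
  forall i, G i.
Proof.
move=> h0 h1 h2 h3 [[|[|[|[|//]]]] hi].
- by rewrite (_ : Ordinal hi = o4 0) //; apply: val_inj.
- by rewrite (_ : Ordinal hi = o4 1) //; apply: val_inj.
- by rewrite (_ : Ordinal hi = o4 2) //; apply: val_inj.
- by rewrite (_ : Ordinal hi = o4 3) //; apply: val_inj.
Qed.

Lemma ord3_ind (G : 'I_3 -> Prop) : G (o3 0) -> G (o3 1) -> G (o3 2) -> forall i, G i.
Proof.
move=> h0 h1 h2 [[|[|[|//]]] hi].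
- by rewrite (_ : Ordinal hi = o3 0) //; apply: val_inj.
- by rewrite (_ : Ordinal hi = o3 1) //; apply: val_inj.
- by rewrite (_ : Ordinal hi = o3 2) //; apply: val_inj.
Qed.

Section SmallSums.
Variable V : nmodType.

Lemma sum4E (F : 'I_4 -> V) :
  \sum_i F i = F (o4 0) + F (o4 1) + F (o4 2) + F (o4 3).
Proof.
rewrite !big_ord_recl big_ord0 addr0 !addrA.
by congr (F _ + F _ + F _ + F _); apply: val_inj.
Qed.

Lemma sum3E (F : 'I_3 -> V) : \sum_i F i = F (o3 0) + F (o3 1) + F (o3 2).
Proof.
rewrite !big_ord_recl big_ord0 addr0 !addrA.
by congr (F _ + F _ + F _); apply: val_inj.
Qed.

Lemma sum_bool3E (F : bool * bool * bool -> V) : \sum_k F k =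
  F (true, true, true) + F (true, true, false) +
  (F (true, false, true) + F (true, false, false)) +
  (F (false, true, true) + F (false, true, false) +
   (F (false, false, true) + F (false, false, false))).
Proof.
rewrite (eq_bigr (fun k => F (k.1, k.2))) => [|[] //].
rewrite -(pair_bigA _ (fun i j => F (i, j))) /=.
rewrite (eq_bigr (fun k => \sum_j F ((k.1, k.2), j))) => [|[] //].
rewrite -(pair_bigA _ (fun i j => \sum_l F ((i, j), l))) /=.
by rewrite !big_bool.
Qed.

Lemma sum_ord3_boolE (F : 'I_3 * bool -> V) : \sum_k F k =
  F (o3 0, true) + F (o3 0, false) + (F (o3 1, true) + F (o3 1, false)) +
  (F (o3 2, true) + F (o3 2, false)).
Proof.
rewrite (eq_bigr (fun k => F (k.1, k.2))) => [|[] //].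
by rewrite -(pair_bigA _ (fun i j => F (i, j))) /= sum3E !big_bool.
Qed.

End SmallSums.

(** * Edge-scribed tetrahedron, octahedron and cube *)

Section PlanarPolytopes.
Variable R : realType.
Implicit Types x y : 'rV[R]_3.

Lemma dotv3E x y : dotv x y =
  x 0 (o3 0) * y 0 (o3 0) + x 0 (o3 1) * y 0 (o3 1) + x 0 (o3 2) * y 0 (o3 2).
Proof. exact: sum3E. Qed.

Lemma row3_ext x y : x 0 (o3 0) = y 0 (o3 0) -> x 0 (o3 1) = y 0 (o3 1) ->
  x 0 (o3 2) = y 0 (o3 2) -> x = y.
Proof. by move=> *; apply/rowP; apply: ord3_ind. Qed.

Lemma sgn1 : (sgn R true = -1) * (sgn R false = 1).
Proof. by rewrite /sgn expr1 expr0. Qed.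

Definition tetra_vertex (k : 'I_4) : 'rV[R]_3 :=
  [:: vec3 1 1 1; vec3 1 (-1) (-1); vec3 (-1) 1 (-1); vec3 (-1) (-1) 1]`_k.

Definition tetra_dual (k : 'I_4) : 'rV[R]_3 := - tetra_vertex k.

(** The four vertices sum to 0 and their matrices [v^T v] sum to 4 times the identity, so these
    weights are barycentric coordinates. *)
Lemma tetra_decomp x :
  x = \sum_k ((1 + dotv (tetra_vertex k) x) / 4) *: tetra_vertex k.
Proof. by rewrite sum4E; apply: row3_ext; rewrite !dotv3E !mxE /=; field. Qed.

Lemma tetra_weights x : \sum_k ((1 + dotv (tetra_vertex k) x) / 4) = 1.
Proof. by rewrite sum4E !dotv3E !mxE /=; field. Qed.

Lemma tetra_conv x : (forall k, -1 <= dotv (tetra_vertex k) x) ->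
  conv_hull (codom tetra_vertex) x.
Proof.
move=> h; rewrite [x]tetra_decomp; apply: conv_hull_fin (tetra_weights x) => k.
  exact: codom_f.
by have := h k; lra.
Qed.

Lemma tetra_gram k l :
  dotv (tetra_vertex k) (tetra_vertex l) = if k == l then 3 else -1.
Proof.
by move: k l; apply: ord4_ind; apply: ord4_ind; rewrite dotv3E !mxE /=; ring.
Qed.

Lemma tetra_polar : polar (conv_hull (codom tetra_vertex)) = conv_hull (codom tetra_dual).
Proof.
rewrite polar_conv_hull; apply/seteqP; split=> [y h|y hy _ /codomP [k ->]].
  have yE : y = \sum_k ((1 + dotv (tetra_vertex k) (- y)) / 4) *: tetra_dual k.
    rewrite -[LHS]opprK [in LHS](tetra_decomp (- y)) -sumrN.
    by apply: eq_bigr => k _; rewrite scalerN.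
  rewrite yE; apply: conv_hull_fin (tetra_weights (- y)) => k; first exact: codom_f.
  by have := h _ (codom_f _ k); rewrite dotvNr; lra.
apply: conv_hull_le hy => _ /codomP [l ->]; rewrite dotvNr tetra_gram.
by case: ifP => _; lra.
Qed.

Lemma tetra_disks : exists Q : set 'rV[R]_3, [/\ tetrahedral Q id,
    packing Q id = range (fun k => cap (point_vec (tetra_vertex k)))
  & exists2 g : 'I_4 -> hat R 2 -> hat R 2,
        apollonian_group Q id = generated (range g)
      & forall i, acts (refl (point_vec (tetra_dual i))) (g i)].
Proof.
exists (conv_hull (codom tetra_vertex)).
have [] := @planar_packing R _ _ tetra_dual tetra_vertex 3 3 tetra_polar.
- by move=> k; rewrite /sqnorm tetra_gram eqxx.
- by move=> k; rewrite /sqnorm dotvNl dotvNr opprK tetra_gram eqxx.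
- by lra.
- by lra.
- apply: (@interior_cube _ _ _ (1 / 3)); first by lra.
  move=> x hx; apply: tetra_conv => k; have h0 := hx (o3 0); have h1 := hx (o3 1).
  have h2 := hx (o3 2); rewrite !ltr_norml in h0 h1 h2.
  case/andP: h0 => ? ?; case/andP: h1 => ? ?; case/andP: h2 => ? ?.
  by move: k; apply: ord4_ind; rewrite dotv3E !mxE /=; lra.
- move=> k l kl; left; rewrite tetra_gram; case: eqP => [e|_]; last by ring.
  by case: kl; rewrite e.
move=> h1 h2 h3; split=> //; split=> //.
suff -> : conv_hull (codom tetra_vertex) = std_tetrahedron R by exact: comb_equiv_refl.
apply: eq_conv_hull => x; apply/codomP/idP => [[k ->]|].
  by move: k; apply: ord4_ind; rewrite !inE /tetra_vertex /= eqxx ?orbT.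
rewrite !inE => /or4P[] /eqP ->; [exists (o4 0)|exists (o4 1)|exists (o4 2)|exists (o4 3)];
  by [].
Qed.

Let r : R := Num.sqrt 2.

Lemma sqrt2_sqr : r * r = 2.
Proof. by rewrite -expr2 sqr_sqrtr. Qed.

Lemma sqrt2_gt0 : 0 < r.
Proof. by rewrite sqrtr_gt0. Qed.

Lemma sqrt2_inv : r^-1 = r / 2.
Proof.
have r0 : r != 0 := lt0r_neq0 sqrt2_gt0.
by apply: (mulfI r0); rewrite mulfV // mulrA sqrt2_sqr mulfV.
Qed.

(** The scales [r] here and [r / 2] for the cube give squared norms [q = 2] and [q = 3 / 2] with
    product [2 - q] along edges, so that edges touch the unit sphere; they also make the two
    polytopes polar to each other. *)
Definition octa_vertex (k : 'I_3 * bool) : 'rV[R]_3 := r *: cross_vertex R k.1 k.2.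

Definition cube_vertex (k : bool * bool * bool) : 'rV[R]_3 :=
  (r / 2) *: vec3 (sgn R k.1.1) (sgn R k.1.2) (sgn R k.2).

Lemma cross_vertex_coord (i j : 'I_3) b :
  cross_vertex R i b 0 j = if j == i then sgn R b else 0.
Proof. by rewrite !mxE eqxx /=; case: eqP => _; rewrite ?mulr1 ?mulr0. Qed.

Lemma cube_conv x : (forall i b, sgn R b * x 0 i <= r / 2) ->
  conv_hull (codom cube_vertex) x.
Proof.
(* The weight of a vertex is the product over the axes of the linear interpolation weights. *)
move=> h; pose w (k : bool * bool * bool) : R := (1 + sgn R k.1.1 * (r * x 0 (o3 0))) / 2 *
  ((1 + sgn R k.1.2 * (r * x 0 (o3 1))) / 2) * ((1 + sgn R k.2 * (r * x 0 (o3 2))) / 2).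
have w0 (b : bool) i : 0 <= (1 + sgn R b * (r * x 0 i)) / 2.
  have e : r * (r / 2) = 1 by rewrite mulrA sqrt2_sqr mulfV.
  have := ler_wpM2l (ltW sqrt2_gt0) (h i (~~ b)); rewrite sgnN e; lra.
have -> : x = \sum_k w k *: cube_vertex k.
  have rr := sqrt2_sqr.
  rewrite sum_bool3E; apply: row3_ext; rewrite !mxE /= /w /= !sgn1.
  - transitivity ((r * r) * x 0 (o3 0) / 2); first by rewrite rr; field.
    by field.
  - transitivity ((r * r) * x 0 (o3 1) / 2); first by rewrite rr; field.
    by field.
  - transitivity ((r * r) * x 0 (o3 2) / 2); first by rewrite rr; field.
    by field.
apply: conv_hull_fin => [k|k|]; first exact: codom_f.
  by apply: mulr_ge0 (w0 _ _); apply: mulr_ge0.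
by rewrite sum_bool3E /w /= !sgn1; field.
Qed.

Lemma abs_sgn (t : R) : exists b, `|t| = sgn R b * t.
Proof.
have [t0|t0] := leP 0 t; first by exists false; rewrite sgn1 mul1r ger0_norm.
by exists true; rewrite sgn1 mulN1r ltr0_norm.
Qed.

Lemma octa_conv x : (forall k, dotv (cube_vertex k) x <= 1) ->
  conv_hull (codom octa_vertex) x.
Proof.
move=> h; have r0 : r != 0 := lt0r_neq0 sqrt2_gt0.
pose S := 1 - (`|x 0 (o3 0)| + `|x 0 (o3 1)| + `|x 0 (o3 2)|) * (r / 2).
have S0 : 0 <= S.
  have [b0 e0] := abs_sgn (x 0 (o3 0)); have [b1 e1] := abs_sgn (x 0 (o3 1)).
  have [b2 e2] := abs_sgn (x 0 (o3 2)); have := h (b0, b1, b2).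
  by rewrite dotvZl dotv3E !mxE /= -e0 -e1 -e2 /S; lra.
(* Each coordinate is carried by the vertex of its sign, with weight [|x i| / r]; the remaining
   weight [S] is spread evenly over the six vertices, which sum to 0. *)
pose w (k : 'I_3 * bool) : R :=
  (`|x 0 k.1| + sgn R k.2 * x 0 k.1) * (r / 4) + S / 6.
have -> : x = \sum_k w k *: octa_vertex k.
  have rr := sqrt2_sqr.
  rewrite sum_ord3_boolE; apply: row3_ext; rewrite !mxE /= /w /= !sgn1.
  - transitivity ((r * r) * x 0 (o3 0) / 2); first by rewrite rr; field.
    by field.
  - transitivity ((r * r) * x 0 (o3 1) / 2); first by rewrite rr; field.
    by field.
  - transitivity ((r * r) * x 0 (o3 2) / 2); first by rewrite rr; field.
    by field.
apply: conv_hull_fin => [k|k|]; first exact: codom_f.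
  rewrite /w addr_ge0 ?divr_ge0 // mulr_ge0 ?divr_ge0 ?(ltW sqrt2_gt0) //.
  case: (k.2); rewrite sgn1 ?mulN1r ?mul1r.
    by rewrite subr_ge0 ler_norm.
  by have := ler_norm (- x 0 k.1); rewrite normrN; lra.
by rewrite sum_ord3_boolE /w /= !sgn1 /S; field.
Qed.

Lemma dotv_octa_vertex k x : dotv (octa_vertex k) x = r * (sgn R k.2 * x 0 k.1).
Proof. by rewrite dotvZl dotvC dotv_cross_vertex. Qed.

Lemma octa_cube_le k l : dotv (octa_vertex k) (cube_vertex l) <= 1.
Proof.
have e : r * (r / 2) = 1 by rewrite mulrA sqrt2_sqr mulfV.
have h (b c : bool) : r * (sgn R b * (r / 2 * sgn R c)) <= 1.
  by rewrite mulrCA [r * (_ * _)]mulrA e mul1r sgnM sgn_le1.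
by rewrite dotv_octa_vertex; case: k => i b; move: i; apply: ord3_ind; rewrite !mxE /=; apply: h.
Qed.

Lemma octa_polar : polar (conv_hull (codom octa_vertex)) = conv_hull (codom cube_vertex).
Proof.
rewrite polar_conv_hull; apply/seteqP; split=> [y h|y hy _ /codomP [k ->]].
  apply: cube_conv => i b; have := h _ (codom_f _ (i, b)); rewrite dotv_octa_vertex /=.
  by rewrite -[r / 2]sqrt2_inv -[_^-1]mul1r ler_pdivlMr ?sqrt2_gt0 // mulrC.
by apply: conv_hull_le hy => _ /codomP [l ->]; exact: octa_cube_le.
Qed.

Lemma cube_polar : polar (conv_hull (codom cube_vertex)) = conv_hull (codom octa_vertex).
Proof.
rewrite polar_conv_hull; apply/seteqP; split=> [y h|y hy _ /codomP [k ->]].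
  by apply: octa_conv => k; exact: h (codom_f _ k).
by apply: conv_hull_le hy => _ /codomP [l ->]; rewrite dotvC; exact: octa_cube_le.
Qed.

Lemma sqnorm_octa k : sqnorm (octa_vertex k) = 2.
Proof.
rewrite /sqnorm dotv_octa_vertex mxE cross_vertex_coord eqxx.
by rewrite (mulrCA (sgn R k.2)) sgn_sqr mulr1 sqrt2_sqr.
Qed.

Lemma cube_gram k l : dotv (cube_vertex k) (cube_vertex l) =
  (sgn R (k.1.1 (+) l.1.1) + sgn R (k.1.2 (+) l.1.2) + sgn R (k.2 (+) l.2)) / 2.
Proof.
have e : r / 2 * (r / 2) = 2^-1.
  by rewrite mulrACA sqrt2_sqr mulrA mulfV // mul1r.
rewrite dotvZl dotvZr mulrA e mulrC dotv3E !mxE /= !sgnM.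
by [].
Qed.

Lemma sqnorm_cube k : sqnorm (cube_vertex k) = 3 / 2.
Proof. by rewrite /sqnorm cube_gram !addbb sgn1; field. Qed.

Lemma cube_vertex_inj : injective cube_vertex.
Proof.
have rn : r / 2 != 0 by rewrite -sqrt2_inv invr_eq0 lt0r_neq0 // sqrt2_gt0.
have sI (b c : bool) : sgn R b = sgn R c -> b = c.
  by move/(congr1 ( *%R (sgn R c))); rewrite sgn_sqr sgnM => /sgn_eq1; case: b c => -[].
move=> [[k1 k2] k3] [[l1 l2] l3] /(scalerI rn) /rowP h.
have := h (o3 0); have := h (o3 1); have := h (o3 2).
by rewrite !mxE /= => /sI -> /sI -> /sI ->.
Qed.

Lemma interior_octa : interior (conv_hull (codom octa_vertex)) 0.
Proof.
apply: (@interior_cube _ _ _ (r / 3)); first by rewrite divr_gt0 ?sqrt2_gt0.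
move=> x hx; apply: octa_conv => k; rewrite dotvZl dotv3E !mxE /=.
have h (b : bool) i : sgn R b * x 0 i <= r / 3.
  have := hx i; rewrite ltr_norml => /andP[? ?].
  by case: b; rewrite sgn1; lra.
have e : r / 2 * r = 1 by rewrite mulrAC sqrt2_sqr mulfV.
rewrite -[leRHS]e ler_pM2l ?divr_gt0 ?sqrt2_gt0 //.
by have := h k.1.1 (o3 0); have := h k.1.2 (o3 1); have := h k.2 (o3 2); lra.
Qed.

Lemma octa_disks : exists Q : set 'rV[R]_3, [/\ octahedral Q id,
    packing Q id = range (fun k => cap (point_vec (octa_vertex k)))
  & exists2 g : bool * bool * bool -> hat R 2 -> hat R 2,
        apollonian_group Q id = generated (range g)
      & forall i, acts (refl (point_vec (cube_vertex i))) (g i)].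
Proof.
exists (conv_hull (codom octa_vertex)).
have [] := @planar_packing R _ _ cube_vertex octa_vertex 2 (3 / 2) octa_polar.
- exact: sqnorm_octa.
- exact: sqnorm_cube.
- by lra.
- by lra.
- exact: interior_octa.
- move=> [i b] [j c] kl; rewrite dotv_octa_vertex [octa_vertex (j, c) 0 _]mxE /=.
  rewrite cross_vertex_coord; case: eqP => [ij|_]; last by left; rewrite !mulr0 subrr.
  (* Antipodal vertices: a pair on another axis has the same midpoint 0. *)
  right; subst j.
  have cb : c = ~~ b.
    by case: b c kl => -[].
  have [i' i'i] : exists i' : 'I_3, i' != i.
    by move: i {kl}; apply: ord3_ind; [exists (o3 1)|exists (o3 0)|exists (o3 0)].
  have nn b1 b2 : octa_vertex (i', b1) <> octa_vertex (i, b2).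
    by move=> /(scalerI (lt0r_neq0 sqrt2_gt0)) /cross_vertex_inj /= e; rewrite e eqxx in i'i.
  exists (i', b), (i', ~~ b); split=> //.
  by rewrite cb /octa_vertex /cross_vertex /= sgnN !scaleNr !scalerN !subrr.
move=> h1 h2 h3; split=> //; split=> //.
have -> : conv_hull (codom octa_vertex) = [set r *: x | x in std_cross_polytope R 3].
  rewrite /std_cross_polytope -conv_hull_scale; apply: eq_conv_hull => x.
  apply/codomP/mapP => [[k ->]|[y /cross_seqP [i [b ->]] ->]]; last by exists (i, b).
  by exists (cross_vertex R k.1 k.2) => //; apply/cross_seqP; exists k.1, k.2.
exact: comb_equiv_scale sqrt2_gt0.
Qed.

Lemma cube_disks : exists Q : set 'rV[R]_3, [/\ cubical Q id,
    packing Q id = range (fun k => cap (point_vec (cube_vertex k)))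
  & exists2 g : 'I_3 * bool -> hat R 2 -> hat R 2,
        apollonian_group Q id = generated (range g)
      & forall i, acts (refl (point_vec (octa_vertex i))) (g i)].
Proof.
exists (conv_hull (codom cube_vertex)).
have r0 : 0 < r / 2 by rewrite divr_gt0 ?sqrt2_gt0.
have [] := @planar_packing R _ _ octa_vertex cube_vertex (3 / 2) 2 cube_polar.
- exact: sqnorm_cube.
- exact: sqnorm_octa.
- by lra.
- by lra.
- apply: (@interior_cube _ _ _ (r / 2)) => // x hx; apply: cube_conv => i b.
  have := hx i; rewrite ltr_norml => /andP[? ?].
  by case: b; rewrite sgn1; lra.
- move=> [[k1 k2] k3] [[l1 l2] l3] kl.
  (* One differing sign is an edge. With two or three, exchanging one differing sign between the two
     vertices gives another pair with the same midpoint. *)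
  have [e1|n1] := eqVneq k1 l1; have [e2|n2] := eqVneq k2 l2.
  + left; rewrite cube_gram /= e1 e2 !addbb.
    have -> : k3 (+) l3 = true.
      by case: (k3 =P l3) => [e3|]; [case: kl; rewrite e1 e2 e3|case: (k3) (l3) => -[]].
    by rewrite !sgn1; field.
  + have [e3|n3] := eqVneq k3 l3.
      left; rewrite cube_gram /= e1 e3 !addbb.
      have -> : k2 (+) l2 = true by case: (k2) (l2) n2 => -[].
      by rewrite !sgn1; field.
    right; exists (l1, l2, k3), (k1, k2, l3); split.
    * by apply: row3_ext; rewrite !mxE /=; ring.
    * by move=> /cube_vertex_inj /(congr1 (fun k => k.1.2)) /= e; rewrite e eqxx in n2.
    * by move=> /cube_vertex_inj /(congr1 snd) /= e; rewrite e eqxx in n3.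
  + have [e3|n3] := eqVneq k3 l3.
      left; rewrite cube_gram /= e2 e3 !addbb.
      have -> : k1 (+) l1 = true by case: (k1) (l1) n1 => -[].
      by rewrite !sgn1; field.
    right; exists (l1, l2, k3), (k1, k2, l3); split.
    * by apply: row3_ext; rewrite !mxE /=; ring.
    * by move=> /cube_vertex_inj /(congr1 (fun k => k.1.1)) /= e; rewrite e eqxx in n1.
    * by move=> /cube_vertex_inj /(congr1 snd) /= e; rewrite e eqxx in n3.
  + right; exists (l1, k2, k3), (k1, l2, l3); split.
    * by apply: row3_ext; rewrite !mxE /=; ring.
    * by move=> /cube_vertex_inj /(congr1 (fun k => k.1.1)) /= e; rewrite e eqxx in n1.
    * by move=> /cube_vertex_inj /(congr1 (fun k => k.1.2)) /= e; rewrite e eqxx in n2.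
move=> h1 h2 h3; split=> //; split=> //.
have -> : conv_hull (codom cube_vertex) = [set (r / 2) *: x | x in std_cube R 3].
  apply/seteqP; split=> [x hx|_ [y hy <-]]; last first.
    apply: cube_conv => i b; rewrite mxE mulrCA -[leRHS]mulr1 ler_pM2l //.
    by have := hy i => /andP[? ?]; case: b; rewrite sgn1; lra.
  exists ((r / 2)^-1 *: x); last by rewrite scalerA mulfV ?scale1r // lt0r_neq0.
  have h i b : sgn R b * x 0 i <= r / 2.
    rewrite -dotv_cross_vertex dotvC; apply: conv_hull_le hx => _ /codomP [k ->].
    rewrite dotvC dotv_cross_vertex; move: i; apply: ord3_ind;
      by rewrite !mxE /= mulrCA sgnM ler_piMr ?sgn_le1 // ltW.
  move=> i; rewrite mxE mulrC ler_pdivrMr // ler_pdivlMr //.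
  by have := h i true; have := h i false; rewrite !sgn1; lra.
exact: comb_equiv_scale.
Qed.

End PlanarPolytopes.

(** * Sections *)

Section ReflectionPair.
Variables (R : realType) (d : nat) (r : R) (X n : lor R d).
Hypotheses (rr : r * r = 2) (XX : lf X X = 1) (nn : lf n n = 1) (Xn : lf X n = 0).

(** The unit vectors [(X + n) / sqrt 2] and [(X - n) / sqrt 2] are orthogonal and span the plane of
    [X] and [n]. The two reflections compose to minus the identity on that plane, just as the
    reflections in [X] and in [n] do. *)
Lemma refl_pair_orthogonal Y : lf Y n = 0 ->
  refl ((r / 2) *: (X + 1 *: n)) (refl ((r / 2) *: (X + -1 *: n)) Y) = refl X Y.
Proof.
move=> Yn; rewrite /refl !(lfDl, lfDr, lfNl, lfNr, lfZl, lfZr) (lfC n X) Xn Yn nn XX.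
by lor_expand; field: rr.
Qed.

Lemma refl_pair_normal :
  refl ((r / 2) *: (X + 1 *: n)) (refl ((r / 2) *: (X + -1 *: n)) n) = -1 *: n.
Proof.
rewrite /refl !(lfDl, lfDr, lfNl, lfNr, lfZl, lfZr) (lfC n X) Xn nn XX.
by lor_expand; field: rr.
Qed.

End ReflectionPair.

Section Embedding.
Variables (R : realType) (F0 F1 F2 F3 n : lor R 3).

Definition orthonormal5 :=
  [/\ lf F0 F0 = -1, lf F1 F1 = 1, lf F2 F2 = 1, lf F3 F3 = 1 & lf n n = 1] /\
  ([/\ lf F0 F1 = 0, lf F0 F2 = 0, lf F0 F3 = 0 & lf F0 n = 0] /\
   [/\ lf F1 F2 = 0, lf F1 F3 = 0 & lf F1 n = 0]) /\
  [/\ lf F2 F3 = 0, lf F2 n = 0 & lf F3 n = 0].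

(** [(b, s, t)] is read in the orthonormal coordinates of [lift_sphere], where [s] and [t] are the
    sum and the difference of the time coordinate and the last space coordinate. *)
Definition embed (y : lor R 2) : lor R 3 :=
  y.1.1 0 ord0 *: F1 + y.1.1 0 ord_max *: F2 +
  ((y.1.2 0 0 - y.2 0 0) / 2) *: F3 + ((y.1.2 0 0 + y.2 0 0) / 2) *: F0.

Lemma embed_lift (v : 'rV[R]_3) (h : R) : embed (lift_sphere v h) =
  v 0 (o3 0) *: F1 + v 0 (o3 1) *: F2 + v 0 (o3 2) *: F3 + h *: F0.
Proof.
rewrite /embed /= !mxE.
have -> : lift ord_max ord0 = o3 0 by apply: val_inj.
have -> : lift ord_max ord_max = o3 1 by apply: val_inj.
have -> : (ord_max : 'I_3) = o3 2 by apply: val_inj.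
by congr (_ + _ *: _ + _ *: _); field.
Qed.

Lemma embed_linear : linear embed.
Proof. by move=> a x y; rewrite /embed; lor_expand; field. Qed.

Hypothesis onF : orthonormal5.

Lemma embed_lf x y : lf (embed x) (embed y) = lf x y.
Proof.
case: onF => -[h00 h11 h22 h33 hnn] [[[h01 h02 h03 h0n] [h12 h13 h1n]] [h23 h2n h3n]].
have e : dotv x.1.1 y.1.1 = x.1.1 0 ord0 * y.1.1 0 ord0 + x.1.1 0 ord_max * y.1.1 0 ord_max.
  rewrite /dotv big_ord_recr big_ord1 /=; congr (_ * _ + _ ); congr (_ _ _); exact: val_inj.
rewrite /embed !(lfDl, lfDr, lfZl, lfZr) (lfC F1 F0) (lfC F2 F0) (lfC F3 F0).
rewrite (lfC F2 F1) (lfC F3 F1) (lfC F3 F2) h00 h11 h22 h33 h01 h02 h03 h12 h13 h23.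
by rewrite /lf e; field.
Qed.

Lemma embed_n y : lf (embed y) n = 0.
Proof.
case: onF => -[h00 h11 h22 h33 hnn] [[[h01 h02 h03 h0n] [h12 h13 h1n]] [h23 h2n h3n]].
by rewrite /embed !(lfDl, lfZl) h0n h1n h2n h3n; ring.
Qed.

Lemma embed_span z : exists y a, z = embed y + a *: n.
Proof.
case: onF => -[h00 h11 h22 h33 hnn] [[[h01 h02 h03 h0n] [h12 h13 h1n]] [h23 h2n h3n]].
exists (lift_sphere (vec3 (lf z F1) (lf z F2) (lf z F3)) (- lf z F0)), (lf z n).
rewrite embed_lift !mxE /=.
apply/eqP; rewrite -subr_eq0; apply/eqP.
apply: (@lor3_orthogonal_basis _ F0 F1 F2 F3 n) => //.
- by rewrite h00; apply/eqP; lra.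
- by rewrite h11; apply/eqP; lra.
- by rewrite h22; apply/eqP; lra.
- by rewrite h33; apply/eqP; lra.
- by rewrite hnn; apply/eqP; lra.
- by rewrite !(lfDr, lfNr, lfZr) h00 h01 h02 h03 h0n (lfC F0 z); ring.
- by rewrite !(lfDr, lfNr, lfZr) (lfC F1 F0) h01 h11 h12 h13 h1n (lfC F1 z); ring.
- by rewrite !(lfDr, lfNr, lfZr) (lfC F2 F0) (lfC F2 F1) h02 h12 h22 h23 h2n (lfC F2 z); ring.
- rewrite !(lfDr, lfNr, lfZr) (lfC F3 F0) (lfC F3 F1) (lfC F3 F2) h03 h13 h23 h33 h3n.
  by rewrite (lfC F3 z); ring.
- rewrite !(lfDr, lfNr, lfZr) (lfC n F0) (lfC n F1) (lfC n F2) (lfC n F3).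
  by rewrite h0n h1n h2n h3n hnn (lfC n z); ring.
Qed.

Lemma refl_embed a y : refl (embed a) (embed y) = embed (refl a y).
Proof.
have h := embed_linear (- (2 * lf y a)) a y.
by rewrite /refl embed_lf addrC -scaleNr -h scaleNr addrC.
Qed.

Lemma refl_embed_n a : refl (embed a) n = 1 *: n.
Proof. by rewrite /refl lfC embed_n mulr0 scale0r subr0 scale1r. Qed.

Variables (C : lor R 3) (kappa : R).
Hypotheses (kappa0 : 0 < kappa) (Cneg : forall p, lf (null_vec p) C < 0).
Hypotheses (CF0 : lf F0 C = - kappa) (CF1 : lf F1 C = 0) (CF2 : lf F2 C = 0)
  (CF3 : lf F3 C = 0).

(** [C] may lie outside the span: products with the span see only its projection, the image of
    [lift_sphere 0 kappa], which is again time-like. In the tetrahedral case [C] is not orthogonal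
    to [n] and [kappa = sqrt 2]; in the other two [F0 = C]. *)
Lemma embed_alg_equiv (I K : Type) (T : I -> lor R 3 -> lor R 3)
    (f : I -> hat R 3 -> hat R 3) (a : I -> lor R 2) (g : I -> hat R 2 -> hat R 2)
    (E : K -> lor R 3) (w : K -> lor R 2) (rho chi : R) (eta : K -> R) :
  (forall i, isometry (T i)) -> (forall i, acts (T i) (f i)) ->
  (forall i, lf (a i) (a i) = 1) -> (forall i, acts (refl (a i)) (g i)) ->
  (forall i y, T i (embed y) = embed (refl (a i) y)) ->
  chi * chi = 1 -> (forall i, T i n = chi *: n) ->
  0 < rho -> (forall k, lf (w k) (w k) = 1) ->
  (forall k, E k = rho *: embed (w k) + eta k *: n) ->
  (forall s, word (fun i => refl (a i)) s =1 id -> chi ^+ size s = 1) ->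
  (forall s k l, word (fun i => refl (a i)) s (w k) = w l ->
     chi ^+ size s * eta k = eta l) ->
  alg_equiv (generated (range f)) (range (fun k => cap (E k)))
            (generated (range g)) (range (fun k => cap (w k))) /\
  (forall i, involutive (f i)).
Proof.
move=> iT af a1 ag TJ chi2 Tn rho0 w1 EE par col.
have TK i : involutive (T i).
  move=> z; have [y [t ->]] := embed_span z; have TD (x1 x2 : lor R 3) :
    T i (x1 + t *: x2) = T i x1 + t *: T i x2 by rewrite addrC (iT i).1 addrC.
  by rewrite !TD !TJ Tn (linear_scale _ _ (iT i).1) Tn (scalerA chi) chi2 scale1r reflK.
split; last by move=> i; exact: acts_involutive (iT i).1 (TK i) (af i).
apply: (@section_alg_equiv _ _ _ embed n C (lift_sphere 0 kappa) T f a g E w rho chi eta)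
  => //.
- exact: embed_linear.
- exact: embed_lf.
- exact: embed_n.
- exact: embed_span.
- move=> y; have [v [h ->]] := lift_sphere_surj y; rewrite embed_lift lf_lift_sphere.
  by rewrite !(lfDl, lfZl) CF0 CF1 CF2 CF3 dotv0r; ring.
- apply: (@future_timelike _ _ _ 0 kappa) => //.
  by rewrite lf_lift_sphere dotv0l sub0r oppr_lt0 mulr_gt0.
Qed.

End Embedding.

(** * Integral invariants of words of reflections *)

Section Invariants.
Variable R : realType.
Let r : R := Num.sqrt 2.

Lemma point_vec_tetra (v : 'rV[R]_3) : sqnorm v = 3 -> point_vec v = (r / 2) *: lift_sphere v 1.
Proof.
move=> h; rewrite /point_vec h -sqrt2_inv.
by have -> : 3 - 1 = 2 :> R by ring.
Qed.

Lemma point_vec_octa k : point_vec (octa_vertex R k) = lift_sphere (octa_vertex R k) 1.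
Proof.
rewrite /point_vec sqnorm_octa; have -> : 2 - 1 = 1 :> R by ring.
by rewrite sqrtr1 invr1 scale1r.
Qed.

Lemma point_vec_cube k : point_vec (cube_vertex R k) = r *: lift_sphere (cube_vertex R k) 1.
Proof.
rewrite /point_vec sqnorm_cube; have -> : 3 / 2 - 1 = 2^-1 :> R by field.
by rewrite sqrtrV // invrK.
Qed.

Lemma lift_cube k : point_vec (cube_vertex R k) =
  lift_sphere (vec3 (sgn R k.1.1) (sgn R k.1.2) (sgn R k.2)) r.
Proof.
have rr : r * r = 2 := sqrt2_sqr R.
by rewrite point_vec_cube; lor_expand; rewrite -/r; field: rr.
Qed.

Lemma odd_half_int (k : nat) : k%:R / 2 \is a @Num.int R -> ~~ odd k.
Proof.
move=> /intrP [z e]; have : (k%:Z)%:~R = (z * 2)%:~R :> R.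
  by rewrite rmorphM /= -e divfK // pnatr_eq0.
by move/intr_inj => h; lia.
Qed.

Let intD (a b : R) : a \is a Num.int -> b \is a Num.int -> a + b \is a Num.int.
Proof. by move=> ? ?; exact: rpredD. Qed.

Let intB (a b : R) : a \is a Num.int -> b \is a Num.int -> a - b \is a Num.int.
Proof. by move=> ? ?; exact: rpredB. Qed.

Let intM (a b : R) : a \is a Num.int -> b \is a Num.int -> a * b \is a Num.int.
Proof. by move=> ? ?; exact: rpredM. Qed.

Let int_nat k : k%:R \is a @Num.int R.
Proof. exact: rpred_nat. Qed.

Lemma sgn_int b : sgn R b \is a @Num.int R.
Proof. by rewrite rpredX // rpredN rpred1. Qed.

(** The Lorentz product of the two vectors is [r * q]. Once [r] is taken out of the space
    coordinates the reflection is integral, since the time entry of the unit vector supplies a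
    second [r]. *)
Lemma refl_cube k (x y z t : R) :
  let q := sgn R k.1.1 * x + sgn R k.1.2 * y + sgn R k.2 * z - t in
  refl (point_vec (cube_vertex R k)) (lift_sphere (r *: vec3 x y z) t) =
  lift_sphere (r *: vec3 (x - 2 * q * sgn R k.1.1) (y - 2 * q * sgn R k.1.2)
                         (z - 2 * q * sgn R k.2)) (t - 4 * q).
Proof.
move=> q; have rr : r * r = 2 := sqrt2_sqr R.
rewrite /refl lift_cube lf_lift_sphere dotv3E !mxE /=.
rewrite -scaleNr -[X in X + _]scale1r lift_sphere_comb.
congr lift_sphere; last by rewrite /q; ring: rr.
by apply: row3_ext; rewrite !mxE /= /q; ring: rr.
Qed.

(* Each generator reduces modulo 4 to the same map, so the image of the time
   vector [lift_sphere 0 1] remembers the parity of the word. *)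
Lemma octa_parity (s : seq (bool * bool * bool)) :
  word (fun k => refl (point_vec (cube_vertex R k))) s =1 id -> (-1 : R) ^+ size s = 1.
Proof.
set m := fun k => _; move=> wid.
(* The invariant: [t] is odd, and [x], [y], [z] have the parity of the length of the word. *)
have [x [y [z [t [e [hx hy hz ht]]]]]] : exists x y z t : R,
    word m s (lift_sphere 0 1) = lift_sphere (r *: vec3 (2 * x) (2 * y) (2 * z)) t /\
    [/\ (x - (size s)%:R) / 2 \is a Num.int, (y - (size s)%:R) / 2 \is a Num.int,
        (z - (size s)%:R) / 2 \is a Num.int & (t - 1) / 2 \is a Num.int].
  elim: s {wid} => [|k s [x [y [z [t [e [hx hy hz ht]]]]]]] /=.
    exists 0, 0, 0, 1; split; first by congr lift_sphere; apply: row3_ext; rewrite !mxE /=; ring.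
    by rewrite !subrr mul0r rpred0.
  rewrite e /m refl_cube; set q := _ - t.
  exists (x - q * sgn R k.1.1), (y - q * sgn R k.1.2), (z - q * sgn R k.2), (t - 4 * q).
  split; first by congr lift_sphere; apply: row3_ext; rewrite !mxE /=; ring.
  have int_of (u : R) : (u - (size s)%:R) / 2 \is a Num.int -> u \is a Num.int.
    move=> hu; have -> : u = 2 * ((u - (size s)%:R) / 2) + (size s)%:R by field.
    exact: intD (intM (int_nat 2) hu) (int_nat _).
  pose p := sgn R k.1.1 * x + sgn R k.1.2 * y + sgn R k.2 * z.
  have hp : p \is a Num.int by do 2?[apply: intD]; apply: (intM (sgn_int _) (int_of _ _)).
  (* [q] is odd, so every generator changes the parity of [x], [y], [z], while [t] changes by [4 q]
     and stays odd. *)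
  have qE : q = 2 * (p - (t - 1) / 2) - 1 by rewrite /q /p; field.
  have step (u : R) b : (u - (size s)%:R) / 2 \is a Num.int ->
      (u - q * sgn R b - (size s).+1%:R) / 2 \is a Num.int.
    move=> hu; rewrite -natr1; case: b; rewrite sgn1.
      have -> : (u - q * -1 - ((size s)%:R + 1)) / 2 =
        (u - (size s)%:R) / 2 + (p - (t - 1) / 2) - 1 by rewrite qE; field.
      exact: intB (intD hu (intB hp ht)) (int_nat 1).
    have -> : (u - q * 1 - ((size s)%:R + 1)) / 2 =
      (u - (size s)%:R) / 2 - (p - (t - 1) / 2) by rewrite qE; field.
    exact: intB hu (intB hp ht).
  split; [exact: step|exact: step|exact: step|].
  have -> : (t - 4 * q - 1) / 2 = (t - 1) / 2 - 2 * q by field.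
  rewrite qE; apply: (intB ht (intM (int_nat 2) (intB _ (int_nat 1)))).
  exact: intM (int_nat 2) (intB hp ht).
have x0 : x = 0.
  have r0 : r * 2 != 0 by rewrite mulf_neq0 ?pnatr_eq0 // lt0r_neq0 // sqrt2_gt0.
  have := congr1 (fun A : lor R 2 => A.1.1 0 ord0) e; rewrite wid /= !mxE /= mulrA => /esym/eqP.
  by rewrite mulf_eq0 (negPf r0) => /eqP.
have : - ((x - (size s)%:R) / 2) \is a Num.int by rewrite rpredN.
rewrite x0 sub0r mulNr opprK => /odd_half_int.
by rewrite -signr_odd => /negPf ->.
Qed.

(* Reflecting in a face of the cube changes the coordinates by multiples
   of [4], so they are remembered modulo [4]. *)
Lemma cube_orbit (s : seq ('I_3 * bool)) k l :
  word (fun i => refl (point_vec (octa_vertex R i))) s (point_vec (cube_vertex R k)) =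
  point_vec (cube_vertex R l) -> k = l.
Proof.
set m := fun i => _; pose v : 'rV[R]_3 := vec3 (sgn R k.1.1) (sgn R k.1.2) (sgn R k.2).
(* The time entry is tracked as an integer multiple of [r]: the product with the reflecting vector
   is then [r q] with [q] an integer, and the entries [r] of [octa_vertex] make the change
   [2 r q r = 4 q] up to sign. *)
have [x [t [e [hx ht]]]] : exists (x : 'rV[R]_3) (t : R),
    word m s (point_vec (cube_vertex R k)) = lift_sphere x (r * t) /\
    (forall i, (x 0 i - v 0 i) / 4 \is a Num.int) /\ t \is a Num.int.
  elim: s => [|[j b] s [x [t [e [hx ht]]]]] /=.
    exists v, 1; rewrite lift_cube mulr1; split=> //.
    by split=> [i|]; rewrite ?rpred1 // subrr mul0r rpred0.
  have rr : r * r = 2 := sqrt2_sqr R.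
  have vi i : v 0 i \is a Num.int.
    by move: i; apply: ord3_ind; rewrite !mxE /= sgn_int.
  have xi i : x 0 i \is a Num.int.
    have -> : x 0 i = 4 * ((x 0 i - v 0 i) / 4) + v 0 i by field.
    exact: intD (intM (int_nat 4) (hx i)) (vi i).
  pose q := sgn R b * x 0 j - t.
  have hq : q \is a Num.int by exact: intB (intM (sgn_int b) (xi j)) ht.
  exists (x - (2 * r * q) *: octa_vertex R (j, b)), (t - 2 * q); split.
    rewrite e /m point_vec_octa /refl lf_lift_sphere dotvC dotv_octa_vertex /=.
    rewrite -scaleNr -[X in X + _]scale1r lift_sphere_comb scale1r -[in RHS]scaleNr.
    by congr (lift_sphere (_ + _ *: _) _); rewrite /q -/r; ring.
  split=> [i|]; last exact: intB ht (intM (int_nat 2) hq).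
  rewrite mxE [(- _ : 'rV_3) 0 i]mxE [(_ *: octa_vertex _ _) 0 i]mxE [octa_vertex _ _ 0 i]mxE.
  rewrite cross_vertex_coord -/r.
  have -> (c : R) : (x 0 i - 2 * r * q * (r * c) - v 0 i) / 4 =
    (x 0 i - v 0 i) / 4 - q * c by field: rr.
  apply: (intB (hx i) (intM hq _)).
  by case: ifP => _; [exact: sgn_int|exact: (int_nat 0)].
rewrite e lift_cube => e'.
have ev : x = vec3 (sgn R l.1.1) (sgn R l.1.2) (sgn R l.2).
  exact: lift_sphere_inj e'.
have sI (b c : bool) : (sgn R c - sgn R b) / 4 \is a Num.int -> b = c.
  move=> h; have := @odd_half_int 1.
  case: b c h => -[] //; rewrite !sgn1.
    have -> : (1 - -1) / 4 = 1 / 2 :> R by field.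
    by move=> h /(_ h).
  have -> : (-1 - 1) / 4 = - (1 / 2) :> R by field.
  by rewrite rpredN => h /(_ h).
have := hx (o3 0); have := hx (o3 1); have := hx (o3 2); rewrite ev !mxE /=.
move=> /sI h3 /sI h2 /sI h1.
by case: k l h1 h2 h3 {v hx e e' ev} => [[? ?] ?] [[? ?] ?] /= -> -> ->.
Qed.

End Invariants.

Lemma apollonian_section_range (R : realType) (d : nat) (P : set 'rV[R]_d.+1)
    (mu : hat R d -> hat R d) (I K : Type) (f : I -> hat R d -> hat R d)
    (b : K -> set (hat R d)) :
  (forall i, involutive (f i)) -> (forall i, apollonian_group P mu (f i)) ->
  (forall k, packing P mu (b k)) ->
  apollonian_section P mu (generated (range f)) (range b) /\
  ball_orbit (generated (range f)) (range b) `<=` apollonian_packing P mu.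
Proof.
move=> fK fP bP.
have sub : generated (range f) `<=` apollonian_group P mu.
  by apply: generated_sub => _ [i _ <-]; exact: fP.
split; first by split=> //; [exact: subgroup_generated|move=> _ [k _ <-]; exact: bP].
by move=> _ [g [_ [/sub hg [k _ <-] ->]]]; exists g, (b k).
Qed.

Section Sections.
Variables (R : realType) (P : set 'rV[R]_4) (mu : hat R 3 -> hat R 3).
Variables (C : lor R 3) (U : 'I_4 -> lor R 3).
Hypotheses (fr : frame C U) (packE : forall i b, packing P mu (cap (C + sgn R b *: U i)))
  (groupA : forall e, exists2 f, apollonian_group P mu f & acts (refl (facet_vec C U e)) f).
Let r : R := Num.sqrt 2.

Let rr : r * r = 2 := sqrt2_sqr R.

Let CC : lf C C = -1. Proof. by case: fr. Qed.
Let CU i : lf C (U i) = 0. Proof. by case: fr. Qed.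
Let UC i : lf (U i) C = 0. Proof. by rewrite lfC CU. Qed.
Let UU i j : lf (U i) (U j) = if i == j then 2 else 0. Proof. by case: fr. Qed.

Ltac frame_ring := rewrite ?(lfDl, lfDr, lfNl, lfNr, lfZl, lfZr) ?UC ?CC ?CU ?UU /=; field: rr.

Ltac frame_vec := lor_expand; rewrite -?/r; field: rr.

Let Cneg : forall p, lf (null_vec p) C < 0.
Proof. by case: fr. Qed.

Let r0 : 0 < r := sqrt2_gt0 R.

Definition has_section (shape : set 'rV[R]_3 -> (hat R 2 -> hat R 2) -> Prop) :=
  exists (G : set (hat R 3 -> hat R 3)) (X : set (set (hat R 3))),
    [/\ apollonian_section P mu G X, ball_orbit G X `<=` apollonian_packing P mu
      & exists (Q : set 'rV[R]_3) (nu : hat R 2 -> hat R 2),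
          shape Q nu /\ alg_equiv G X (apollonian_group Q nu) (packing Q nu)].

Lemma tetrahedral_section : has_section (@tetrahedral R).
Proof.
(* The projection of [C] off [n], scaled to norm -1. [F1], [F2], [F3] take their signs from the
   three coordinates of the tetrahedron's vertices. *)
pose F0 := (r / 4) *: (4 *: C + (U (o4 0) + U (o4 1) + U (o4 2) + U (o4 3))).
pose F1 := (r / 4) *: (U (o4 0) + U (o4 1) - U (o4 2) - U (o4 3)).
pose F2 := (r / 4) *: (U (o4 0) - U (o4 1) + U (o4 2) - U (o4 3)).
pose F3 := (r / 4) *: (U (o4 0) - U (o4 1) - U (o4 2) + U (o4 3)).
pose n := C + 2^-1 *: (U (o4 0) + U (o4 1) + U (o4 2) + U (o4 3)).
have onF : orthonormal5 F0 F1 F2 F3 n.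
  rewrite /orthonormal5 /F0 /F1 /F2 /F3 /n.
  by split; [split|split; [split|]]; try split; frame_ring.
have [Q [tQ pQ [g gQ ag]]] := tetra_disks R.
(* The facet that differs from [n] in the sign of [U k] only; it is orthogonal to [n], so its
   reflection fixes [n]. *)
have /choice [f fP] (k : 'I_4) : exists f, apollonian_group P mu f /\
    acts (refl (facet_vec C U (fun i => i == k))) f.
  by have [f ? ?] := groupA (fun i => i == k); exists f.
have sq3 k : sqnorm (tetra_vertex R k) = 3 by rewrite /sqnorm tetra_gram eqxx.
have sq3' k : sqnorm (tetra_dual R k) = 3.
  by rewrite /sqnorm dotvNl dotvNr opprK tetra_gram eqxx.
have JZ (t : R) y : embed F0 F1 F2 F3 (t *: y) = t *: embed F0 F1 F2 F3 y.
  by apply: linear_scale; exact: embed_linear.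
have AE k : facet_vec C U (fun i => i == k) =
    embed F0 F1 F2 F3 (point_vec (tetra_dual R k)).
  rewrite point_vec_tetra // JZ embed_lift.
  rewrite /facet_vec sum4E /F0 /F1 /F2 /F3.
  by move: k; apply: ord4_ind; rewrite /tetra_dual /= !mxE /= !sgn1; frame_vec.
have EE k : C + sgn R false *: U k =
    1 *: embed F0 F1 F2 F3 (point_vec (tetra_vertex R k)) + 0 *: n.
  rewrite point_vec_tetra // JZ embed_lift.
  rewrite scale1r scale0r addr0 /F0 /F1 /F2 /F3.
  by move: k; apply: ord4_ind; rewrite /tetra_vertex /= !mxE /= !sgn1; frame_vec.
have a1 k : lf (point_vec (tetra_dual R k)) (point_vec (tetra_dual R k)) = 1.
  by rewrite point_vec1 // sq3'; lra.
have [||||||||||||||||aeq fK] := @embed_alg_equiv R F0 F1 F2 F3 n onF C r r0 Cneg _ _ _ _ _ _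
  (fun k => refl (facet_vec C U (fun i => i == k))) f (fun k => point_vec (tetra_dual R k)) g
  (fun k => C + sgn R false *: U k) (fun k => point_vec (tetra_vertex R k)) 1 1 (fun=> 0).
- by rewrite /F0; frame_ring.
- by rewrite /F1; frame_ring.
- by rewrite /F2; frame_ring.
- by rewrite /F3; frame_ring.
- by move=> k; apply: refl_isometry; exact: facet_vec1.
- by move=> k; have [] := fP k.
- exact: a1.
- exact: ag.
- by move=> k y; rewrite AE (refl_embed onF).
- by rewrite mulr1.
- by move=> k; rewrite AE (refl_embed_n onF).
- exact: ltr01.
- by move=> k; rewrite point_vec1 // sq3; lra.
- exact: EE.
- by move=> s _; rewrite expr1n.
- by move=> s k l _; rewrite mulr0.
have [h1 h2] := apollonian_section_range fK (fun k => (fP k).1) (fun k => packE k false).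
exists (generated (range f)), (range (fun k => cap (C + sgn R false *: U k))).
by split=> //; exists Q, id; split=> //; rewrite pQ gQ.
Qed.

Let oct_sign (k : bool * bool * bool) (b : bool) (i : 'I_4) : bool :=
  nth false [:: k.1.1; k.1.2; k.2; b] i.

Lemma octahedral_section : has_section (@octahedral R).
Proof.
pose F1 := (r / 2) *: U (o4 0); pose F2 := (r / 2) *: U (o4 1).
pose F3 := (r / 2) *: U (o4 2); pose n := (r / 2) *: U (o4 3).
have onF : orthonormal5 C F1 F2 F3 n.
  rewrite /orthonormal5 /F1 /F2 /F3 /n.
  by split; [split|split; [split|]]; try split; frame_ring.
have [Q [tQ pQ [g gQ ag]]] := octa_disks R.
pose A k b := facet_vec C U (oct_sign k b).
(* A single facet reflection moves the sphere, as the facet vector has a component along [n]; the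
   product with the mirror facet preserves the sphere and reverses [n]. *)
pose T k := refl (A k false) \o refl (A k true).
have /choice [f fP] (k : bool * bool * bool) :
    exists f, apollonian_group P mu f /\ acts (T k) f.
  have [f1 h1 a1] := groupA (oct_sign k false).
  have [f2 h2 a2] := groupA (oct_sign k true).
  exists (f1 \o f2); split; first exact: gen_comp.
  by apply: acts_comp a1 a2; apply: (refl_isometry _).1; exact: facet_vec1.
pose a k := point_vec (cube_vertex R k).
pose J := embed C F1 F2 F3.
have AE k b : A k b = (r / 2) *: (J (a k) + sgn R b *: n).
  rewrite /a lift_cube /J embed_lift /A /facet_vec sum4E /F1 /F2 /F3 /n !mxE /=.
  by frame_vec.
pose idx (i : 'I_3) : 'I_4 := nth (o4 0) [:: o4 0; o4 1; o4 2] i.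
have EE (k : 'I_3 * bool) : C + sgn R k.2 *: U (idx k.1) =
    1 *: J (point_vec (octa_vertex R k)) + 0 *: n.
  rewrite point_vec_octa /J embed_lift /F1 /F2 /F3 /octa_vertex !mxE.
  by case: k => i b; move: i; apply: ord3_ind; rewrite /idx /= ?mulr0 ?mulr1; frame_vec.
have a1 k : lf (a k) (a k) = 1 by rewrite point_vec1 // sqnorm_cube; lra.
have nn : lf n n = 1 by case: onF => -[].
have Jn y : lf (J y) n = 0 by exact: (embed_n onF).
have JJ x y : lf (J x) (J y) = lf x y by exact: (embed_lf onF).
have [||||||||||||||||aeq fK] := @embed_alg_equiv R C F1 F2 F3 n onF C 1 ltr01 Cneg _ _ _ _ _ _
  T f a g (fun k => C + sgn R k.2 *: U (idx k.1)) (fun k => point_vec (octa_vertex R k))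
  1 (-1) (fun=> 0).
- exact: CC.
- by rewrite /F1; frame_ring.
- by rewrite /F2; frame_ring.
- by rewrite /F3; frame_ring.
- by move=> k; apply: isometry_comp; apply: refl_isometry; exact: facet_vec1.
- by move=> k; have [] := fP k.
- exact: a1.
- exact: ag.
- move=> k y; rewrite /T /= !AE !sgn1 refl_pair_orthogonal ?JJ ?a1 ?Jn //.
  exact: (refl_embed onF).
- by ring.
- by move=> k; rewrite /T /= !AE !sgn1 refl_pair_normal ?JJ ?a1 ?Jn.
- exact: ltr01.
- by move=> k; rewrite point_vec1 // sqnorm_octa; lra.
- exact: EE.
- exact: octa_parity.
- by move=> s k l _; rewrite mulr0.
have [h1 h2] := apollonian_section_range fK (fun k => (fP k).1) (fun k => packE (idx k.1) k.2).
exists (generated (range f)), (range (fun k => cap (C + sgn R k.2 *: U (idx k.1)))).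
by split=> //; exists Q, id; split=> //; rewrite pQ gQ.
Qed.

(* The three pairs of opposite facets of the cross-polytope used here cut its
   eight vertices as the faces of a cube do. *)
Let cube_sign (k : 'I_3 * bool) (i : 'I_4) : bool :=
  k.2 (+) nth false (nth [::] [:: [:: false; false; false; false];
    [:: false; false; true; true]; [:: false; true; false; true]] k.1) i.

(** Reversing all three signs keeps the index, so antipodal vertices of the cube go to antipodal
    vertices of the cross-polytope, told apart by the sign [k.1.1]. *)
Let cube_index (k : bool * bool * bool) : 'I_4 :=
  nth (o4 0) [:: o4 0; o4 1; o4 2; o4 3] ((k.1.1 (+) k.1.2).*2 + (k.1.1 (+) k.2))%N.

Lemma cubical_section : has_section (@cubical R).
Proof.
pose F1 := (r / 4) *: (U (o4 0) + U (o4 1) + U (o4 2) + U (o4 3)).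
pose F2 := (r / 4) *: (U (o4 0) + U (o4 1) - U (o4 2) - U (o4 3)).
pose F3 := (r / 4) *: (U (o4 0) - U (o4 1) + U (o4 2) - U (o4 3)).
pose n := (r / 4) *: (U (o4 0) - U (o4 1) - U (o4 2) + U (o4 3)).
have onF : orthonormal5 C F1 F2 F3 n.
  rewrite /orthonormal5 /F1 /F2 /F3 /n.
  by split; [split|split; [split|]]; try split; frame_ring.
have [Q [tQ pQ [g gQ ag]]] := cube_disks R.
have /choice [f fP] (k : 'I_3 * bool) : exists f, apollonian_group P mu f /\
    acts (refl (facet_vec C U (cube_sign k))) f.
  by have [f ? ?] := groupA (cube_sign k); exists f.
have AE k : facet_vec C U (cube_sign k) = embed C F1 F2 F3 (point_vec (octa_vertex R k)).
  rewrite point_vec_octa embed_lift /F1 /F2 /F3 /facet_vec sum4E /octa_vertex !mxE.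
  case: k => i b; move: i; apply: ord3_ind; rewrite /cube_sign /= ?addbF ?addbT ?sgnN;
    by frame_vec.
(* The sign is the parity of the cube vertex: four of the eight balls are tilted to each side of the
   sphere. *)
pose eta (k : bool * bool * bool) : R := r / 2 * (sgn R k.1.1 * sgn R k.1.2 * sgn R k.2).
have EE k : C + sgn R k.1.1 *: U (cube_index k) =
    (r / 2) *: embed C F1 F2 F3 (point_vec (cube_vertex R k)) + eta k *: n.
  rewrite lift_cube embed_lift /F1 /F2 /F3 /n /eta !mxE /=.
  by case: k => [[[] []] []]; rewrite /cube_index /= !sgn1; frame_vec.
have [||||||||||||||||aeq fK] := @embed_alg_equiv R C F1 F2 F3 n onF C 1 ltr01 Cneg _ _ _ _ _ _
  (fun k => refl (facet_vec C U (cube_sign k))) f (fun k => point_vec (octa_vertex R k)) g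
  (fun k => C + sgn R k.1.1 *: U (cube_index k)) (fun k => point_vec (cube_vertex R k))
  (r / 2) 1 eta.
- exact: CC.
- by rewrite /F1; frame_ring.
- by rewrite /F2; frame_ring.
- by rewrite /F3; frame_ring.
- by move=> k; apply: refl_isometry; exact: facet_vec1.
- by move=> k; have [] := fP k.
- by move=> k; rewrite point_vec1 // sqnorm_octa; lra.
- exact: ag.
- by move=> k y; rewrite AE (refl_embed onF).
- by rewrite mulr1.
- by move=> k; rewrite AE (refl_embed_n onF).
- by rewrite divr_gt0.
- by move=> k; rewrite point_vec1 // sqnorm_cube; lra.
- exact: EE.
- by move=> s _; rewrite expr1n.
- by move=> s k l /cube_orbit ->; rewrite expr1n mul1r.
have [h1 h2] := apollonian_section_range fK (fun k => (fP k).1)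
  (fun k => packE (cube_index k) k.1.1).
exists (generated (range f)), (range (fun k => cap (C + sgn R k.1.1 *: U (cube_index k)))).
by split=> //; exists Q, id; split=> //; rewrite pQ gQ.
Qed.

End Sections.

Theorem theorem4 (R : realType) (P : set 'rV[R]_4) (mu : hat R 3 -> hat R 3)
    (hP : orthoplicial P mu) :
  [/\ exists (G : set (hat R 3 -> hat R 3)) (X : set (set (hat R 3))),
        [/\ apollonian_section P mu G X,
            ball_orbit G X `<=` apollonian_packing P mu
          & exists (Q : set 'rV[R]_3) (nu : hat R 2 -> hat R 2),
              tetrahedral Q nu /\
              alg_equiv G X (apollonian_group Q nu) (packing Q nu)],
      exists (G : set (hat R 3 -> hat R 3)) (X : set (set (hat R 3))),
        [/\ apollonian_section P mu G X,
            ball_orbit G X `<=` apollonian_packing P mu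
          & exists (Q : set 'rV[R]_3) (nu : hat R 2 -> hat R 2),
              octahedral Q nu /\
              alg_equiv G X (apollonian_group Q nu) (packing Q nu)]
    & exists (G : set (hat R 3 -> hat R 3)) (X : set (set (hat R 3))),
        [/\ apollonian_section P mu G X,
            ball_orbit G X `<=` apollonian_packing P mu
          & exists (Q : set 'rV[R]_3) (nu : hat R 2 -> hat R 2),
              cubical Q nu /\
              alg_equiv G X (apollonian_group Q nu) (packing Q nu)]].
Proof.
have [C [U [fr packE groupA]]] := orthoplicial_frame hP; split.
- exact: (tetrahedral_section fr packE groupA).
- exact: (octahedral_section fr packE groupA).
- exact: (cubical_section fr packE groupA).
Qed.
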